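(* For every $1<p<\infty$ there is a constant $b_p\in(0,1/4)$ depending only on $p$ such that the following holds. Let $n\ge 2$ and $L\ge 1$ be integers and let $\vec\omega=\{\omega_l\}_{l=1}^L\subset \mathbb{S}^{n-1}$ be a set consisting of $L$ (distinct) points. Then there exist constants $\lambda_1,\ldots,\lambda_L\in\mathbb{R}$ such that the sets $$D_l:=\left\{\omega\in\mathbb{S}^{n-1}\ \Big|\ |\omega-\omega_l|^p+\lambda_l\leq \min_{1\leq k\leq L}\left(|\omega-\omega_k|^p+\lambda_k\right) \right\},\qquad 1\le l\le L,$$ form an equal area partition of $\mathbb{S}^{n-1}$ up to null sets, i.e. $\bigcup_{l=1}^L D_l=\mathbb{S}^{n-1}$, $\sigma_{n-1}(D_l\cap D_k)=0$ for $l\ne k$, and $\sigma_{n-1}(D_l)=1/L$ for every $l$, and such that $$\max_{1\leq l \leq L}\operatorname{diam}_{\mathbb{R}^{n}}(D_l)\leq \frac{2}{b_p}\cdot\left\{\frac{|\mathbb{S}^{n-2}|}{n-1}\left(\frac{b_p (1-b_p^2)^{\frac12} }{\arcsin b_p } \right)^{n-2}\right\}^{-\frac{1}{n-1+p}}\cdot \mathrm{MK}_p^{\mathbb{R}^{n}}(\sigma_{n-1}, \nu_{\vec\omega})^{\frac{p}{n-1+p}},$$ where $\sigma_{n-1}$ and $\nu_{\vec\omega}$ are regarded as probability measures on $\mathbb{R}^n$.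
   Context: $\mathbb{S}^{n-1}$ is the standard unit sphere in $\mathbb{R}^n$, $|\cdot|$ (applied to vectors) is the Euclidean norm on $\mathbb{R}^n$, and $\sigma_{n-1}$ is the Riemannian volume measure on $\mathbb{S}^{n-1}$ normalized to be a probability measure. $|\mathbb{S}^{n-2}|$ is the $(n-2)$-dimensional Hausdorff measure of $\mathbb{S}^{n-2}$ (so $|\mathbb{S}^0|=2$). $\operatorname{diam}_{\mathbb{R}^n}(A)$ is the Euclidean diameter of $A$. For $\vec\omega=\{\omega_l\}_{l=1}^L$, $\nu_{\vec\omega}:=\frac1L\sum_{l=1}^L\delta_{\omega_l}$. For Borel probability measures $\mu,\nu$ on $\mathbb{R}^n$ with finite $p$th moment, $$\mathrm{MK}^{\mathbb{R}^n}_p(\mu, \nu):=\inf_{\gamma\in \Pi(\mu, \nu)}\left(\int_{\mathbb{R}^n\times \mathbb{R}^n} |x-y|^p\,d\gamma(x, y)\right)^{1/p},$$ where $\Pi(\mu,\nu)$ is the set of Borel probability measures on $\mathbb{R}^n\times\mathbb{R}^n$ with left and right marginals $\mu$ and $\nu$. *)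

(* Defs.v *)
From HB Require Import structures.
From mathcomp Require Import all_boot all_order all_algebra.
From mathcomp Require Import all_classical all_reals all_analysis.

Set Implicit Arguments.
Unset Strict Implicit.
Unset Printing Implicit Defensive.

Import Order.TTheory GRing.Theory Num.Theory.
Import numFieldNormedType.Exports.

Local Open Scope classical_set_scope.
Local Open Scope ring_scope.

(* R^n is 'rV[R]_n. The library norm on 'rV[R]_n is the sup norm: it induces the
   usual topology, but the Euclidean norm has to be defined. *)
Definition enorm {R : realType} {n : nat} (x : 'rV[R]_n) : R :=
  Num.sqrt (\sum_(i < n) x 0 i ^+ 2).

(* sphere R n is the unit sphere of R^n, i.e. S^(n-1). *)
Definition sphere (R : realType) (n : nat) : set 'rV[R]_n :=
  [set x | enorm x = 1].
Arguments sphere : clear implicits.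

Definition open_ball (R : realType) (n : nat) : set 'rV[R]_n :=
  [set x | enorm x < 1].
Arguments open_ball : clear implicits.

(* The added 0 only matters for the empty set, whose diameter is 0. *)
Definition diam {R : realType} {n : nat} (A : set 'rV[R]_n) : \bar R :=
  ereal_sup (0%E |` [set (enorm (x - y))%:E | x in A & y in A]).

(* R^n with its Borel sigma-algebra *)
Definition borel_rV (R : realType) (n : nat) :=
  g_sigma_algebraType (@open 'rV[R]_n).

(* Lebesgue measure on R^m, carried by m.-tuple R, by iterated products of the
   Lebesgue measure of the line. *)
Section lebesgue_tuple.
Context {R : realType}.

Definition tuple_cons m (x : R * m.-tuple R) : m.+1.-tuple R :=
  [tuple of x.1 :: x.2].

Lemma measurable_tuple_cons m : measurable_fun setT (@tuple_cons m).
Proof. exact: (measurable_cons measurable_fst measurable_snd). Qed.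

Section step.
Variables (m : nat) (mu : {sigma_finite_measure set (m.-tuple R) -> \bar R}).

Definition lebesgue_step : set (m.+1.-tuple R) -> \bar R :=
  pushforward (@lebesgue_measure R \x mu)%E (@tuple_cons m).

Let step0 : lebesgue_step set0 = 0%E.
Proof. by rewrite /lebesgue_step /pushforward preimage_set0 measure0. Qed.

Let step_ge0 A : (0 <= lebesgue_step A)%E.
Proof. by rewrite /lebesgue_step /pushforward; apply: measure_ge0. Qed.

Let step_sigma_additive : semi_sigma_additive lebesgue_step.
Proof.
have mcons := @measurable_tuple_cons m.
move=> F mF tF mUF; rewrite /lebesgue_step /pushforward preimage_bigcup.
apply: measure_semi_sigma_additive.
- by move=> n; rewrite -[X in measurable X]setTI; exact: mcons.
- apply/trivIsetP => /= i j _ _ ij; rewrite -preimage_setI.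
  by move/trivIsetP : tF => /(_ _ _ _ _ ij) ->//; rewrite preimage_set0.
- by rewrite -preimage_bigcup -[X in measurable X]setTI; exact: mcons.
Qed.

HB.instance Definition _ := isMeasure.Build _ _ _ lebesgue_step
  step0 step_ge0 step_sigma_additive.

Let step_sigma_finite : sigma_finite setT lebesgue_step.
Proof.
pose uncons (t : m.+1.-tuple R) := (thead t, [tuple of behead t]).
have consK : cancel (@tuple_cons m) uncons.
  by case=> a t; congr pair; apply: val_inj.
have unconsK : cancel uncons (@tuple_cons m).
  by move=> t; rewrite [RHS]tuple_eta.
have muncons : measurable_fun setT uncons.
  apply: measurable_fun_pair; last exact: measurable_behead.
  exact: measurable_tnth.
have /sigma_finiteP[F [TF ndF Foo]] := sigma_finiteT (@lebesgue_measure R).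
have /sigma_finiteP[G [TG ndG Goo]] := sigma_finiteT mu.
exists (fun k => uncons @^-1` (F k `*` G k)) => [|k].
  rewrite -preimage_bigcup -(preimage_setT uncons); congr (_ @^-1` _).
  apply/seteqP; split=> // -[x y] _.
  have [i _ Fx] : (\bigcup_k F k) x by rewrite -TF.
  have [j _ Gy] : (\bigcup_k G k) y by rewrite -TG.
  exists (maxn i j) => //; split => /=.
    by move: Fx; exact/subsetPset/ndF/leq_maxl.
  by move: Gy; exact/subsetPset/ndG/leq_maxr.
have [mF Fk] := Foo k; have [mG Gk] := Goo k; split.
  by rewrite -[X in measurable X]setTI; apply: muncons => //; exact: measurableX.
rewrite /lebesgue_step /pushforward -comp_preimage.
rewrite (_ : uncons \o _ = id) ?preimage_id; last exact/funext.
by rewrite product_measure1E// lte_mul_pinfty// ge0_fin_numE.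
Qed.

HB.instance Definition _ := Measure_isSigmaFinite.Build _ _ _ lebesgue_step
  step_sigma_finite.

End step.

Fixpoint lebesgue_tuple (m : nat) :
    {sigma_finite_measure set (m.-tuple R) -> \bar R} :=
  if m is m'.+1 then lebesgue_step (lebesgue_tuple m') else \d_([tuple]).

End lebesgue_tuple.

Definition row_of_tuple {R : realType} {m : nat} (t : m.-tuple R) : 'rV[R]_m :=
  \row_(i < m) tnth t i.

Definition ball_volume (R : realType) (m : nat) : \bar R :=
  lebesgue_tuple m [set t : m.-tuple R | enorm (row_of_tuple t) <= 1].

(* The m-dimensional Hausdorff measure for the Euclidean distance, normalized so
   as to coincide with Lebesgue measure on R^m; for m = 0 it is the counting
   measure (0 ^+ 0 = 1, whence the special case of the empty set). *)
Section hausdorff.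
Context {R : realType} {n : nat}.
Variable m : nat.

Definition hausdorff_gauge (E : set 'rV[R]_n) : \bar R :=
  if E == set0 then 0%E
  else (ball_volume R m * ((fine (diam E) / 2) ^+ m)%:E)%E.

Definition hausdorff_pre (delta : R) (A : set 'rV[R]_n) : \bar R :=
  ereal_inf [set (\sum_(0 <= k <oo) hausdorff_gauge (F k))%E |
    F in [set F : (set 'rV[R]_n)^nat |
      A `<=` \bigcup_k F k /\ forall k, (diam (F k) <= delta%:E)%E]].

Definition hausdorff_measure (A : set 'rV[R]_n) : \bar R :=
  ereal_sup [set hausdorff_pre delta A | delta in [set d : R | 0 < d]].

End hausdorff.

(* For a parametrization f of a submanifold, injective on U, the Riemannian
   volume of A `&` f @` U for the metric induced by the Euclidean one is the
   integral of sqrt(det g) over the parameters, with g_ij = <d_i f, d_j f>.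
   The rows of jacobian f x are the d_i f. *)
Definition gram {R : realType} {m n : nat} (f : 'rV[R]_m -> 'rV[R]_n)
    (x : 'rV[R]_m) : 'M[R]_m :=
  jacobian f x *m (jacobian f x)^T.

Definition chart_volume {R : realType} {m n : nat}
    (f : 'rV[R]_m -> 'rV[R]_n) (U : set 'rV[R]_m) (A : set 'rV[R]_n) : \bar R :=
  (\int[lebesgue_tuple m]_(t in row_of_tuple @^-1` (U `&` f @^-1` A))
     (Num.sqrt (\det (gram f (row_of_tuple t))))%:E)%E.

Section sphere_volume.
Variables (R : realType) (n : nat).

(* The parametrization of the open hemisphere {0 < (-1)^s * x_i} of S^(n-1) as a
   graph over the open unit ball of the hyperplane {x_i = 0}. *)
Definition hemisphere_chart (i : 'I_n) (s : bool) (x : 'rV[R]_n.-1) : 'rV[R]_n :=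
  \row_(j < n) if unlift i j is Some k then x 0 k
               else (-1) ^+ s * Num.sqrt (1 - enorm x ^+ 2).

(* The points of the hemisphere (i, s) whose first nonzero coordinate is the
   i-th: these 2n sets partition the sphere. *)
Definition hemisphere_piece (i : 'I_n) (s : bool) : set 'rV[R]_n :=
  [set x | [/\ sphere R n x, 0 < (-1) ^+ s * x 0 i &
              forall j : 'I_n, (j < i)%N -> x 0 j = 0]].

(* The volume of a Borel set A of R^n is that of its intersection with S^(n-1):
   the sum of the volumes computed in the charts over a partition subordinate to
   the hemisphere atlas. *)
Definition sphere_volume (A : set (borel_rV R n)) : \bar R :=
  (\sum_(i < n) \sum_(s : bool)
     chart_volume (hemisphere_chart i s) (open_ball R n.-1)
       (A `&` hemisphere_piece i s))%E.

Definition sphere_probability (A : set (borel_rV R n)) : \bar R :=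
  (sphere_volume A * ((fine (sphere_volume (sphere R n)))^-1)%:E)%E.

End sphere_volume.

Definition empirical {R : realType} {n L : nat} (w : 'I_L -> 'rV[R]_n)
    (A : set (borel_rV R n)) : \bar R :=
  ((L%:R^-1)%:E * \sum_(l < L) \d_(w l : borel_rV R n) A)%E.

Definition coupling {R : realType} {n : nat}
    (mu nu : set (borel_rV R n) -> \bar R) :
    set (probability (borel_rV R n * borel_rV R n)%type R) :=
  [set g | forall A : set (borel_rV R n), measurable A ->
     g (A `*` setT) = mu A /\ g (setT `*` A) = nu A].

Definition MK {R : realType} {n : nat} (p : R)
    (mu nu : set (borel_rV R n) -> \bar R) : \bar R :=
  ereal_inf
    [set poweR (\int[g]_z (enorm ((z.1 : 'rV[R]_n) - z.2) `^ p)%:E)%E p^-1 |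
      g in coupling mu nu].

Definition laguerre_cell {R : realType} {n L : nat} (p : R)
    (w : 'I_L -> 'rV[R]_n) (lambda : 'I_L -> R) (l : 'I_L) : set 'rV[R]_n :=
  [set x | sphere R n x /\
     ((enorm (x - w l) `^ p + lambda l)%:E <=
        \big[mine/+oo]_(k < L) (enorm (x - w k) `^ p + lambda k)%:E)%E].

(* Main.v *)
Require Import Defs.
From HB Require Import structures.
From mathcomp Require Import all_boot all_order all_algebra.
From mathcomp Require Import all_classical all_reals all_analysis.
From mathcomp Require Import measurable_realfun.
From mathcomp Require Import ring lra.

Set Implicit Arguments.
Unset Strict Implicit.
Unset Printing Implicit Defensive.

Import Order.TTheory GRing.Theory Num.Theory.
Import numFieldNormedType.Exports.

Local Open Scope classical_set_scope.
Local Open Scope ring_scope.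

(* All that matters about b is that it is small: the quantity in braces is at most
   16 ^ (n - 1), so it is enough to find C depending only on p such that
   |x - w_l| <= C * MK ^ (p / (n - 1 + p)) for every x in D_l.
   A level set of |x - w_k|^p - |x - w_l|^p is negligible on the sphere: for the
   level 0 it lies in a hyperplane, and otherwise the regular points on a line of
   some chart are isolated, while (|x - w_k|, |x - w_l|) takes a single value at the
   critical points. Hence weights maximizing the dual Kantorovich functional give
   cells of mass 1 / L.
   Put r = |x - w_l|, and join x to w_l by a chain of N points of the sphere with
   steps of length O(r / N). If near each of them there were a point moved by less
   than r / N to the center of its cell, cyclical monotonicity would give
   r^p = O(N (r / N)^p), which is false for N large, as 1 < p. So all the points of
   some cap of radius r / N are moved by at least r / N. The cap has measure at
   least (c r / N)^(n - 1), and by weak duality MK^p >= (c r / N)^(n - 1 + p). *)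

(** * Lebesgue measure on tuples *)

(** The dimension n is arbitrary while b may depend on p only. This is affordable because every
    estimate ends under a root of order m + p, where m = n - 1: a loss of the form C ^ m costs at
    most a factor C. So no area is computed exactly. The area of a piece of a hemisphere is
    compared, up to a factor 2 ^ (m + 1), with the Lebesgue volume of the cone over it between the
    radii 1/2 and 1; disjoint balls are packed in this cone, and the volume of the unit ball cancels
    between a cap and the whole sphere. One ball of radius about r would give r ^ (m + 1); lining up
    about 1 / r of them restores the exponent m. The powers of 16 add up as follows: a cap of radius
    r has measure at least (r / 16 ^ 3) ^ m, and the braces cost a factor 1 / 16, whence b = 1 / (16
    ^ 4 N), where the number N of steps of the chain satisfies 2 N (9 / N) ^ p < 1. The condition 1
    < p serves twice: such an N exists, and the equation of the critical points of a tie, at two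
    points at squared distances d1 and d2, says that t ^ (p - 1) (4 - t) agrees at t = d1 and t =
    d2; for 1 < p the logarithm of this function is strictly concave. *)

Section image_measure.
Local Open Scope ereal_scope.
Context d1 d2 (X : measurableType d1) (Y : measurableType d2) (R : realType).

Definition image_measure (mu : {measure set X -> \bar R}) (phi : X -> Y)
    (mphi : measurable_fun [set: X] phi) : {measure set Y -> \bar R}.
Proof. by refine (pushforward mu phi : {measure set Y -> \bar R}). Defined.

Lemma image_measureE (mu : {measure set X -> \bar R}) (phi : X -> Y)
    (mphi : measurable_fun [set: X] phi) (A : set Y) :
  image_measure mu mphi A = mu (phi @^-1` A).
Proof. by []. Qed.

Lemma ge0_integral_image_measure (phi : X -> Y)
    (mu : {measure set X -> \bar R}) (nu : {measure set Y -> \bar R})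
    (f : Y -> \bar R) : measurable_fun [set: X] phi ->
  (forall A, measurable A -> nu A = mu (phi @^-1` A)) ->
  measurable_fun [set: Y] f -> (forall y, 0 <= f y) ->
  \int[nu]_y f y = \int[mu]_x f (phi x).
Proof.
move=> mphi numu mf f0.
rewrite -[RHS](@ge0_integral_pushforward _ _ _ _ _ _ mphi mu setT f)//.
by apply: eq_measure_integral => A mA _; rewrite numu.
Qed.

End image_measure.

Section density.
Local Open Scope ereal_scope.
Context d (T : measurableType d) (R : realType).
Variables (mu : {measure set T -> \bar R}) (f : T -> R).
Hypotheses (mf : measurable_fun setT f) (f0 : forall x, (0 <= f x)%R).

(** The two proofs are arguments of the set function so that its measure structure can be inferred
    from the term itself. *)
Definition density_measure of measurable_fun [set: T] f & forall x, (0 <= f x)%R :=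
  fun A : set T => \int[mu]_(x in A) (f x)%:E.

Let m0 : density_measure mf f0 set0 = 0.
Proof. by rewrite /density_measure integral_set0. Qed.

Let m_ge0 A : 0 <= density_measure mf f0 A.
Proof. by apply: integral_ge0 => x _; rewrite lee_fin. Qed.

Let m_sigma_additive : semi_sigma_additive (density_measure mf f0).
Proof.
move=> F mF tF mUF; rewrite /density_measure ge0_integral_bigcup//; first last.
- by move=> x _; rewrite lee_fin.
- by apply/measurable_EFinP; exact: measurable_funTS.
by apply: is_cvg_ereal_nneg_natsum_cond => n _ _; exact: m_ge0.
Qed.

HB.instance Definition _ := isMeasure.Build _ _ _ (density_measure mf f0)
  m0 m_ge0 m_sigma_additive.

End density.

Section lebesgue_line.
Local Open Scope ereal_scope.
Context {R : realType}.
Notation mu := (@lebesgue_measure R).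

(** By uniqueness of Lebesgue measure: its image under x |-> c x + a, multiplied by c, has the right
    value on half-open intervals. *)
Lemma ge0_integral_affine (a c : R) (f : R -> \bar R) : (0 < c)%R ->
  measurable_fun [set: R] f -> (forall y, 0 <= f y) ->
  \int[mu]_x f (c * x + a)%R = (c^-1)%:E * \int[mu]_x f x.
Proof.
move=> c0 mf f0.
pose phi (x : measurableTypeR R) : measurableTypeR R := (c * x + a)%R.
have mphi : measurable_fun setT phi.
  by apply: measurable_funD => //; exact: measurable_funM.
have c0' : (0 <= c)%R by exact: ltW.
pose nu : {measure set _ -> \bar R} := mscale (NngNum c0') (image_measure mu mphi).
have muE A : measurable A -> mu A = nu A.
  apply: lebesgue_measure_unique => _ [[x y]] _ <-.
  rewrite /nu /= /mscale image_measureE /=.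
  have -> : phi @^-1` `]x, y]%classic = `](((x - a) / c)%R), (((y - a) / c)%R)]%classic.
    apply/seteqP; split => z /=; rewrite !in_itv/= /phi;
    by rewrite ltr_pdivrMr// ler_pdivlMr// ltrBlDr lerBrDr mulrC.
  rewrite !lebesgue_measure_itv/= !lte_fin.
  rewrite ltr_pM2r ?invr_gt0// ltrD2r; case: ifPn => //; last by rewrite mule0.
  move=> xy; rewrite -!EFinB -EFinM; congr EFin.
  by field; rewrite gt_eqF.
have -> : \int[mu]_x f x = \int[nu]_x f x.
  by apply: eq_measure_integral => A mA _; exact: muE.
rewrite ge0_integral_mscale// muleA -EFinM mulVf ?gt_eqF// mul1e.
by rewrite (ge0_integral_image_measure (mu:=mu) mphi).
Qed.

End lebesgue_line.

Section tuple_fubini.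
Context {R : realType}.
Notation mu := (@lebesgue_measure R).
Notation lt := (@lebesgue_tuple R).
Local Open Scope ereal_scope.

Lemma ge0_integral_tupleS m (f : m.+1.-tuple R -> \bar R) :
  measurable_fun [set: m.+1.-tuple R] f -> (forall t, 0 <= f t) ->
  \int[lt m.+1]_t f t = \int[mu]_x \int[lt m]_t f [tuple of x :: t].
Proof.
move=> mf f0.
rewrite (ge0_integral_image_measure (mu := mu \x lt m) (@measurable_tuple_cons R m))//.
by rewrite fubini_tonelli1//; exact: measurableT_comp mf (@measurable_tuple_cons R m).
Qed.

Lemma ge0_integral_tupleS_swap m (f : m.+1.-tuple R -> \bar R) :
  measurable_fun [set: m.+1.-tuple R] f -> (forall t, 0 <= f t) ->
  \int[lt m.+1]_t f t = \int[lt m]_t \int[mu]_x f [tuple of x :: t].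
Proof.
move=> mf f0.
rewrite (ge0_integral_image_measure (mu := mu \x lt m) (@measurable_tuple_cons R m))//.
by rewrite fubini_tonelli2//; exact: measurableT_comp mf (@measurable_tuple_cons R m).
Qed.

Lemma measurable_fun_integral_tuple m (f : m.+1.-tuple R -> \bar R) :
  measurable_fun [set: m.+1.-tuple R] f -> (forall t, 0 <= f t) ->
  measurable_fun [set: R] (fun x => \int[lt m]_t f [tuple of x :: t]).
Proof.
move=> mf f0.
apply: (measurable_fun_fubini_tonelli_F (m2 := lt m) (fun z => f (tuple_cons z))) => //.
exact: measurableT_comp mf (@measurable_tuple_cons R m).
Qed.

Lemma ge0_integral_tuple0 (f : 0.-tuple R -> \bar R) :
  measurable_fun [set: 0.-tuple R] f -> \int[lt 0]_t f t = f [tuple].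
Proof. by move=> mf; rewrite integral_dirac// diracT mul1e. Qed.

Definition affine_tuple (c : R) m (a t : m.-tuple R) : m.-tuple R :=
  [tuple (c * tnth t i + tnth a i)%R | i < m].

Lemma measurable_affine_tuple c m (a : m.-tuple R) :
  measurable_fun [set: m.-tuple R] (affine_tuple c a).
Proof.
apply/measurable_fun_tnthP => i.
rewrite (_ : _ \o _ = fun t => (c * tnth t i + tnth a i)%R); last first.
  by apply/funext => t /=; rewrite tnth_mktuple.
apply: measurable_funD => //; apply: measurable_funM => //.
exact: measurable_tnth.
Qed.

Lemma affine_tupleS c m (a : m.+1.-tuple R) x (t : m.-tuple R) :
  affine_tuple c a [tuple of x :: t] =
  [tuple of (c * x + thead a)%R :: affine_tuple c [tuple of behead a] t].
Proof.
apply: eq_from_tnth => i; rewrite tnth_mktuple.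
case: (unliftP ord0 i) => [j ->|->]; last by rewrite !tnth0.
rewrite !tnthS tnth_mktuple tnth_behead.
by have -> : lift ord0 j = inord j.+1 by apply/ord_inj; rewrite lift0 inordK ?ltnS.
Qed.

Lemma ge0_integral_affine_tuple (c : R) m (a : m.-tuple R)
    (f : m.-tuple R -> \bar R) : (0 < c)%R ->
  measurable_fun [set: m.-tuple R] f -> (forall t, 0 <= f t) ->
  \int[lt m]_t f (affine_tuple c a t) = (c ^- m)%:E * \int[lt m]_t f t.
Proof.
move=> c0; elim: m a f => [|m ih] a f mf f0.
  rewrite !ge0_integral_tuple0//; last first.
    exact: measurableT_comp mf (measurable_affine_tuple _ _).
  rewrite expr0 invr1 mul1e; congr f; exact: tuple0.
rewrite !ge0_integral_tupleS//; last first.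
  exact: measurableT_comp mf (measurable_affine_tuple _ _).
have mfx x : measurable_fun [set: m.-tuple R] (fun t : m.-tuple R => f [tuple of x :: t]).
  by apply: measurableT_comp mf _; exact: measurable_cons.
have mF := measurable_fun_integral_tuple mf f0.
have F0 x : 0 <= \int[lt m]_t f [tuple of x :: t] by exact: integral_ge0.
under eq_integral => x _.
  under eq_integral do rewrite affine_tupleS.
  rewrite (ih _ (fun t => f [tuple of (c * x + thead a)%R :: t]))//.
  over.
rewrite ge0_integralZl//; last 2 first.
- apply: (measurableT_comp mF).
  by apply: measurable_funD => //; exact: measurable_funM.
- by rewrite lee_fin invr_ge0 exprn_ge0// ltW.
rewrite (ge0_integral_affine _ c0 mF F0) muleA -EFinM; congr (_%:E * _).
by rewrite exprSr invfM.
Qed.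

Definition update_tuple m (t : m.-tuple R) (j : 'I_m) (x : R) : m.-tuple R :=
  [tuple if i == j then x else tnth t i | i < m].

Lemma update_tuple_cons0 m x y (t : m.-tuple R) :
  update_tuple [tuple of y :: t] ord0 x = [tuple of x :: t].
Proof.
apply: eq_from_tnth => i; rewrite tnth_mktuple.
by case: (unliftP ord0 i) => [j ->|->]; rewrite ?tnthS//= ?tnth0.
Qed.

Lemma update_tuple_consS m j x y (t : m.-tuple R) :
  update_tuple [tuple of y :: t] (lift ord0 j) x =
  [tuple of y :: update_tuple t j x].
Proof.
apply: eq_from_tnth => i; rewrite tnth_mktuple.
case: (unliftP ord0 i) => [k ->|->]; last by rewrite !tnth0.
by rewrite !tnthS tnth_mktuple (inj_eq lift_inj).
Qed.

Lemma lebesgue_tuple_indic m (A : set (m.-tuple R)) : measurable A ->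
  lt m A = \int[lt m]_t (\1_A t)%:E.
Proof. by move=> mA; rewrite integral_indic// setIT. Qed.

(* Fubini along the j-th axis *)
Lemma lebesgue_tuple_countable_slices m (j : 'I_m) (A : set (m.-tuple R)) :
  measurable A ->
  (forall t, countable [set x | A (update_tuple t j x)]) ->
  lt m A = 0.
Proof.
elim: m j A => [[]//|m ih] j A mA cA.
have mI : measurable_fun [set: m.+1.-tuple R] (fun t => (\1_A t)%:E : \bar R).
  by apply/measurable_EFinP; exact: measurable_indic.
have I0 t : 0 <= (\1_A t)%:E :> \bar R by rewrite lee_fin.
have mcons x : measurable_fun [set: m.-tuple R] (fun t : m.-tuple R => [tuple of x :: t]).
  exact: measurable_cons.
have mcons2 (t : m.-tuple R) : measurable_fun [set: R] (fun x => [tuple of x :: t]).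
  exact: measurable_cons.
rewrite lebesgue_tuple_indic//.
(* An axis other than the first is an axis of the tail and is left to the induction; the first one
   is integrated innermost, where a countable slice has measure 0. *)
case: (unliftP ord0 j) => [k jk|j0].
  rewrite ge0_integral_tupleS// integral0_eq// => x _.
  have mAx : measurable ((fun t : m.-tuple R => [tuple of x :: t]) @^-1` A).
    by rewrite -[X in measurable X]setTI; exact: mcons.
  rewrite -[LHS](_ : lt m ((fun t : m.-tuple R => [tuple of x :: t]) @^-1` A) = _).
    apply: (ih k) => // t.
    have := cA [tuple of x :: t]; rewrite jk.
    by apply: sub_countable; apply: subset_card_le => y /=; rewrite update_tuple_consS.
  by rewrite lebesgue_tuple_indic.
rewrite ge0_integral_tupleS_swap// integral0_eq// => t _.
have mAx : measurable ((fun x : measurableTypeR R => [tuple of x :: t]) @^-1` A).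
  by rewrite -[X in measurable X]setTI; exact: mcons2.
transitivity (mu ((fun x => [tuple of x :: t]) @^-1` A)); last first.
  apply: countable_lebesgue_measure0.
  have := cA [tuple of 0%R :: t]; rewrite j0.
  by apply: sub_countable; apply: subset_card_le => y /=; rewrite update_tuple_cons0.
by have := integral_indic mu measurableT mAx; rewrite setIT => <-.
Qed.

End tuple_fubini.

(** * Euclidean norm and balls *)

Section euclidean.
Context {R : realType}.

Definition dot n (x y : 'rV[R]_n) : R := \sum_(i < n) x 0 i * y 0 i.

Section dot_theory.
Variable n : nat.
Implicit Types (x y z : 'rV[R]_n) (a : R).

Lemma dotC x y : dot x y = dot y x.
Proof. by apply: eq_bigr => i _; rewrite mulrC. Qed.

Lemma dotDl x y z : dot (x + y) z = dot x z + dot y z.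
Proof. by rewrite -big_split; apply: eq_bigr => i _; rewrite !mxE mulrDl. Qed.

Lemma dotZl a x y : dot (a *: x) y = a * dot x y.
Proof. by rewrite mulr_sumr; apply: eq_bigr => i _; rewrite !mxE mulrA. Qed.

Lemma dotDr x y z : dot x (y + z) = dot x y + dot x z.
Proof. by rewrite dotC dotDl !(dotC x). Qed.

Lemma dotZr a x y : dot x (a *: y) = a * dot x y.
Proof. by rewrite dotC dotZl dotC. Qed.

Lemma dotNl x y : dot (- x) y = - dot x y.
Proof. by rewrite -scaleN1r dotZl mulN1r. Qed.

Lemma dotNr x y : dot x (- y) = - dot x y.
Proof. by rewrite dotC dotNl dotC. Qed.

Lemma dot_ge0 x : 0 <= dot x x.
Proof. by apply: sumr_ge0 => i _; rewrite -expr2 sqr_ge0. Qed.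

Lemma enormE x : enorm x = Num.sqrt (dot x x).
Proof. by congr Num.sqrt; apply: eq_bigr => i _; rewrite expr2. Qed.

Lemma enorm_ge0 x : 0 <= enorm x. Proof. exact: sqrtr_ge0. Qed.
Hint Resolve enorm_ge0 : core.

Lemma sqr_enorm x : enorm x ^+ 2 = dot x x.
Proof. by rewrite enormE sqr_sqrtr ?dot_ge0. Qed.

Lemma enorm_eq0 x : (enorm x == 0) = (x == 0).
Proof.
apply/idP/eqP => [|->]; last first.
  by rewrite /enorm big1 ?sqrtr0// => i _; rewrite mxE expr0n.
rewrite -(sqrf_eq0 (enorm x)) sqr_enorm psumr_eq0; last first.
  by move=> i _; rewrite -expr2 sqr_ge0.
move=> /allP x0; apply/rowP => i; rewrite mxE.
by have := x0 i; rewrite mem_index_enum => /(_ isT); rewrite /= -expr2 sqrf_eq0 => /eqP.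
Qed.

Lemma enorm0 : enorm (0 : 'rV[R]_n) = 0.
Proof. by apply/eqP; rewrite enorm_eq0. Qed.

Lemma enormZ a x : enorm (a *: x) = `|a| * enorm x.
Proof.
by rewrite !enormE dotZl dotZr mulrA -expr2 sqrtrM ?sqr_ge0// sqrtr_sqr.
Qed.

Lemma enormN x : enorm (- x) = enorm x.
Proof. by rewrite -scaleN1r enormZ normrN1 mul1r. Qed.

Lemma enormBC x y : enorm (x - y) = enorm (y - x).
Proof. by rewrite -enormN opprB. Qed.

Lemma cauchy_schwarz x y : dot x y <= enorm x * enorm y.
Proof.
have [->|x0] := eqVneq x 0.
  by rewrite enorm0 mul0r -(scale0r 0) dotZl mul0r.
have [->|y0] := eqVneq y 0.
  by rewrite enorm0 mulr0 -(scale0r 0) dotZr mul0r.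
have px : 0 < enorm x by rewrite lt_neqAle eq_sym enorm_eq0 x0 enorm_ge0.
have py : 0 < enorm y by rewrite lt_neqAle eq_sym enorm_eq0 y0 enorm_ge0.
have := dot_ge0 (enorm y *: x - enorm x *: y).
rewrite dotDl !dotDr !dotNl !dotNr !dotZl !dotZr -!sqr_enorm (dotC y x).
move=> h; have {}h : 0 <= enorm x * enorm y * (enorm x * enorm y - dot x y).
  by nra.
by rewrite pmulr_rge0 ?mulr_gt0// subr_ge0 in h.
Qed.

Lemma ler_enormD x y : enorm (x + y) <= enorm x + enorm y.
Proof.
rewrite -(ler_pXn2r (ltn0Sn 1)) ?nnegrE ?addr_ge0//.
rewrite sqr_enorm dotDl !dotDr (dotC y x) sqrrD !sqr_enorm.
by have := cauchy_schwarz x y; lra.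
Qed.

Lemma ler_enormB x y : enorm (x - y) <= enorm x + enorm y.
Proof. by rewrite -(enormN y); exact: ler_enormD. Qed.

Lemma enorm_triangle y x z : enorm (x - z) <= enorm (x - y) + enorm (y - z).
Proof. by rewrite -[x - z](subrKA y) ler_enormD. Qed.

Lemma ler_dist_enorm x y : `|enorm x - enorm y| <= enorm (x - y).
Proof.
have := ler_enormD (y - x) x; have := ler_enormD (x - y) y.
rewrite !subrK (enormBC y) => h1 h2.
by rewrite ler_norml; apply/andP; split; lra.
Qed.

Lemma ler_coord_enorm x i : `|x 0 i| <= enorm x.
Proof.
rewrite -(ler_pXn2r (ltn0Sn 1)) ?nnegrE//.
rewrite sqr_enorm real_normK ?num_real// /dot (bigD1 i)//= -expr2 lerDl.
by apply: sumr_ge0 => j _; rewrite -expr2 sqr_ge0.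
Qed.

Lemma sqr_enormB x y :
  enorm (x - y) ^+ 2 = enorm x ^+ 2 + enorm y ^+ 2 - 2 * dot x y.
Proof.
rewrite !sqr_enorm dotDl !dotDr !dotNl !dotNr (dotC y x); ring.
Qed.

End dot_theory.

Lemma enorm_continuous n : continuous (@enorm R n).
Proof.
move=> x; apply: continuous_comp; last exact: sqrt_continuous.
apply: (@continuous_big _ _ _ _ _ _ _ _ (fun (i : 'I_n) (y : 'rV[R]_n) => y 0 i ^+ 2)).
  by move=> y; exact: add_continuous.
move=> i _ y; apply: (@continuous_comp _ _ _ (fun x : 'rV[R]_n => x 0 i) (fun y : R => y ^+ 2));
  [exact: coord_continuous|exact: exprn_continuous].
Qed.

Lemma measurable_fun_enorm d (T : measurableType d) n (f : T -> 'rV[R]_n) :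
  (forall i, measurable_fun [set: T] (fun t => f t 0 i)) ->
  measurable_fun [set: T] (fun t => enorm (f t)).
Proof.
move=> mf; apply: measurableT_comp.
  by apply: continuous_measurable_fun => x; exact: sqrt_continuous.
apply: measurable_sum => i.
exact/measurable_funX/mf.
Qed.

End euclidean.

Section tuple_balls.
Context {R : realType}.
Notation mu := (@lebesgue_measure R).
Notation lt := (@lebesgue_tuple R).

Definition tuple_ball n (a : 'rV[R]_n) (r : R) : set (n.-tuple R) :=
  [set t | enorm (row_of_tuple t - a) < r].

Lemma measurable_row_coord n (a : 'rV[R]_n) i :
  measurable_fun [set: n.-tuple R] (fun t => (row_of_tuple t - a) 0 i).
Proof.
rewrite (_ : (fun t => _) = (fun t => tnth t i - a 0 i)); last first.
  by apply/funext => t; rewrite !mxE.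
by apply: measurable_funB => //; exact: measurable_tnth.
Qed.

Lemma measurable_tuple_ball n (a : 'rV[R]_n) r : measurable (tuple_ball a r).
Proof.
rewrite -[X in measurable X]setTI.
have -> : tuple_ball a r =
    (fun t => enorm (row_of_tuple t - a)) @^-1` [set x | x < r].
  by [].
apply: measurable_fun_enorm => //; first exact: measurable_row_coord.
by rewrite -set_itvE.
Qed.

Lemma lebesgue_tuple_ball n (a : 'rV[R]_n) r : 0 < r ->
  (lt n (tuple_ball a r) = (r ^+ n)%:E * lt n (tuple_ball 0 1))%E.
Proof.
move=> r0; pose ta := [tuple a 0 i | i < n].
have H := @ge0_integral_affine_tuple R r n ta (fun t => (\1_(tuple_ball a r) t)%:E) r0.
rewrite lebesgue_tuple_indic; last exact: measurable_tuple_ball.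
have {}H : (\int[lt n]_t (\1_(tuple_ball a r) (affine_tuple r ta t))%:E =
  (r ^- n)%:E * \int[lt n]_t (\1_(tuple_ball a r) t)%:E)%E.
  apply: H => [|t]; last by rewrite lee_fin.
  by apply/measurable_EFinP/measurable_indic; exact: measurable_tuple_ball.
rewrite lebesgue_tuple_indic; last exact: measurable_tuple_ball.
rewrite -[LHS]mul1e -[X in (X%:E * _)%E](@mulfV _ (r ^+ n)) ?gt_eqF ?exprn_gt0//.
rewrite EFinM -muleA -H; congr (_ * _)%E.
apply: eq_integral => t _; congr (_%:E); rewrite !indicE; congr (_%:R); congr nat_of_bool.
have e : row_of_tuple (affine_tuple r ta t) - a = r *: row_of_tuple t.
  by apply/rowP => i; rewrite !mxE !tnth_mktuple addrK.
have h : (enorm (row_of_tuple (affine_tuple r ta t) - a) < r) =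
         (enorm (row_of_tuple t - 0) < 1).
  by rewrite e enormZ gtr0_norm// subr0 -{2}(mulr1 r) ltr_pM2l.
by apply/idP/idP; rewrite !inE /tuple_ball /= h.
Qed.

Definition tuple_cube n (a : 'rV[R]_n) (d : R) : set (n.-tuple R) :=
  [set t | forall i, `|tnth t i - a 0 i| <= d].

Lemma lebesgue_tuple_cube n (a : 'rV[R]_n) (d : R) : 0 <= d ->
  lt n (tuple_cube a d) = ((2 * d) ^+ n)%:E.
Proof.
move=> d0; elim: n a => [|n ih] a.
  rewrite /= diracE expr0 mem_set// => -[]//.
pose a' := \row_(i < n) a 0 (lift ord0 i).
transitivity ((mu \x lt n)%E (`[a 0 ord0 - d, a 0 ord0 + d]%classic `*` tuple_cube a' d)).
  rewrite [LHS](_ : _ = (mu \x lt n)%E (@tuple_cons R n @^-1` tuple_cube a d))//.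
  congr ((mu \x lt n)%E _); apply/seteqP; split => -[x t] /=.
    move=> h; split => /=.
      by have := h ord0; rewrite tnth0 in_itv/= ler_distl.
    by move=> i; have := h (lift ord0 i); rewrite tnthS mxE.
  move=> [/=]; rewrite in_itv/= => h1 h2 i.
  case: (unliftP ord0 i) => [k ->|->]; last by rewrite tnth0 ler_distl.
  by rewrite tnthS; have := h2 k; rewrite mxE.
rewrite product_measure1E; last 2 first.
- by [].
- rewrite (_ : tuple_cube a' d = \bigcap_(i : 'I_n) [set t | `|tnth t i - a' 0 i| <= d]); last first.
    by apply/seteqP; split => [t h i _|t h i]; exact: h.
  apply: fin_bigcap_measurable => // i _.
  rewrite -[X in measurable X]setTI.
  have -> : [set t : n.-tuple R | `|tnth t i - a' 0 i| <= d] =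
    (fun t => `|tnth t i - a' 0 i|) @^-1` [set x | x <= d] by [].
  apply: measurableT_comp => //; last by rewrite -set_itvE.
  by apply: measurable_funB => //; exact: measurable_tnth.
have hI : mu `[a 0 ord0 - d, a 0 ord0 + d]%classic = (2 * d)%:E.
  rewrite lebesgue_measure_itv/= lte_fin.
  case: ifPn => [_|]; first by rewrite -EFinB; congr (_%:E); lra.
  rewrite -leNgt => h; have e : d = 0 by apply/eqP; rewrite eq_le d0 andbT; lra.
  by rewrite e mulr0.
by rewrite exprS EFinM -(ih a'); congr (_ * _)%E; exact: hI.
Qed.

Lemma enorm_cube n (a : 'rV[R]_n) d t : 0 <= d -> tuple_cube a d t ->
  enorm (row_of_tuple t - a) ^+ 2 <= n%:R * d ^+ 2.
Proof.
move=> d0 h; rewrite sqr_enorm /dot.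
rewrite (le_trans (ler_sum _ (G := fun=> d ^+ 2) _))//; last first.
  by rewrite sumr_const card_ord mulr_natl.
by move=> i _; rewrite -expr2 !mxE -real_normK ?num_real// ler_pXn2r ?nnegrE.
Qed.

Lemma cube_enorm n (a : 'rV[R]_n) d t :
  enorm (row_of_tuple t - a) <= d -> tuple_cube a d t.
Proof.
by move=> h i; apply: le_trans h; have := ler_coord_enorm (row_of_tuple t - a) i; rewrite !mxE.
Qed.

(** The open ball is taken here, the closed one in [ball_volume]. The value is never computed: it
    cancels whenever two volumes are compared. *)
Definition unit_ball_volume n : \bar R := lt n (tuple_ball 0 1).

Lemma measurable_tuple_cube n (a : 'rV[R]_n) d : measurable (tuple_cube a d).
Proof.
rewrite (_ : tuple_cube a d = \bigcap_(i : 'I_n) [set t | `|tnth t i - a 0 i| <= d]); last first.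
  by apply/seteqP; split => [t h i _|t h i]; exact: h.
apply: fin_bigcap_measurable => // i _.
rewrite -[X in measurable X]setTI.
have -> : [set t : n.-tuple R | `|tnth t i - a 0 i| <= d] =
  (fun t => `|tnth t i - a 0 i|) @^-1` [set x | x <= d] by [].
apply: measurableT_comp => //; last by rewrite -set_itvE.
by apply: measurable_funB => //; exact: measurable_tnth.
Qed.

Lemma unit_ball_volume_gt0 n : (0 < unit_ball_volume n)%E.
Proof.
(* The cube of half-side 1 / (n + 1) lies in the ball because n < (n + 1) ^ 2. *)
have d0 : 0 < n.+1%:R^-1 :> R by rewrite invr_gt0.
apply: (@lt_le_trans _ _ (lt n (tuple_cube 0 n.+1%:R^-1))).
  by rewrite lebesgue_tuple_cube ?(ltW d0)// lte_fin exprn_gt0// mulr_gt0.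
apply: le_measure; rewrite ?inE; [exact: measurable_tuple_cube|exact: measurable_tuple_ball|].
move=> t /(enorm_cube (ltW d0)) h; rewrite /tuple_ball /=.
rewrite -(ltr_pXn2r (ltn0Sn 1)) ?nnegrE ?enorm_ge0// expr1n (le_lt_trans h)//.
rewrite exprVn ltr_pdivrMr ?exprn_gt0// mul1r.
rewrite -natrX ltr_nat expnS expn1 (leq_trans (ltnSn n))// leq_pmulr//.
Qed.

Lemma ball_volume_le n : (ball_volume R n <= (2 ^+ n)%:E)%E.
Proof.
rewrite /ball_volume -[X in (X ^+ n)%:E]mulr1 -(lebesgue_tuple_cube (0 : 'rV[R]_n))//.
apply: le_measure; rewrite ?inE; [|exact: measurable_tuple_cube|]; last first.
  by move=> t h; apply: cube_enorm; rewrite subr0.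
rewrite -[X in measurable X]setTI.
have -> : [set t : n.-tuple R | enorm (row_of_tuple t) <= 1] =
    (fun t => enorm (row_of_tuple t)) @^-1` [set x | x <= 1].
  by [].
apply: measurable_fun_enorm => //; last by rewrite -set_itvE.
by move=> i; have := measurable_row_coord 0 i; under eq_fun do rewrite subr0.
Qed.

Lemma unit_ball_volume_le n : (unit_ball_volume n <= ball_volume R n)%E.
Proof.
rewrite /ball_volume; apply: le_measure; rewrite ?inE; [exact: measurable_tuple_ball| |].
  rewrite -[X in measurable X]setTI.
  have -> : [set t : n.-tuple R | enorm (row_of_tuple t) <= 1] =
      (fun t => enorm (row_of_tuple t)) @^-1` [set x | x <= 1].
    by [].
  apply: measurable_fun_enorm => //; last by rewrite -set_itvE.
  by move=> i; have := measurable_row_coord 0 i; under eq_fun do rewrite subr0.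
by move=> t; rewrite /tuple_ball/= subr0 => /ltW.
Qed.

Lemma unit_ball_volume_fin n : unit_ball_volume n \is a fin_num.
Proof.
rewrite ge0_fin_numE ?(ltW (unit_ball_volume_gt0 _))//.
by rewrite (le_lt_trans (unit_ball_volume_le n))// (le_lt_trans (ball_volume_le n))// ltry.
Qed.

(* Disjointness of the balls of radius r around 2r-separated centers. *)
Lemma packing_measure n (s : seq 'rV[R]_n) (r : R) (A : set (n.-tuple R)) :
  0 < r -> measurable A ->
  pairwise (fun a b => 2 * r <= enorm (a - b)) s ->
  (forall a, a \in s -> tuple_ball a r `<=` A) ->
  (((size s)%:R * r ^+ n)%:E * unit_ball_volume n <= lt n A)%E.
Proof.
move=> r0; elim: s A => [|a s ih] A mA /=; first by rewrite mul0r mul0e.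
move=> /andP[/allP sa ps] sA.
have mB := measurable_tuple_ball a r.
have -> : lt n A = (lt n (tuple_ball a r) + lt n (A `\` tuple_ball a r))%E.
  rewrite -measureU//; [|exact: measurableD|by rewrite setDIK].
  by rewrite setDUK//; apply: sA; rewrite mem_head.
rewrite lebesgue_tuple_ball// -[(size s).+1]addn1 addnC natrD mulrDl mul1r EFinD.
rewrite ge0_muleDl ?lee_fin ?mulr_ge0 ?exprn_ge0 ?(ltW r0)//.
rewrite leeD// ih//; first exact: measurableD.
move=> b bs t tb; split; first by apply: sA tb; rewrite inE bs orbT.
move=> ta; have := sa _ bs; apply/negP; rewrite -ltNge.
move: ta tb; rewrite /tuple_ball /= => ta tb.
rewrite (le_lt_trans (enorm_triangle (row_of_tuple t) _ _))// mulr2n mulrDl mul1r.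
by rewrite ltrD// enormBC.
Qed.

End tuple_balls.

(** * Cones and the area of the sphere *)

Section radial_density.
Context {R : realType}.
Notation mu := (@lebesgue_measure R).

(* Density of the image of the Lebesgue measure on the positive half-line by
   x |-> sqrt (x ^+ 2 + a ^+ 2); it vanishes for r <= a since Num.sqrt is 0 on
   negative numbers and x / 0 = 0. *)
Definition radial_density (a r : R) : R :=
  Num.max 0 (r / Num.sqrt (r ^+ 2 - a ^+ 2)).

Lemma radial_density_ge0 a r : 0 <= radial_density a r.
Proof. by rewrite le_max lexx. Qed.

Lemma radial_density0 a r : r <= a -> radial_density a r = 0.
Proof.
move=> ra; rewrite /radial_density; have [r0|r0] := leP r 0.
  by apply/max_idPl; rewrite mulr_le0_ge0// invr_ge0 sqrtr_ge0.
rewrite (_ : Num.sqrt _ = 0) ?invr0 ?mulr0 ?maxxx//.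
by apply: ler0_sqrtr; rewrite subr_le0 ler_pXn2r ?nnegrE// ltW// (lt_le_trans r0).
Qed.

Lemma radial_densityE a r : 0 <= a -> a < r ->
  radial_density a r = r / Num.sqrt (r ^+ 2 - a ^+ 2).
Proof.
move=> a0 ar; apply/max_idPr; apply: divr_ge0; last exact: sqrtr_ge0.
by rewrite ltW// (le_lt_trans a0).
Qed.

Lemma measurable_fun_radial_density d (T : measurableType d) (f g : T -> R) :
  measurable_fun [set: T] f -> measurable_fun [set: T] g ->
  measurable_fun [set: T] (fun t => radial_density (f t) (g t)).
Proof.
move=> mf mg; apply: measurable_maxr => //; apply: measurable_funM => //.
under eq_fun do rewrite -powR_inv1 ?sqrtr_ge0//.
apply: (measurableT_comp (measurable_powR _)).
apply: measurableT_comp.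
  by apply: continuous_measurable_fun => x; exact: sqrt_continuous.
by apply: measurable_funB; exact: measurable_funX.
Qed.

Definition hypot (a x : R) : R := Num.sqrt (x ^+ 2 + a ^+ 2).

Lemma lt_hypot (a x y : R) : 0 <= x -> x < y -> hypot a x < hypot a y.
Proof.
move=> x0 xy; rewrite ltr_sqrt ?ltrD2r ?ltr_pXn2r ?nnegrE ?(ltW (le_lt_trans x0 xy))//.
by rewrite ltr_pwDl ?sqr_ge0// exprn_gt0// (le_lt_trans x0).
Qed.

Lemma le_hypot (a x y : R) : 0 <= x -> x <= y -> hypot a x <= hypot a y.
Proof.
move=> x0; rewrite le_eqVlt => /predU1P[->//|xy].
by rewrite ltW// lt_hypot.
Qed.

(** The primitive is sqrt (r ^ 2 - a ^ 2), whose derivative is singular at r = a; the condition 0 <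
    c keeps the interval away from this point. *)
Lemma integral_radial_density_itv (a c d : R) : 0 <= a -> 0 < c -> c <= d ->
  (\int[mu]_(r in `]hypot a c, hypot a d]) (radial_density a r)%:E = (d - c)%:E)%E.
Proof.
move=> a0 c0; rewrite le_eqVlt => /predU1P[<-|cd].
  by rewrite set_itv_ge ?bnd_simp ?ltxx// integral_set0 subrr.
have gta (r : R) : hypot a c <= r -> a < r.
  move=> h; apply: lt_le_trans h.
  rewrite -(ltr_pXn2r (ltn0Sn 1)) ?nnegrE ?sqrtr_ge0// sqr_sqrtr ?addr_ge0 ?sqr_ge0//.
  by rewrite ltrDr exprn_gt0.
rewrite integral_itv_obnd_cbnd; last first.
  by apply/measurable_EFinP; apply: measurable_funTS; exact: measurable_fun_radial_density.
have sq0 (r : R) : hypot a c <= r -> 0 < r ^+ 2 - a ^+ 2.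
  move=> h; rewrite subr_gt0 ltr_pXn2r ?nnegrE ?gta// ltW//.
  by rewrite (le_lt_trans a0)// gta.
pose F (r : R) : R := Num.sqrt (r ^+ 2 - a ^+ 2).
have cF (r : R) : {for r, continuous F}.
  apply: continuous_comp; last exact: sqrt_continuous.
  by apply: cvgB; [exact: exprn_continuous|exact: cvg_cst].
have dF (r : R) : hypot a c <= r -> is_derive r 1 F (r / Num.sqrt (r ^+ 2 - a ^+ 2)).
  move=> h; have s0 := sq0 _ h.
  have := @is_derive1_comp _ (@Num.sqrt R) (fun r => r ^+ 2 - a ^+ 2) r _ _
     (is_derive1_sqrt s0) _.
  move=> H; apply: (is_derive_eq (H _ _)).
  rewrite /GRing.scale/=.
  by field; rewrite ?gt_eqF ?sqrtr_gt0.
rewrite (@continuous_FTC2 _ _ F).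
- rewrite -EFinB; congr EFin; congr (_ - _).
    rewrite /F /hypot sqr_sqrtr ?addr_ge0 ?sqr_ge0// addrK sqrtr_sqr gtr0_norm//.
    exact: lt_trans cd.
  by rewrite /F /hypot sqr_sqrtr ?addr_ge0 ?sqr_ge0// addrK sqrtr_sqr gtr0_norm.
- by apply: lt_hypot => //; exact: ltW.
- apply: (subspace_eq_continuous (f := fun r : R => r / F r)).
    move=> r; rewrite inE/= in_itv/= => /andP[h _].
    exact/esym/radial_densityE/gta.
  apply: continuous_in_subspaceT => r; rewrite inE/= in_itv/= => /andP[h _].
  apply: cvgM; first exact: cvg_id.
  by apply: cvgV; [rewrite gt_eqF// sqrtr_gt0 sq0|exact: cF].
- split; first by move=> r; rewrite in_itv/= => /andP[/ltW h _]; have [] := dF _ h.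
    by apply: cvg_at_right_filter; exact: cF.
  by apply: cvg_at_left_filter; exact: cF.
- move=> r /[!in_itv]/= /andP[/ltW h _].
  have D := dF _ h.
  by rewrite derive1E derive_val radial_densityE// gta.
Qed.



Lemma hypot_ge a x : 0 <= a -> a <= hypot a x.
Proof.
move=> a0; rewrite -(ler_pXn2r (ltn0Sn 1)) ?nnegrE ?sqrtr_ge0//.
by rewrite sqr_sqrtr ?addr_ge0 ?sqr_ge0// lerDr sqr_ge0.
Qed.

(** The inverse of [hypot a], from ]a, +oo[ to ]0, +oo[. *)
Let psi (a r : R) : R := Num.sqrt (r ^+ 2 - a ^+ 2).

Let psiK a r : 0 <= a -> a < r -> hypot a (psi a r) = r.
Proof.
move=> a0 ar; rewrite /hypot /psi sqr_sqrtr.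
  by rewrite subrK sqrtr_sqr gtr0_norm// (le_lt_trans a0).
by rewrite subr_ge0 ler_pXn2r ?nnegrE// ltW// (le_lt_trans a0).
Qed.

Let psi_gt0 a r : 0 <= a -> a < r -> 0 < psi a r.
Proof.
move=> a0 ar; rewrite sqrtr_gt0 subr_gt0 ltr_pXn2r ?nnegrE//.
by rewrite ltW// (le_lt_trans a0).
Qed.

Let le_psi a r c : 0 <= a -> a < r -> 0 <= c ->
  (psi a r <= c) = (r <= hypot a c).
Proof.
move=> a0 ar c0; rewrite -(ler_pXn2r (ltn0Sn 1)) ?nnegrE ?sqrtr_ge0//.
rewrite sqr_sqrtr; last by rewrite subr_ge0 ler_pXn2r ?nnegrE// ltW// (le_lt_trans a0).
rewrite -[RHS](ler_pXn2r (ltn0Sn 1)) ?nnegrE ?sqrtr_ge0//; last first.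
  by rewrite ltW// (le_lt_trans a0).
by rewrite sqr_sqrtr ?addr_ge0 ?sqr_ge0// lerBlDr.
Qed.

Let measurable_psi a : measurable_fun [set: R] (psi a).
Proof.
apply: measurableT_comp.
  by apply: continuous_measurable_fun => x; exact: sqrt_continuous.
by apply: measurable_funB => //; exact: measurable_funX.
Qed.

Section fixed_radius.
Variables (a : R) (a0 : 0 <= a).

Let md : measurable_fun [set: measurableTypeR R] (radial_density a).
Proof. exact: measurable_fun_radial_density. Qed.

Let D : {measure set (measurableTypeR R) -> \bar R} :=
  density_measure mu md (radial_density_ge0 a).

Let D_gt B : measurable B -> D B = D (B `&` `]a, +oo[%classic).
Proof.
move=> mB; rewrite -[in LHS](setUIDK B `]a, +oo[%classic) measureU; last 3 first.
- exact: measurableI.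
- exact: measurableD.
- by apply/seteqP; split => // x [[_ ?] [_]].
rewrite [X in (_ + X)%E](_ : _ = 0%E) ?adde0//.
apply: integral0_eq => r [_ /=]; rewrite in_itv/= andbT => /negP; rewrite -leNgt => ra.
by rewrite radial_density0.
Qed.

(** Continuity from below along the intervals that start at [hypot a] of d / (k + 1); they exhaust
    the interval starting at a. *)
Let D_itv0 d : 0 < d -> D `]a, hypot a d]%classic = d%:E.
Proof.
move=> d0.
have hk k : 0 < d * k.+1%:R^-1 by rewrite mulr_gt0// invr_gt0.
have hkd k : d * k.+1%:R^-1 <= d by rewrite ler_piMr ?(ltW d0)// invf_le1// ler1n.
pose F k := `]hypot a (d * k.+1%:R^-1), hypot a d]%classic.
have -> : `]a, hypot a d]%classic = \bigcup_k F k.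
  apply/seteqP; split => r /=; last first.
    move=> [k _]; rewrite /F/= !in_itv/= => /andP[+ ->]; rewrite andbT.
    by apply: le_lt_trans; exact: hypot_ge.
  rewrite in_itv/= => /andP[ar rd].
  have := psi_gt0 a0 ar => p0.
  have [k kp] : exists k : nat, d / psi a r < k.+1%:R.
    exists (Num.truncn (d / psi a r)).
    by have /andP[] := truncn_itv (ltW (divr_gt0 d0 p0)).
  exists k => //; rewrite /F/= in_itv/= rd andbT.
  rewrite -[ltRHS](psiK a0 ar); apply: lt_hypot; first exact: ltW.
  by rewrite ltr_pdivrMr// mulrC -ltr_pdivrMr.
have DF k : D (F k) = (d - d * k.+1%:R^-1)%:E.
  by exact: integral_radial_density_itv.
have c1 : D \o F @ \oo --> D (\bigcup_k F k).
  have mF k : measurable (F k : set (measurableTypeR R)) by rewrite /F.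
  apply: nondecreasing_cvg_mu => //; first exact: bigcupT_measurable.
  move=> i j ij; apply/subsetPset; apply: subset_itvr.
  rewrite bnd_simp.
  apply: le_hypot; first exact: ltW.
  by rewrite ler_pM2l// lef_pV2 ?posrE// ler_nat.
have c2 : D \o F @ \oo --> d%:E.
  rewrite (_ : D \o F = EFin \o (fun k => d - d * k.+1%:R^-1)); last exact/funext.
  apply: cvg_EFin; first by near=> k.
  rewrite -[X in _ --> X]subr0; apply: cvgB; first exact: cvg_cst.
  rewrite -[X in _ --> X](mulr0 d); apply: cvgM; first exact: cvg_cst.
  exact: cvg_harmonic.
exact: cvg_unique c1 c2.
Unshelve. all: by end_near. Qed.

Let D_itv c d : 0 <= c -> c <= d -> D `]hypot a c, hypot a d]%classic = (d - c)%:E.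
Proof.
rewrite le_eqVlt => /predU1P[<-|c0 cd]; last by exact: integral_radial_density_itv.
have -> : hypot a 0 = a by rewrite /hypot expr0n add0r sqrtr_sqr ger0_norm.
rewrite le_eqVlt => /predU1P[<-|d0]; last by rewrite subr0 D_itv0.
rewrite set_itv_ge ?measure0 ?subrr// bnd_simp -leNgt.
by rewrite /hypot expr0n add0r sqrtr_sqr ger0_norm.
Qed.

(** A change of variables proved by uniqueness: the density carried back by [psi a], completed by
    Lebesgue measure on ]-oo, 0], has the right value on every ]c, d] and is therefore Lebesgue
    measure. *)
Lemma lebesgue_hypot (J : set R) : measurable J ->
  (mu [set x | (0 < x)%R /\ J (hypot a x)] =
   \int[mu]_(r in J) (radial_density a r)%:E)%E.
Proof.
move=> mJ.
have mpsi := measurable_psi a.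
pose psi' (r : measurableTypeR R) : measurableTypeR R := psi a r.
have mN : measurable (`]-oo, 0]%classic : set (measurableTypeR R)) by [].
pose m' : {measure set (measurableTypeR R) -> \bar R} :=
  measure_add (image_measure D (mpsi : measurable_fun _ psi')) (mrestr mu mN).
have m'E A : m' A = (D (psi' @^-1` A) + mu (A `&` `]-oo, 0%R]%classic))%E.
  exact: measure_addE.
have muE A : measurable A -> mu A = m' A.
  apply: lebesgue_measure_unique => _ [[c d]] _ <-; rewrite m'E /=.
  have mp : measurable (psi' @^-1` `]c, d]%classic) by rewrite -[X in measurable X]setTI; exact: (measurable_psi a).
  rewrite D_gt//.
  have [d0|d0] := leP d 0.
    rewrite [X in (D X + _)%E](_ : _ = set0); last first.
      apply/seteqP; split => // r [/=]; rewrite !in_itv/= andbT => /andP[_ h] ar.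
      by have := psi_gt0 a0 ar; rewrite ltNge (le_trans h d0).
    rewrite measure0 add0e; congr mu; apply/esym/setIidPl => x /=.
    by rewrite !in_itv/= => /andP[_ /le_trans]; exact.
  have M0 : 0 <= Num.max c 0 by rewrite le_max lexx orbT.
  have -> : psi' @^-1` `]c, d]%classic `&` `]a, +oo[%classic =
      `]hypot a (Num.max c 0), hypot a d]%classic.
    apply/seteqP; split => r /=; rewrite !in_itv/= ?andbT.
      move=> [/andP[cr rd] ar]; rewrite -le_psi// ?(ltW d0)// rd andbT.
      by rewrite ltNge -le_psi// -ltNge gt_max cr psi_gt0.
    move=> /andP[cr rd].
    have ar : a < r by apply: le_lt_trans cr; exact: hypot_ge.
    split => //; rewrite [X in _ && X]le_psi ?(ltW d0)// rd andbT.
    move: cr; rewrite ltNge -le_psi// -ltNge.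
    by rewrite gt_max => /andP[].
  have [cd|dc] := leP c d; last first.
    rewrite [in LHS]set_itv_ge ?bnd_simp -?leNgt ?ltW// set_itv_ge; last first.
      rewrite bnd_simp -leNgt (max_idPl _) ?(ltW (lt_trans d0 dc))// ltW//.
      by rewrite lt_hypot// ltW.
    rewrite set_itv_ge ?bnd_simp -?leNgt ?ltW// set0I !measure0 adde0//.
  rewrite D_itv ?le_max ?lexx ?orbT// ?ge_max ?cd ?(ltW d0)//.
  have -> : `]c, d]%classic `&` `]-oo, 0]%classic = `]c, 0]%classic.
    apply/seteqP; split => r /=; rewrite !in_itv/=; first by move=> [/andP[-> _] ->].
    by move=> /andP[-> r0]; rewrite r0 (le_trans r0)// ltW.
  rewrite !lebesgue_measure_itv/= !lte_fin.
  case: (ltgtP c 0) => [c0|c0|c0].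
  - by rewrite (lt_trans c0 d0) -!EFinB -EFinD; congr EFin; lra.
  - move: cd; rewrite le_eqVlt => /predU1P[->|cd]; first by rewrite ltxx subrr adde0.
    by rewrite cd adde0.
  - by rewrite c0 d0 adde0.
have mh : measurable_fun [set: R] (hypot a).
  apply: measurableT_comp.
    by apply: continuous_measurable_fun => x; exact: sqrt_continuous.
  by apply: measurable_funD => //; exact: measurable_funX.
have mA : measurable ([set x | (0 < x)%R /\ J (hypot a x)] : set (measurableTypeR R)).
  rewrite (_ : [set _ | _] = `]0, +oo[%classic `&` hypot a @^-1` J); last first.
    by apply/seteqP; split => x /=; rewrite in_itv/= andbT.
  by apply: measurableI => //; rewrite -[X in measurable X]setTI; exact: mh.
rewrite muE// m'E [X in (_ + mu X)%E](_ : _ = set0); last first.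
  apply/seteqP; split => // x [[x0 _]] /=.
  by rewrite in_itv/= leNgt x0.
rewrite measure0 adde0 -[RHS]/(D J) (D_gt mJ) D_gt; last first.
  by rewrite -[X in measurable X]setTI; exact: (measurable_psi a).
congr (D _); apply/seteqP; split => r [/=]; rewrite in_itv/= andbT => h ar; split => //.
  by move: h => [_]; rewrite /psi' psiK.
by split; [exact: psi_gt0|rewrite /psi' psiK].
Qed.

End fixed_radius.

End radial_density.

Section cone.
Context {R : realType}.
Notation mu := (@lebesgue_measure R).
Notation lt := (@lebesgue_tuple R).

Lemma measurable_invr : measurable_fun [set: R] (@GRing.inv R).
Proof.
rewrite (_ : @GRing.inv R = fun x => x * (x ^+ 2) `^ (-1)); last first.
  apply/funext => x; rewrite powR_inv1 ?sqr_ge0//.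
  by have [->|x0] := eqVneq x 0; [rewrite invr0 mul0r|field].
apply: measurable_funM => //; apply: (measurableT_comp (measurable_powR _)).
exact: measurable_funX.
Qed.

Definition tnorm m (t : m.-tuple R) : R := enorm (row_of_tuple t).

Lemma tnorm_ge0 m (t : m.-tuple R) : 0 <= tnorm t.
Proof. exact: enorm_ge0. Qed.

Lemma measurable_tnorm m : measurable_fun [set: m.-tuple R] (@tnorm m).
Proof.
apply: measurable_fun_enorm => i.
by under eq_fun do rewrite mxE; exact: measurable_tnth.
Qed.

Lemma tnorm_cons m x (t : m.-tuple R) :
  tnorm [tuple of x :: t] = hypot (tnorm t) x.
Proof.
rewrite /tnorm /hypot sqr_enorm {1}/enorm big_ord_recl !mxE tnth0.
by congr (Num.sqrt (_ + _)); apply: eq_bigr => i _; rewrite !mxE tnthS expr2.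
Qed.

Definition scale_tuple m (c : R) (t : m.-tuple R) : m.-tuple R :=
  affine_tuple c [tuple 0 | _ < m] t.

Lemma row_scale_tuple m c (t : m.-tuple R) :
  row_of_tuple (scale_tuple c t) = c *: row_of_tuple t.
Proof. by apply/rowP => i; rewrite !mxE !tnth_mktuple addr0. Qed.

Lemma tnorm_scale m c (t : m.-tuple R) :
  tnorm (scale_tuple c t) = `|c| * tnorm t.
Proof. by rewrite /tnorm row_scale_tuple enormZ. Qed.

Lemma measurable_scale_tuple d (T : measurableType d) m (c : T -> R)
    (f : T -> m.-tuple R) :
  measurable_fun [set: T] c -> measurable_fun [set: T] f ->
  measurable_fun [set: T] (fun x => scale_tuple (c x) (f x)).
Proof.
move=> mc mf; apply/measurable_fun_tnthP => i.
rewrite (_ : _ \o _ = fun t => c t * tnth (f t) i); last first.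
  by apply/funext => t /=; rewrite !tnth_mktuple addr0.
apply: measurable_funM => //.
by move/measurable_fun_tnthP : mf; exact.
Qed.

(* It vanishes for 1 <= tnorm y, by the conventions on Num.sqrt and 0^-1. *)
Definition sphere_weight m (y : m.-tuple R) : R :=
  (Num.sqrt (1 - tnorm y ^+ 2))^-1.

Lemma sphere_weight_ge0 m (y : m.-tuple R) : 0 <= sphere_weight y.
Proof. by rewrite invr_ge0 sqrtr_ge0. Qed.

Lemma measurable_sphere_weight m :
  measurable_fun [set: m.-tuple R] (@sphere_weight m).
Proof.
apply: (measurableT_comp measurable_invr); apply: measurableT_comp.
  by apply: continuous_measurable_fun => x; exact: sqrt_continuous.
apply: measurable_funB => //; apply: measurable_funX; exact: measurable_tnorm.
Qed.

(** Surface measure of an open hemisphere, read in the projection to the equatorial ball;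
    [sqrt_det_gram_hemisphere_chart] identifies the density. *)
Definition weighted m : {measure set (m.-tuple R) -> \bar R} :=
  density_measure (lt m) (@measurable_sphere_weight m) (@sphere_weight_ge0 m).

Arguments weighted : simpl never.

(** The radial density is homogeneous of degree 0. This is what separates the volume of a cone into
    a radial factor and an area. *)
Lemma radial_density_scale m (r : R) (z : m.-tuple R) : 0 < r ->
  radial_density (tnorm z) r = sphere_weight (scale_tuple r^-1 z).
Proof.
move=> r0; rewrite /radial_density /sphere_weight tnorm_scale.
rewrite gtr0_norm ?invr_gt0//.
have -> : r ^+ 2 - tnorm z ^+ 2 = r ^+ 2 * (1 - (r^-1 * tnorm z) ^+ 2).
  by field; rewrite gt_eqF.
rewrite sqrtrM ?sqr_ge0// sqrtr_sqr gtr0_norm// invfM mulrA mulfV ?gt_eqF// mul1r.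
by apply/max_idPr; rewrite invr_ge0 sqrtr_ge0.
Qed.

(* The part between the spheres of radii 1/2 and 1 of the cone over the part of
   the upper hemisphere whose projection is U. *)
Definition half_cone m (U : set (m.-tuple R)) : set (m.+1.-tuple R) :=
  [set t | [/\ 0 < thead t, 2^-1 < tnorm t < 1 &
     U (scale_tuple (tnorm t)^-1 [tuple of behead t])]].

Lemma measurable_half_cone m (U : set (m.-tuple R)) :
  measurable U -> measurable (half_cone U).
Proof.
move=> mU.
have -> : half_cone U = ((@tnth _ R ^~ ord0) @^-1` `]0, +oo[%classic) `&`
  ((@tnorm m.+1) @^-1` `]2^-1, 1[%classic) `&`
  ((fun t : m.+1.-tuple R => scale_tuple (tnorm t)^-1 [tuple of behead t]) @^-1` U).
  apply/seteqP; split => t /=; rewrite !in_itv/= andbT.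
    by move=> [].
  by move=> [[]].
apply: measurableI; [apply: measurableI|]; rewrite -[X in measurable X]setTI.
- by apply: measurable_tnth.
- by apply: measurable_tnorm.
- apply: measurable_scale_tuple => //.
    exact: (measurableT_comp measurable_invr (@measurable_tnorm _)).
  exact: measurable_behead.
Qed.

(** Polar coordinates on the cone. For a fixed tail z the first coordinate is traded for the radius
    r by [lebesgue_hypot]; once the integrals are exchanged, z = r y yields the factor r ^ m and, by
    [radial_density_scale], the area density. *)
Lemma half_cone_volume m (U : set (m.-tuple R)) : measurable U ->
  (lt m.+1 (half_cone U) =
   \int[mu]_(r in `]2^-1%R, 1%R[) ((r ^+ m)%:E * weighted m U))%E.
Proof.
move=> mU; have mK := measurable_half_cone mU.
pose h (p : R * m.-tuple R) : \bar R :=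
  (\1_(`]2^-1, 1[%classic : set R) p.1 * \1_U (scale_tuple p.1^-1 p.2) *
   radial_density (tnorm p.2) p.1)%:E.
have h0 p : (0 <= h p)%E.
  by rewrite lee_fin !mulr_ge0//; exact: radial_density_ge0.
have mh : measurable_fun [set: R * m.-tuple R] h.
  apply/measurable_EFinP; apply: measurable_funM; last first.
    apply: measurable_fun_radial_density => //.
    exact: (measurableT_comp (@measurable_tnorm _) measurable_snd).
  apply: measurable_funM.
    apply: (measurableT_comp _ measurable_fst).
    exact: measurable_indic.
  apply: (@measurableT_comp _ _ _ _ _ _ (\1_U : m.-tuple R -> R)
    _ (fun p : R * m.-tuple R => scale_tuple p.1^-1 p.2)).
    exact: measurable_indic.
  apply: measurable_scale_tuple => //.
  exact: (measurableT_comp measurable_invr measurable_fst).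
rewrite lebesgue_tuple_indic// ge0_integral_tupleS_swap; last 2 first.
- by apply/measurable_EFinP; exact: measurable_indic.
- by move=> t; rewrite lee_fin.
transitivity (\int[lt m]_z \int[mu]_r h (r, z))%E.
  apply: eq_integral => z _.
  pose J : set R := [set r | 2^-1 < r < 1 /\ U (scale_tuple r^-1 z)].
  have mJ : measurable J.
    rewrite (_ : J = `]2^-1, 1[%classic `&` ((fun r => scale_tuple r^-1 z) @^-1` U)); last first.
      by apply/seteqP; split => r /=; rewrite in_itv.
    apply: measurableI => //; rewrite -[X in measurable X]setTI.
    by apply: measurable_scale_tuple => //; exact: measurable_invr.
  have mS : measurable_fun [set: R] (fun x => [tuple of x :: z]) by exact: measurable_cons.
  have mSK : measurable ((fun x : measurableTypeR R => [tuple of x :: z]) @^-1` half_cone U).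
    by rewrite -[X in measurable X]setTI; exact: mS.
  transitivity (mu [set x | 0 < x /\ J (hypot (tnorm z) x)]).
    have := integral_indic mu measurableT mSK; rewrite setIT => ->.
    congr (mu _); apply/seteqP; split => x /=.
      move=> []; rewrite tnorm_cons /thead tnth0 => x0 h1 h2; split => //; split => //.
      by move: h2; congr (U (scale_tuple _ _)); apply: val_inj.
    move=> [x0 [h1 h2]]; split; rewrite ?tnorm_cons /thead ?tnth0//.
    by move: h2; congr (U (scale_tuple _ _)); apply: val_inj.
  rewrite lebesgue_hypot ?tnorm_ge0// integral_mkcond; apply: eq_integral => r _.
  rewrite patchE /h /=; case: ifPn => [|].
    rewrite inE => -[h1 h2]; rewrite !indicE !mem_set ?mul1r//=.
  rewrite notin_setE => nJ; rewrite !indicE.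
  case: (boolP (r \in _)) => [|_]; last by rewrite !mul0r.
  rewrite inE /= in_itv/= => rI; rewrite memNset ?mulr0 ?mul0r// => Ur.
  by apply: nJ.
rewrite -(@fubini_tonelli _ _ _ _ _ mu (lt m) h)// [RHS]integral_mkcond.
apply: eq_integral => r _; rewrite patchE; case: ifPn => [|].
  rewrite inE/= in_itv/= => /andP[r2 r1].
  have r0 : 0 < r by rewrite (lt_trans _ r2).
  pose g (y : m.-tuple R) := (\1_U y * sphere_weight y)%:E : \bar R.
  transitivity (\int[lt m]_z g (scale_tuple r^-1 z))%E.
    apply: eq_integral => z _; rewrite /h /= indicE mem_set ?mul1r.
      by rewrite radial_density_scale.
    by rewrite /= in_itv/= r2.
  rewrite ge0_integral_affine_tuple ?invr_gt0//; last 2 first.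
  - apply/measurable_EFinP; apply: measurable_funM; first exact: measurable_indic.
    exact: measurable_sphere_weight.
  - by move=> y; rewrite lee_fin mulr_ge0// sphere_weight_ge0.
  rewrite -exprVn invrK; congr (_ * _)%E.
  rewrite /weighted /= /density_measure [RHS]integral_mkcond; apply: eq_integral => y _.
  rewrite /g patchE indicE.
  by case: (y \in U); rewrite ?mul1r ?mul0r.
rewrite notin_setE => rI; apply: integral0_eq => z _.
by rewrite /h /= indicE memNset// !mul0r.
Qed.

Let mW m (U : set (m.-tuple R)) :
  measurable_fun (`]2^-1, 1[%classic : set R)
    (fun r => (r ^+ m)%:E * weighted m U)%E.
Proof.
apply: emeasurable_funM => //.
by apply/measurable_EFinP; apply: measurable_funX.
Qed.

Let mu_half : mu `]2^-1, 1[%classic = (2^-1)%:E.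
Proof.
rewrite lebesgue_measure_itv/= lte_fin.
have -> : (2^-1 < 1 :> R) by rewrite invf_lt1// ltr1n.
by rewrite -EFinB; congr EFin; field.
Qed.

Let integral_half (x : \bar R) :
  (\int[mu]_(r in `]2^-1%R, 1%R[) x = x * (2^-1)%:E)%E.
Proof. by rewrite integral_cst//; congr (_ * _)%E; exact: mu_half. Qed.

(** Here and in [half_cone_volume_ge], r ^ m lies between 2 ^ (- m) and 1 on an interval of length
    1/2. *)
Lemma half_cone_volume_le m (U : set (m.-tuple R)) : measurable U ->
  (lt m.+1 (half_cone U) <= weighted m U)%E.
Proof.
move=> mU; rewrite half_cone_volume//.
apply: (@le_trans _ _ (\int[mu]_(r in `]2^-1%R, 1%R[) weighted m U)%E).
  apply: ge0_le_integral => //.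
  - move=> r /=; rewrite in_itv/= => /andP[r0 _]; apply: mule_ge0 => //.
    by rewrite lee_fin exprn_ge0// (le_trans _ (ltW r0)).
  - exact: mW.
  - move=> r /=; rewrite in_itv/= => /andP[r0 r1].
    rewrite -[leRHS]mul1e lee_wpmul2r// lee_fin exprn_ile1// ?(ltW r1)//.
    by rewrite (le_trans _ (ltW r0)).
rewrite integral_half -[leRHS]mule1; apply: lee_wpmul2l => //.
by rewrite lee_fin invf_le1// ler1n.
Qed.

Lemma half_cone_volume_ge m (U : set (m.-tuple R)) : measurable U ->
  (weighted m U <= (2 ^+ m.+1)%:E * lt m.+1 (half_cone U))%E.
Proof.
move=> mU; rewrite half_cone_volume//.
rewrite muleC -lee_pdivrMr ?exprn_gt0//.
apply: (@le_trans _ _ (\int[mu]_(r in `]2^-1%R, 1%R[)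
    ((2^-1 ^+ m)%:E * weighted m U))%E).
  have -> : ((2 ^+ m.+1)^-1 = 2^-1 ^+ m * 2^-1 :> R) by rewrite exprVn exprSr invfM.
  by rewrite integral_half muleAC -EFinM muleC.
apply: ge0_le_integral => //.
- exact: mW.
- move=> r /=; rewrite in_itv/= => /andP[r0 r1].
  by rewrite lee_wpmul2r// lee_fin lerXn2r ?nnegrE ?(ltW r0)// (le_trans _ (ltW r0)).
Qed.

Lemma half_cone_sub_ball m (U : set (m.-tuple R)) :
  half_cone U `<=` tuple_ball 0 1.
Proof. by move=> t [_ /andP[_ h] _]; rewrite /tuple_ball /= subr0. Qed.

Lemma weighted_le m (U : set (m.-tuple R)) : measurable U ->
  (weighted m U <= (2 ^+ m.+1)%:E * unit_ball_volume m.+1)%E.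
Proof.
move=> mU; apply: le_trans (half_cone_volume_ge mU) _.
rewrite lee_wpmul2l ?lee_fin ?exprn_ge0//; apply: le_measure.
- by rewrite inE; exact: measurable_half_cone.
- by rewrite inE; exact: measurable_tuple_ball.
- exact: half_cone_sub_ball.
Qed.

(* Lower bound for the weight of a spherical cap of center u and radius r:
   the cone over it contains about 1/r disjoint balls of radius r/16 lined up
   along the direction u, pushed by r/16 into the upper half-space. *)
Lemma weighted_cap_ge m (u : 'rV[R]_m.+1) (r : R) (U : set (m.-tuple R)) :
  0 < r <= 1 -> enorm u = 1 -> 0 <= u 0 ord0 -> measurable U ->
  (forall t : m.+1.-tuple R, 0 < thead t ->
    enorm ((tnorm t)^-1 *: row_of_tuple t - u) <= r ->
    U (scale_tuple (tnorm t)^-1 [tuple of behead t])) ->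
  (((2 * r)^-1 * (r / 16) ^+ m.+1)%:E * unit_ball_volume m.+1 <= weighted m U)%E.
Proof.
move=> /andP[r0 r1] u1 u0 mU hU.
apply: le_trans (half_cone_volume_le mU).
pose e0 : 'rV[R]_m.+1 := delta_mx 0 ord0.
have ne0 : enorm e0 = 1.
  rewrite /enorm (bigD1 ord0)//= big1 ?addr0 ?mxE ?eqxx ?expr1n ?sqrtr1//.
  by move=> i i0; rewrite !mxE/= (negbTE i0) expr0n.
(* The centers advance by r / 8, twice the radius of the balls, from height 5/8 up to at most 3/4
   since (k + 1) r <= 1. Points of the balls are within r / 8 <= 1/8 of the axis point, hence have
   norm between 1/2 and 7/8; the shift by r / 16 along [e0] makes their first coordinate
   positive. *)
pose c (k : nat) : 'rV[R]_m.+1 := (5 / 8 + k%:R * (r / 8)) *: u + (r / 16) *: e0.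
pose N := Num.truncn r^-1.
have /andP[N1 N2] : N%:R <= r^-1 < N.+1%:R by apply: truncn_itv; rewrite invr_ge0 ltW.
have N0 : 1 <= N%:R :> R.
  rewrite ler1n lt0n; apply/eqP => N0; move: N2; rewrite N0 ltNge.
  by rewrite invf_ge1// r1.
have NN : (2 * r)^-1 <= N%:R.
  rewrite invfM; have : r^-1 < N%:R + 1 by rewrite natr1.
  by lra.
apply: (@le_trans _ _ (((size [seq c k | k <- iota 0 N])%:R * (r / 16) ^+ m.+1)%:E
    * unit_ball_volume m.+1)%E).
  rewrite size_map size_iota lee_wpmul2r ?(ltW (unit_ball_volume_gt0 _))// lee_fin.
  by rewrite ler_wpM2r ?exprn_ge0 ?divr_ge0 ?(ltW r0).
apply: packing_measure.
- by rewrite divr_gt0.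
- exact: measurable_half_cone.
- rewrite pairwise_map.
  have : pairwise ltn (iota 0 N).
    by rewrite -sorted_pairwise; [exact: iota_ltn_sorted|exact: ltn_trans].
  apply: sub_pairwise => k l kl /=.
  have -> : c k - c l = ((k%:R - l%:R) * (r / 8)) *: u.
    by apply/rowP => i; rewrite !mxE; ring.
  rewrite enormZ u1 mulr1 normrM (gtr0_norm (_ : 0 < r / 8)) ?divr_gt0//.
  have : 1 <= `|k%:R - l%:R| :> R.
    rewrite distrC ger0_norm ?subr_ge0 ?ler_nat ?(ltnW kl)//.
    by rewrite lerBrDr addrC natr1 ler_nat.
  have hr : 0 < r / 8 by rewrite divr_gt0.
  nra.
move=> _ /mapP[k + ->]; rewrite mem_iota add0n => /andP[_ kN].
move=> t; rewrite /tuple_ball/= => tc.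
pose s := 5 / 8 + k%:R * (r / 8).
have s1 : 5 / 8 <= s by rewrite lerDl mulr_ge0// divr_ge0// ltW.
have s2 : s <= 3 / 4.
  have : k.+1%:R * r <= 1.
    by rewrite -ler_pdivlMr// mul1r (le_trans _ N1)// ler_nat.
  rewrite /s -natr1; lra.
have tsu : enorm (row_of_tuple t - s *: u) < r / 8.
  apply: (le_lt_trans (enorm_triangle (c k) _ _)).
  rewrite [c k - _]addrC addKr enormZ ne0 mulr1 gtr0_norm ?divr_gt0//.
  by lra.
have nt : `|tnorm t - s| < r / 8.
  have := ler_dist_enorm (row_of_tuple t) (s *: u).
  have s0 : 0 <= s by lra.
  by rewrite enormZ u1 mulr1 (ger0_norm s0) => h; exact: le_lt_trans tsu.
have [nt1 nt2] : s - r / 8 < tnorm t /\ tnorm t < s + r / 8.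
  by move: nt; rewrite ltr_distl => /andP[].
have nt0 : 0 < tnorm t by lra.
have th0 : 0 < thead t.
  have := ler_coord_enorm (row_of_tuple t - c k) ord0.
  move/le_lt_trans => /(_ _ tc); rewrite !mxE eqxx /= mulr1 ltr_distl => /andP[+ _].
  have : 0 <= s * u 0 ord0 by rewrite mulr_ge0//; lra.
  rewrite -/s /thead; lra.
split => //; first by apply/andP; split; lra.
apply: hU => //.
(* Both terms in the parenthesis have norm less than r / 8, and s is at least 5/8. *)
have -> : (tnorm t)^-1 *: row_of_tuple t - u =
    s^-1 *: ((s / tnorm t - 1) *: row_of_tuple t + (row_of_tuple t - s *: u)).
  apply/rowP => i; rewrite !mxE; field.
  by rewrite !gt_eqF//; lra.
have s0 : 0 < s by lra.
rewrite enormZ gtr0_norm ?invr_gt0// ler_pdivrMl//.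
apply: (le_trans (ler_enormD _ _)); rewrite enormZ -[enorm (row_of_tuple t)]/(tnorm t).
rewrite -{2}(gtr0_norm nt0) -normrM mulrBl mul1r mulfVK ?gt_eqF// distrC.
by nra.
Qed.

End cone.

(** * The area element of the hemisphere charts *)

Lemma det_rank1_update (F : comNzRingType) m (u : 'cV[F]_m) (v : 'rV[F]_m) :
  \det (1%:M + u *m v) = 1 + (v *m u) 0 0.
Proof.
(* Eliminating the lower left or the upper right block of this bordered matrix evaluates its
   determinant in two ways. *)
pose B : 'M[F]_(1 + m) := block_mx 1%:M (- v) u 1%:M.
have h1 : \det B = \det (1%:M + u *m v).
  have := det_mulmx (block_mx 1%:M 0 (- u) 1%:M : 'M[F]_(1 + m)) B.
  rewrite mulmx_block det_lblock !det1 !mul1r.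
  rewrite !mul1mx !mul0mx !mulmx1 !addr0 addNr det_ublock det1 mul1r => <-.
  by congr (\det _); rewrite addrC mulNmx mulmxN opprK.
have h2 : \det B = \det (1%:M + v *m u).
  have := det_mulmx (block_mx 1%:M v 0 1%:M : 'M[F]_(1 + m)) B.
  rewrite mulmx_block det_ublock !det1 !mul1r.
  rewrite !mul1mx !mul0mx !mulmx1 !add0r addNr det_lblock det1 mulr1 => <-.
  by congr (\det _).
by rewrite -h1 h2 det_mx11 !mxE eqxx.
Qed.

Section chart_jacobian.
Context {R : realType}.
Variables (m : nat).
Implicit Types (x : 'rV[R]_m) (i : 'I_m.+1) (s : bool).

Lemma hemisphere_chart_lift i s x k :
  @hemisphere_chart R m.+1 i s x 0 (lift i k) = x 0 k.
Proof. by rewrite mxE liftK. Qed.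

Lemma hemisphere_chart_diag i s x :
  @hemisphere_chart R m.+1 i s x 0 i = (-1) ^+ s * Num.sqrt (1 - enorm x ^+ 2).
Proof. by rewrite mxE unlift_none. Qed.

(** On a line parallel to a coordinate axis, 1 - |x| ^ 2 has the form a - 2 b h - h ^ 2; this gives
    the partial derivatives of the graph coordinate of a chart. *)
Lemma is_derive_sqrt_quadratic (a b : R) : 0 < a ->
  is_derive (0 : R) 1 (fun h : R => Num.sqrt (a - 2 * b * h - h ^+ 2)) (- b / Num.sqrt a).
Proof.
move=> a0.
have e : a - 2 * b * 0 - 0 ^+ 2 = a by rewrite mulr0 subr0 expr0n subr0.
have := @is_derive1_comp _ (@Num.sqrt R) (fun h => a - 2 * b * h - h ^+ 2) 0 _ _ _ _.
move=> H.
have p0 : 0 < a - 2 * b * 0 - 0 ^+ 2 by rewrite e.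
apply: (is_derive_eq (H _ _ (is_derive1_sqrt p0) _)).
rewrite /GRing.scale/= e.
by field; rewrite gt_eqF ?sqrtr_gt0.
Qed.

Lemma derive_line (V : normedModType R) (g : V -> R) (x v : V) (d : R) :
  is_derive (0 : R) 1 (fun h : R => g (h *: v + x)) d -> 'D_v g x = d.
Proof.
move=> [_ <-]; rewrite /derive /=; congr (lim _).
by apply/funext => A; congr (nbhs _ _); apply/funext => h /=; rewrite scaler1 addr0 scale0r add0r.
Qed.


Lemma sqr_enorm_line x (h : R) j :
  enorm (h *: delta_mx 0 j + x) ^+ 2 = enorm x ^+ 2 + 2 * x 0 j * h + h ^+ 2.
Proof.
rewrite !sqr_enorm dotDl !dotDr !dotZl !dotZr.
have dd (y : 'rV[R]_m) : dot (delta_mx 0 j) y = y 0 j.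
  rewrite /dot (bigD1 j)//= big1 ?addr0 ?mxE ?eqxx ?mul1r// => k kj.
  by rewrite mxE/= (negbTE kj) mul0r.
by rewrite (dotC x) !dd mxE !eqxx /=; ring.
Qed.

Lemma hemisphere_chart_sum i s x :
  hemisphere_chart i s x = \sum_(k < m) (x 0 k *: delta_mx 0 (lift i k)) +
    ((-1) ^+ s * Num.sqrt (1 - enorm x ^+ 2)) *: (delta_mx 0 i : 'rV[R]_m.+1).
Proof.
apply/rowP => j; rewrite !mxE summxE.
case: (unliftP i j) => [k ->|->].
  rewrite (bigD1 k)//= big1 ?addr0; last first.
    by move=> l lk; rewrite !mxE (inj_eq lift_inj) eq_sym (negbTE lk) andbF mulr0.
  by rewrite !mxE !eqxx mulr1 [lift i k == i]eq_sym (negbTE (neq_lift _ _)) mulr0 addr0.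
rewrite big1 ?add0r; first by rewrite !eqxx mulr1.
by move=> l _; rewrite !mxE (negbTE (neq_lift _ _)) andbF mulr0.
Qed.

Lemma differentiable_hemisphere_chart i s x : enorm x < 1 ->
  differentiable (@hemisphere_chart R m.+1 i s : 'rV[R]_m -> 'rV[R]_m.+1) x.
Proof.
move=> x1.
rewrite (_ : hemisphere_chart i s = (\sum_(k < m) (fun x : 'rV[R]_m => x 0 k *: delta_mx 0 (lift i k))) +
    (fun x : 'rV[R]_m => ((-1) ^+ s * Num.sqrt (1 - enorm x ^+ 2)) *: (delta_mx 0 i : 'rV[R]_m.+1))); last first.
  by apply/funext => y; rewrite hemisphere_chart_sum fctE fct_sumE.
apply: differentiableD.
  apply: differentiable_sum => k; apply: differentiableZl.
  exact: differentiable_coord.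
apply: differentiableZl; apply: differentiableM => //.
apply: (@differentiable_comp _ _ _ _ (fun x : 'rV[R]_m => 1 - enorm x ^+ 2) Num.sqrt).
  apply: differentiableB => //.
  rewrite (_ : (fun y => _) = \sum_(k < m) (fun y : 'rV[R]_m => y 0 k ^+ 2)); last first.
    by apply/funext => y; rewrite sqr_enorm fct_sumE; apply: eq_bigr => k _; rewrite expr2.
  apply: differentiable_sum => k; rewrite (_ : (fun y => _) = (fun y : 'rV[R]_m => y 0 k * y 0 k)); last first.
    by apply/funext => y; rewrite expr2.
  apply: differentiableM; exact: differentiable_coord.
apply/derivable1_diffP.
have p0 : 0 < 1 - enorm x ^+ 2 by rewrite subr_gt0 expr_lt1// enorm_ge0.
by have [] := is_derive1_sqrt p0.
Qed.

Lemma jacobian_hemisphere_chart i s x j l : enorm x < 1 ->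
  jacobian (@hemisphere_chart R m.+1 i s : 'rV[R]_m -> 'rV[R]_m.+1) x j l =
  if unlift i l is Some k then (j == k)%:R
  else - ((-1) ^+ s * x 0 j / Num.sqrt (1 - enorm x ^+ 2)).
Proof.
move=> x1; have dx := differentiable_hemisphere_chart i s x1.
have -> : jacobian (@hemisphere_chart R m.+1 i s : 'rV[R]_m -> 'rV[R]_m.+1) x j l =
  ((delta_mx 0 j : 'rV[R]_m) *m
    jacobian (@hemisphere_chart R m.+1 i s : 'rV[R]_m -> 'rV[R]_m.+1) x) 0 l.
  by rewrite -rowE [RHS]mxE.
rewrite -deriveEjacobian// derive_mx; last exact: diff_derivable.
rewrite mxE.
have p0 : 0 < 1 - enorm x ^+ 2 by rewrite subr_gt0 expr_lt1// enorm_ge0.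
case: (unliftP i l) => [k ->|->].
  apply: derive_line.
  under eq_fun do rewrite hemisphere_chart_lift !mxE/=.
  apply: is_derive_eq.
  by rewrite /GRing.scale/= eq_sym; ring.
apply: derive_line.
under eq_fun do rewrite hemisphere_chart_diag sqr_enorm_line.
have := is_derive_sqrt_quadratic (x 0 j) p0 => H.
rewrite (_ : (fun h => _) = (fun h : R => (-1) ^+ s * Num.sqrt (1 - enorm x ^+ 2 - 2 * x 0 j * h - h ^+ 2))); last first.
  by apply/funext => h; rewrite !opprD !addrA.
apply: is_derive_eq.
by rewrite /GRing.scale/=; ring.
Qed.

(** The chart is a graph, so its Gram matrix is 1 + c c^T with c the gradient of the height, and its
    determinant is 1 + |c| ^ 2 = 1 / (1 - |x| ^ 2). *)
Lemma sqrt_det_gram_hemisphere_chart i s x : enorm x < 1 ->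
  Num.sqrt (\det (gram (@hemisphere_chart R m.+1 i s : 'rV[R]_m -> 'rV[R]_m.+1) x)) =
  (Num.sqrt (1 - enorm x ^+ 2))^-1.
Proof.
move=> x1; have p0 : 0 < 1 - enorm x ^+ 2 by rewrite subr_gt0 expr_lt1// enorm_ge0.
pose c : 'cV[R]_m := \col_j - ((-1) ^+ s * x 0 j / Num.sqrt (1 - enorm x ^+ 2)).
have -> : gram (@hemisphere_chart R m.+1 i s : 'rV[R]_m -> 'rV[R]_m.+1) x = 1%:M + c *m c^T.
  rewrite /gram.
  have := fun j l => @jacobian_hemisphere_chart i s x j l x1.
  move: (jacobian _ _) => J HJ.
  apply/matrixP => j k; rewrite !mxE.
  rewrite (bigD1_ord i)//= big_ord1 addrC; congr (_ + _).
    rewrite (bigD1 j)//= big1 ?addr0.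
      by rewrite mxE !HJ liftK eqxx mul1r eq_sym.
    by move=> l lj; rewrite !mxE !HJ liftK eq_sym (negbTE lj) mul0r.
  by rewrite !mxE !HJ unlift_none.
rewrite det_rank1_update !mxE.
under eq_bigr do rewrite !mxE.
have -> : \sum_(j < m) - ((-1) ^+ s * x 0 j / Num.sqrt (1 - enorm x ^+ 2)) *
      - ((-1) ^+ s * x 0 j / Num.sqrt (1 - enorm x ^+ 2)) =
    enorm x ^+ 2 / (1 - enorm x ^+ 2).
  rewrite {3}sqr_enorm mulr_suml; apply: eq_bigr => j _.
  rewrite -[in RHS](sqr_sqrtr (ltW p0)) mulrNN.
  have ss : (-1) ^+ s * (-1) ^+ s = 1 :> R by rewrite -expr2 sqrr_sign.
  rewrite -[RHS]mul1r -[X in _ = X * _]ss; field.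
  by rewrite gt_eqF ?sqrtr_gt0.
have -> : 1 + enorm x ^+ 2 / (1 - enorm x ^+ 2) = (1 - enorm x ^+ 2)^-1.
  by field; rewrite gt_eqF.
by rewrite sqrtrV// ltW.
Qed.

End chart_jacobian.

(** * The normalized measure of the sphere *)

Section borel_row_vectors.
Context {R : realType}.

(** Links the product sigma-algebra of tuples with the Borel one: an open set is the union of the
    countably many cubes with rational center and half-side 1 / (k + 1) that it contains. *)
Lemma measurable_row_of_tuple m :
  measurable_fun [set: m.-tuple R] (row_of_tuple : m.-tuple R -> borel_rV R m).
Proof.
apply: measurability => // _ [U oU <-].
rewrite setTI.
pose q (i : 'rV[rat]_m * nat) : 'rV[R]_m := map_mx ratr i.1.
pose F (i : 'rV[rat]_m * nat) : set (m.-tuple R) :=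
  [set t | (forall u, tuple_cube (q i) i.2.+1%:R^-1 u -> U (row_of_tuple u)) /\
           tuple_cube (q i) i.2.+1%:R^-1 t].
rewrite (_ : _ @^-1` U = \bigcup_i F i).
  apply: countable_bigcupT_measurable => // i.
  have [h|h] := pselect (forall u, tuple_cube (q i) i.2.+1%:R^-1 u -> U (row_of_tuple u)).
    rewrite (_ : F i = tuple_cube (q i) i.2.+1%:R^-1); first exact: measurable_tuple_cube.
    by apply/seteqP; split => [t []|t ?].
  rewrite (_ : F i = set0); first exact: measurable0.
  by apply/seteqP; split => // t [].
apply/seteqP; split => [t /= Ut|t [i _ [h ht]]]; last exact: h.
have /nbhs_ballP[e /= e0 he] : nbhs (row_of_tuple t) U by exact: open_nbhs_nbhs.
pose k := Num.truncn (2 / e).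
have ke : k.+1%:R^-1 < e / 2.
  have /andP[_ h] : k%:R <= 2 / e < k.+1%:R by apply: truncn_itv; rewrite divr_ge0// ltW.
  by rewrite -[e / 2]invrK invf_div ltf_pV2 ?posrE ?divr_gt0.
have k0 : 0 < k.+1%:R^-1 :> R by rewrite invr_gt0.
have /choice[r hr] : forall i : 'I_m, exists r : rat, `|tnth t i - ratr r| <= k.+1%:R^-1.
  move=> i; have lt_itv : tnth t i - k.+1%:R^-1 < tnth t i + k.+1%:R^-1.
    by rewrite ltrD2l -subr_gt0 opprK addr_gt0.
  have [r] := rat_in_itvoo lt_itv.
  rewrite in_itv/= => h; exists r; rewrite ltW// distrC.
  by rewrite ltr_distl.
exists (\row_i r i, k) => //; split => /=; last by move=> i; rewrite !mxE.
move=> u hu; apply: he; split => // i j; rewrite !ord1 /ball/= !mxE.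
have := hr j; have := hu j; rewrite !mxE => h1 h2.
have -> : tnth t j - tnth u j = (tnth t j - ratr (r j)) - (tnth u j - ratr (r j)) by ring.
by rewrite (le_lt_trans (ler_normB _ _))// (le_lt_trans (lerD h2 h1))//; move: ke; set d := _^-1; lra.
Qed.

Lemma measurable_fun_continuous_rV m (f : 'rV[R]_m -> R) : continuous f ->
  measurable_fun [set: borel_rV R m] (f : borel_rV R m -> R).
Proof.
move=> cf; apply: (measurability _ (RGenOpens.measurableE R)) => _ [_ [a [b ->] <-]].
rewrite setTI; apply: sub_sigma_algebra.
by apply: open_comp => // *; exact: cf.
Qed.

Lemma measurable_coord m i :
  measurable_fun [set: borel_rV R m] (fun x : borel_rV R m => (x : 'rV[R]_m) 0 i).
Proof. by apply: measurable_fun_continuous_rV; exact: coord_continuous. Qed.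

Lemma measurable_fun_row d (T : measurableType d) n (f : T -> 'rV[R]_n) :
  (forall i, measurable_fun [set: T] (fun t => f t 0 i)) ->
  measurable_fun [set: T] (f : T -> borel_rV R n).
Proof.
move=> mf.
rewrite (_ : f = row_of_tuple \o (fun t => [tuple f t 0 i | i < n])); last first.
  by apply/funext => t; apply/rowP => i; rewrite mxE tnth_mktuple.
apply: (measurableT_comp (@measurable_row_of_tuple n)).
apply/measurable_fun_tnthP => i.
by rewrite (_ : _ \o _ = fun t => f t 0 i)//; apply/funext => t /=; rewrite tnth_mktuple.
Qed.

Lemma measurable_sphere n : measurable (sphere R n : set (borel_rV R n)).
Proof.
rewrite (_ : sphere R n = (@enorm R n : borel_rV R n -> R) @^-1` [set 1])//.
rewrite -[X in measurable X]setTI.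
by apply: (measurable_fun_continuous_rV (@enorm_continuous R n)).
Qed.

Definition tuple_chart m (i : 'I_m.+1) s (t : m.-tuple R) : borel_rV R m.+1 :=
  @hemisphere_chart R m.+1 i s (row_of_tuple t).

Lemma measurable_tuple_chart m i s :
  measurable_fun [set: m.-tuple R] (@tuple_chart m i s).
Proof.
apply: measurable_fun_row => j.
case: (unliftP i j) => [k ->|->].
  rewrite (_ : (fun t => _) = (fun t => tnth t k)); first exact: measurable_tnth.
  by apply/funext => t; rewrite hemisphere_chart_lift mxE.
under eq_fun do rewrite hemisphere_chart_diag.
apply: measurable_funM => //; apply: measurableT_comp.
  by apply: continuous_measurable_fun => x; exact: sqrt_continuous.
apply: measurable_funB => //; apply: measurable_funX; exact: measurable_tnorm.
Qed.

Lemma measurable_hemisphere_piece m (i : 'I_m.+1) s :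
  measurable (@hemisphere_piece R m.+1 i s : set (borel_rV R m.+1)).
Proof.
rewrite (_ : hemisphere_piece i s = sphere R m.+1 `&`
   (fun x : borel_rV R m.+1 => (-1) ^+ s * (x : 'rV[R]_m.+1) 0 i) @^-1` `]0, +oo[%classic `&`
   \bigcap_(j : 'I_m.+1) [set x | (j < i)%N -> (x : 'rV[R]_m.+1) 0 j = 0]); last first.
  apply/seteqP; split => x /=; rewrite in_itv/= andbT.
    by move=> [h1 h2 h3]; split; [by []|move=> j _; exact: h3].
  by move=> [[h1 h2] h3]; split => // j; exact: h3.
apply: measurableI; first apply: measurableI; first exact: measurable_sphere.
  rewrite -[X in measurable X]setTI.
  by apply: measurable_funM => //; exact: measurable_coord.
apply: fin_bigcap_measurable => // j _.
have [ji|ji] := boolP (j < i)%N.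
  rewrite (_ : [set x | _] = (fun x : borel_rV R m.+1 => (x : 'rV[R]_m.+1) 0 j) @^-1` [set 0]); last first.
    by apply/seteqP; split => x /=; [exact|move=> ->].
  by rewrite -[X in measurable X]setTI; exact: measurable_coord.
by rewrite (_ : [set x | _] = setT)//; apply/seteqP; split.
Qed.

Lemma weighted_ball m (A : set (m.-tuple R)) : measurable A ->
  weighted m A = weighted m (A `&` [set t | tnorm t < 1]).
Proof.
move=> mA; rewrite /weighted /= /density_measure.
rewrite [LHS]integral_mkcond [RHS]integral_mkcond; apply: eq_integral => t _.
rewrite !patchE; case: (boolP (t \in A)) => tA; last first.
  by rewrite memNset//= => -[At _]; move: tA; rewrite notin_setE => /(_ At).
rewrite inE in tA; case: (ltP (tnorm t) 1) => h; first by rewrite mem_set.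
rewrite memNset/=; last by move=> [_]; rewrite ltNge h.
rewrite /sphere_weight ler0_sqrtr ?invr0// subr_le0 -(expr1n _ 2).
by rewrite ler_pXn2r ?nnegrE// ?tnorm_ge0.
Qed.

Lemma measurable_unit_ball m : measurable [set t : m.-tuple R | tnorm t < 1].
Proof.
rewrite (_ : [set t | _] = tuple_ball 0 1); first exact: measurable_tuple_ball.
by apply/seteqP; split => t /=; rewrite /tuple_ball /= subr0.
Qed.

Lemma weighted_null m (A : set (m.-tuple R)) : measurable A ->
  lebesgue_tuple m (A `&` [set t | tnorm t < 1]) = 0%E -> weighted m A = 0%E.
Proof.
move=> mA A0; rewrite weighted_ball// /weighted /= /density_measure.
apply: null_set_integral => //.
  by apply: measurableI => //; exact: measurable_unit_ball.
apply/measurable_EFinP; apply: measurable_funTS; exact: measurable_sphere_weight.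
Qed.

Lemma chart_volumeE m (i : 'I_m.+1) s (A : set (borel_rV R m.+1)) : measurable A ->
  chart_volume (@hemisphere_chart R m.+1 i s : 'rV[R]_m -> 'rV[R]_m.+1) (open_ball R m) A =
  weighted m (tuple_chart i s @^-1` A).
Proof.
move=> mA.
have mFA : measurable (tuple_chart i s @^-1` A).
  by rewrite -[X in measurable X]setTI; exact: measurable_tuple_chart.
rewrite weighted_ball// /weighted /= /density_measure /chart_volume.
rewrite (_ : row_of_tuple @^-1` _ = tuple_chart i s @^-1` A `&` [set t | tnorm t < 1]); last first.
  by apply/seteqP; split => t /= [].
apply: eq_integral => t; rewrite inE => -[_ t1].
by rewrite sqrt_det_gram_hemisphere_chart.
Qed.

Let sum_hemispheres m (V : 'I_m.+1 -> bool -> \bar R) :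
  (forall i s, i != ord0 -> V i s = 0%E) ->
  (\sum_(i < m.+1) \sum_(s : bool) V i s = V ord0 false + V ord0 true)%E.
Proof.
move=> V0; rewrite (bigD1 ord0)//= [X in (_ + X)%E]big1 ?adde0; last first.
  by move=> i i0; rewrite big1// => s _; exact: V0.
by rewrite big_bool addeC.
Qed.

(** Only the two charts along the first axis contribute. A piece with i different from [ord0]
    satisfies x_0 = 0, and x_0 is one of the parameters of its own chart, so that it comes from a
    coordinate hyperplane, which is null. *)
Lemma sphere_volumeE m (A : set (borel_rV R m.+1)) : measurable A ->
  sphere_volume A = (weighted m (tuple_chart ord0 false @^-1` A) +
                     weighted m (tuple_chart ord0 true @^-1` A))%E.
Proof.
move=> mA.
have E s : chart_volume (@hemisphere_chart R m.+1 ord0 s : 'rV[R]_m -> 'rV[R]_m.+1) (open_ball R m)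
   (A `&` hemisphere_piece ord0 s) = weighted m (tuple_chart ord0 s @^-1` A).
  have mAp : measurable (A `&` (@hemisphere_piece R m.+1 ord0 s : set (borel_rV R m.+1))).
    by apply: measurableI => //; exact: measurable_hemisphere_piece.
  have mpre B : measurable B -> measurable (@tuple_chart m ord0 s @^-1` B).
    by move=> mB; rewrite -[X in measurable X]setTI; exact: measurable_tuple_chart.
  rewrite chart_volumeE// weighted_ball; last exact: mpre.
  rewrite [RHS]weighted_ball; last exact: mpre.
  congr (weighted m _); apply/seteqP; split => t /= [h t1]; split => //.
    by case: h.
  split => //.
  have p0 : 0 < 1 - tnorm t ^+ 2 by rewrite subr_gt0 expr_lt1// tnorm_ge0.
  split => //; last first.
    rewrite /tuple_chart hemisphere_chart_diag mulrA -expr2 sqrr_sign mul1r.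
    by rewrite sqrtr_gt0.
  rewrite /sphere /= /enorm big_ord_recl /tuple_chart hemisphere_chart_diag.
  under eq_bigr do rewrite hemisphere_chart_lift.
  rewrite exprMn sqrr_sign mul1r sqr_sqrtr ?(ltW p0)// -[X in _ + X](_ : tnorm t ^+ 2 = _).
    by rewrite subrK sqrtr1.
  by rewrite sqr_enorm; apply: eq_bigr => j _; rewrite expr2.
apply: etrans; [apply: sum_hemispheres|by congr (_ + _)%E; exact: E].
move=> i s i0.
have mAp : measurable (A `&` (@hemisphere_piece R m.+1 i s : set (borel_rV R m.+1))).
  by apply: measurableI => //; exact: measurable_hemisphere_piece.
have mpre : measurable (@tuple_chart m i s @^-1` (A `&` (@hemisphere_piece R m.+1 i s))).
  by rewrite -[X in measurable X]setTI; exact: measurable_tuple_chart.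
rewrite chart_volumeE//; apply: weighted_null => //.
have [k ik] : exists k, ord0 = lift i k.
  case: (unliftP i ord0) => [k ->|i00]; first by exists k.
  by rewrite i00 eqxx in i0.
apply: (@lebesgue_tuple_countable_slices _ _ k).
  by apply: measurableI => //; exact: measurable_unit_ball.
have i_gt0 : (0 < i)%N by rewrite lt0n.
move=> t; apply: (@sub_countable _ _ _ [set 0]); last exact: countable1.
apply: subset_card_le => x /= [[_ [_ _ h]] _].
have e (y : m.-tuple R) : (tuple_chart i s y : 'rV[R]_m.+1) 0 ord0 = tnth y k.
  by rewrite [X in _ 0 X]ik /tuple_chart hemisphere_chart_lift mxE.
have := e (update_tuple t k x); rewrite tnth_mktuple eqxx => <-.
exact: h.
Qed.

End borel_row_vectors.

Section sphere_measure.
Context {R : realType}.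
Variable m : nat.
Notation W := (@weighted R m).
Notation T := (borel_rV R m.+1).

Lemma measurable_chart_preimage i s (A : set T) : measurable A ->
  measurable (@tuple_chart R m i s @^-1` A).
Proof. by move=> mA; rewrite -[X in measurable X]setTI; exact: measurable_tuple_chart. Qed.

Lemma enorm_tuple_chart s (t : m.-tuple R) : tnorm t < 1 ->
  enorm (tuple_chart ord0 s t : 'rV[R]_m.+1) = 1.
Proof.
move=> t1; have p0 : 0 < 1 - tnorm t ^+ 2 by rewrite subr_gt0 expr_lt1// tnorm_ge0.
rewrite /enorm big_ord_recl /tuple_chart hemisphere_chart_diag.
under eq_bigr do rewrite hemisphere_chart_lift.
rewrite exprMn sqrr_sign mul1r sqr_sqrtr ?(ltW p0)// -[X in _ + X](_ : tnorm t ^+ 2 = _).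
  by rewrite subrK sqrtr1.
by rewrite sqr_enorm; apply: eq_bigr => j _; rewrite expr2.
Qed.

Lemma weighted_chart_sphere s :
  W (tuple_chart ord0 s @^-1` (sphere R m.+1 : set T)) = W setT.
Proof.
rewrite weighted_ball; last by apply: measurable_chart_preimage; exact: measurable_sphere.
rewrite [RHS]weighted_ball//; congr (W _); apply/seteqP; split => t /= [] // _ t1.
by split => //; exact: enorm_tuple_chart.
Qed.

Lemma weighted_setT_gt0 : (0 < W setT)%E.
Proof.
apply: (@lt_le_trans _ _ (((2 * 1)^-1 * (1 / 16) ^+ m.+1)%:E * unit_ball_volume m.+1)%E).
  by rewrite mule_gt0// ?unit_ball_volume_gt0// lte_fin mulr_gt0// ?exprn_gt0 ?divr_gt0 ?invr_gt0.
pose u : 'rV[R]_m.+1 := delta_mx 0 ord0.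
apply: (@weighted_cap_ge _ _ u) => //.
- by rewrite ltr01 lexx.
- rewrite /enorm (bigD1 ord0)//= big1 ?addr0 ?mxE ?eqxx ?expr1n ?sqrtr1//.
  by move=> i i0; rewrite !mxE/= (negbTE i0) expr0n.
- by rewrite mxE.
Qed.

Lemma weighted_setT_fin : W setT \is a fin_num.
Proof.
rewrite ge0_fin_numE ?(ltW weighted_setT_gt0)//.
rewrite (le_lt_trans (weighted_le measurableT))// lte_mul_pinfty//.
by have := @unit_ball_volume_fin R m.+1; rewrite ge0_fin_numE// ltW// unit_ball_volume_gt0.
Qed.

Definition sphere_mass : R := 2 * fine (W setT).

Lemma sphere_mass_gt0 : 0 < sphere_mass.
Proof. by rewrite mulr_gt0// fine_gt0// weighted_setT_gt0/= -ge0_fin_numE// ?weighted_setT_fin. Qed.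

Lemma sphere_volume_sphere : sphere_volume (sphere R m.+1 : set T) = sphere_mass%:E.
Proof.
rewrite sphere_volumeE; last exact: measurable_sphere.
by rewrite !weighted_chart_sphere /sphere_mass mulr2n mulrDl mul1r EFinD fineK ?weighted_setT_fin.
Qed.

Definition sphere_nng : {nonneg R} :=
  NngNum (ltW (divr_gt0 ltr01 sphere_mass_gt0)).

(** [sphere_probability] is a bare set function; this is a bundled measure that agrees with it on
    Borel sets. *)
Definition sphere_measure : {measure set T -> \bar R} :=
  mscale sphere_nng (measure_add
    (image_measure W (@measurable_tuple_chart R m ord0 false))
    (image_measure W (@measurable_tuple_chart R m ord0 true))).

Lemma sphere_measureE (A : set T) :
  sphere_measure A = ((sphere_mass^-1)%:E * (W (tuple_chart ord0 false @^-1` A) +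
                     W (tuple_chart ord0 true @^-1` A)))%E.
Proof.
rewrite /sphere_measure /= /mscale /=.
rewrite -[X in (X * _ = _)%E]/((1 / sphere_mass)%:E) mul1r; congr (_ * _)%E.
exact: measure_addE.
Qed.

Lemma sphere_probabilityE (A : set T) : measurable A ->
  sphere_probability A = sphere_measure A.
Proof.
move=> mA; rewrite /sphere_probability sphere_volume_sphere sphere_measureE.
by rewrite sphere_volumeE// muleC.
Qed.

Lemma sphere_measure_setT : sphere_measure setT = 1%E.
Proof.
rewrite sphere_measureE !preimage_setT.
have -> : (W setT + W setT = sphere_mass%:E)%E.
  by rewrite /sphere_mass mulr2n mulrDl mul1r EFinD fineK ?weighted_setT_fin.
by rewrite -EFinM mulVf// gt_eqF// sphere_mass_gt0.
Qed.

Lemma sphere_measure_null (A : set T) : measurable A ->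
  (forall s, lebesgue_tuple m (tuple_chart ord0 s @^-1` A `&` [set t | tnorm t < 1]) = 0%E) ->
  sphere_measure A = 0%E.
Proof.
move=> mA A0; rewrite sphere_measureE !weighted_null ?adde0 ?mule0//;
  exact: measurable_chart_preimage.
Qed.

(** The cone estimate is divided by the total mass, itself bounded by the same ball volume. To apply
    it, u is reflected into the half-space where the first coordinate is nonnegative, and only the
    hemisphere on the side of u is retained. *)
Lemma sphere_measure_cap (u : 'rV[R]_m.+1) (r : R) (A : set T) : (0 < m)%N ->
  sphere R m.+1 u -> 0 < r <= 1 -> measurable A ->
  (forall x, sphere R m.+1 x -> enorm (x - u) <= r -> A x) ->
  (((r / 16 ^+ 3) ^+ m)%:E <= sphere_measure A)%E.
Proof.
move=> m0 u1 /andP[r0 r1] mA hA.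
pose s := u 0 ord0 < 0.
pose u' : 'rV[R]_m.+1 := \row_j if j == ord0 then `|u 0 ord0| else u 0 j.
have u'1 : enorm u' = 1.
  rewrite -u1 /enorm; congr Num.sqrt; apply: eq_bigr => j _; rewrite mxE.
  by case: eqP => // ->; rewrite real_normK ?num_real.
have us : u 0 ord0 = (-1) ^+ s * `|u 0 ord0|.
  rewrite /s; case: ltP => h; first by rewrite ltr0_norm// expr1 mulN1r opprK.
  by rewrite ger0_norm// expr0 mul1r.
pose U := @tuple_chart R m ord0 s @^-1` A.
have mU : measurable U by exact: measurable_chart_preimage.
have hU : (((2 * r)^-1 * (r / 16) ^+ m.+1)%:E * unit_ball_volume m.+1 <= W U)%E.
  apply: (@weighted_cap_ge _ _ u') => //; first by rewrite r0 r1.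
    by rewrite mxE eqxx.
  move=> t t0 tu.
  have n0 : 0 < tnorm t.
    rewrite (lt_le_trans t0)// (le_trans (ler_norm _))//.
    by have := ler_coord_enorm (row_of_tuple t) ord0; rewrite mxE.
  have nt : tnorm t = hypot (tnorm [tuple of behead t]) (thead t).
    by rewrite -tnorm_cons; congr tnorm; exact: tuple_eta.
  have nt2 : tnorm t ^+ 2 = thead t ^+ 2 + tnorm [tuple of behead t] ^+ 2.
    by rewrite nt sqr_sqrtr ?addr_ge0 ?sqr_ge0.
  have t1 : tnorm (scale_tuple (tnorm t)^-1 [tuple of behead t]) < 1.
    rewrite tnorm_scale gtr0_norm ?invr_gt0// ltr_pdivrMl// mulr1.
    by rewrite -(ltr_pXn2r (ltn0Sn 1)) ?nnegrE ?tnorm_ge0// nt2 ltrDr exprn_gt0.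
  apply: hA; first exact: enorm_tuple_chart.
  apply: le_trans tu; rewrite le_eqVlt; apply/orP; left; apply/eqP.
  rewrite /enorm; congr Num.sqrt; rewrite !big_ord_recl; congr (_ + _).
    rewrite !mxE eqxx unlift_none -/(tnorm _) tnorm_scale.
    have -> : Num.sqrt (1 - (`|(tnorm t)^-1| * tnorm [tuple of behead t]) ^+ 2) =
        (tnorm t)^-1 * thead t.
      rewrite gtr0_norm ?invr_gt0//.
      have -> : 1 - ((tnorm t)^-1 * tnorm [tuple of behead t]) ^+ 2 = ((tnorm t)^-1 * thead t) ^+ 2.
        rewrite -[X in X - _](@mulVf _ (tnorm t ^+ 2)) ?expf_neq0 ?gt_eqF//.
        by rewrite !exprMn exprVn -mulrBr nt2 addrK.
      by rewrite sqrtr_sqr ger0_norm// mulr_ge0 ?invr_ge0 ?ltW.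
    by rewrite {1}us -mulrBr exprMn sqrr_sign mul1r.
  apply: eq_bigr => j _; rewrite !mxE liftK !mxE tnth_mktuple [tnth [tuple _ | _ < _] _]tnth_mktuple.
  rewrite addr0 tnth_behead.
  rewrite [lift ord0 j == ord0]eq_sym (negbTE (neq_lift _ _)).
  by have -> : lift ord0 j = inord j.+1 by apply/ord_inj; rewrite lift0 inordK ?ltnS.
rewrite sphere_measureE.
apply: (@le_trans _ _ ((sphere_mass^-1)%:E * W U)%E); last first.
  rewrite lee_wpmul2l ?lee_fin ?invr_ge0 ?(ltW sphere_mass_gt0)//.
  by rewrite /U; case: (s); rewrite ?leeDl ?leeDr.
have vfin := @unit_ball_volume_fin R m.+1.
have v0 : 0 < fine (unit_ball_volume m.+1 : \bar R).
  by rewrite fine_gt0// unit_ball_volume_gt0/= -ge0_fin_numE// ltW// unit_ball_volume_gt0.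
have mass_le : sphere_mass <= 2 * (2 ^+ m.+1 * fine (unit_ball_volume m.+1 : \bar R)).
  rewrite /sphere_mass ler_pM2l// -lee_fin fineK ?weighted_setT_fin//.
  by rewrite EFinM fineK// weighted_le.
rewrite muleC lee_pdivlMr ?sphere_mass_gt0//.
apply: le_trans hU; rewrite -(fineK vfin) -!EFinM lee_fin.
apply: (@le_trans _ _ ((r / 16 ^+ 3) ^+ m * (2 * (2 ^+ m.+1 * fine (unit_ball_volume m.+1 : \bar R))))).
  by rewrite ler_wpM2l// exprn_ge0// divr_ge0// ?exprn_ge0// ltW.
rewrite !mulrA ler_pM2r//.
have -> : (2 * r)^-1 * (r / 16) ^+ m.+1 = (r / 16) ^+ m / 32.
  by rewrite exprS; field; rewrite gt_eqF.
have -> : (r / 16 ^+ 3) ^+ m * 2 * 2 ^+ m.+1 = (r / 16) ^+ m * (4 * (2 / 16 ^+ 2) ^+ m).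
  have -> : r / 16 ^+ 3 = r / 16 * (16 ^+ 2)^-1 by field.
  rewrite (exprMn m (r / 16)) (exprMn m 2) (exprS 2 m).
  move: ((r / 16) ^+ m) (2 ^+ m) (_^-1 ^+ m) => a b c; ring.
rewrite ler_pM2l ?exprn_gt0 ?divr_gt0//.
(* Beyond the radius r / 16 of the packed balls, a spare factor 16 ^ 2 per dimension absorbs 2 * 2 ^
   (m + 1) from the total mass and 32 from the packing; this is an equality for m = 1. *)
have h : (2 / 16 ^+ 2) ^+ m <= 2 / 16 ^+ 2 :> R.
  rewrite -(prednK m0) exprSr ler_piMl ?divr_ge0 ?exprn_ge0//.
  rewrite exprn_ile1 ?divr_ge0 ?exprn_ge0// ler_pdivrMr ?exprn_gt0// mul1r.
  by rewrite -natrX ler_nat.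
have : (32^-1 : R) = 4 * (2 / 16 ^+ 2) by field.
by lra.
Qed.

End sphere_measure.

(** * Isolated zeros, and critical points of a difference of powers *)

Section isolated_zeros.
Context {R : realType}.

(** A point is determined by a nearby rational together with a radius of isolation, so each [F i]
    has at most one element. *)
Lemma isolated_points_countable (S : set R) :
  (forall x, S x -> exists2 e, 0 < e & forall y, S y -> `|y - x| < e -> y = x) ->
  countable S.
Proof.
move=> iS.
pose F (i : rat * nat) : set R := [set x | [/\ S x,
   `|x - ratr i.1| < i.2.+1%:R^-1 & forall y, S y -> `|y - x| < 2 * i.2.+1%:R^-1 -> y = x]].
have -> : S = \bigcup_i F i.
  apply/seteqP; split => [x Sx|x [i _ []//]].
  have [e e0 he] := iS _ Sx.
  pose k := Num.truncn (2 / e).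
  have ke : 2 * k.+1%:R^-1 < e.
    have /andP[_ h] : k%:R <= 2 / e < k.+1%:R by apply: truncn_itv; rewrite divr_ge0// ltW.
    by rewrite ltr_pdivrMr// mulrC -ltr_pdivrMr.
  have k0 : 0 < k.+1%:R^-1 :> R by rewrite invr_gt0.
  have lt_itv : x - k.+1%:R^-1 < x + k.+1%:R^-1.
    by rewrite ltrD2l -subr_gt0 opprK addr_gt0.
  have [r] := rat_in_itvoo lt_itv; rewrite in_itv/= => h.
  exists (r, k) => //; split => //=; first by rewrite distrC ltr_distl.
  by move=> y Sy yx; apply: he => //; exact: lt_trans ke.
apply: bigcup_countable => // i _.
have [[x0 Fx0]|nF] := pselect (exists x, F i x); last first.
  by rewrite (_ : F i = set0)//; apply/seteqP; split => // x Fx; apply: nF; exists x.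
apply: (@sub_countable _ _ _ [set x0]); last exact: countable1.
apply: subset_card_le => y [Sy hy _] /=; case: Fx0 => Sx0 hx0 h; apply: h => //.
rewrite -[y - x0](subrKA (ratr i.1)).
rewrite (le_lt_trans (ler_normD _ _))// mulr2n mulrDl mul1r ltrD//.
by rewrite distrC.
Qed.

(** Zeros accumulating at x would make the difference quotient vanish arbitrarily close to x. *)
Lemma is_derive_isolated (h : R -> R) (x d : R) : is_derive x 1 h d -> d != 0 ->
  h x = 0 -> exists2 e, 0 < e & forall y, h y = 0 -> `|y - x| < e -> y = x.
Proof.
move=> [dh hd] d0 hx0.
have : (k^-1 *: (h (k + x) - h x)) @[k --> 0^'] --> d.
  rewrite -hd; have := dh; rewrite /derivable /derive /=.
  by under eq_fun do rewrite [_ *: 1]mulr1.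
move/cvgrPdist_lt => /(_ `|d|); rewrite normr_gt0 => /(_ d0).
move=> /nbhs_ballP[e /= e0 he]; exists e => // y hy yx.
apply/eqP; rewrite -subr_eq0; apply/negPn/negP => yx0.
have := he (y - x); rewrite /ball/= sub0r normrN => /(_ yx yx0).
by rewrite subrK hy hx0 subr0 scaler0 subr0 ltxx.
Qed.

Lemma ln_lt_sub1 (u : R) : 0 < u -> u != 1 -> ln u < u - 1.
Proof.
move=> u0 u1; have l0 : ln u != 0 by rewrite ln_eq0.
by have := expR_gt1Dx l0; rewrite lnK// ltrBrDl.
Qed.

(** This is the logarithm of t ^ q (4 - t), where 4 is the largest squared distance on the unit
    sphere. It is strictly concave, so a value strictly between two points exceeds the smaller of
    the two end values. *)
Lemma strict_quasiconcave (q x y z : R) : 0 < q -> 0 < x -> x < y -> y < z -> z < 4 ->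
  Num.min (q * ln x + ln (4 - x)) (q * ln z + ln (4 - z)) < q * ln y + ln (4 - y).
Proof.
move=> q0 x0 xy yz z4.
have y0 : 0 < y by exact: lt_trans xy.
have y4 : 0 < 4 - y by rewrite subr_gt0 (lt_trans yz).
(* the graph lies below its tangent line at y *)
have T t : 0 < t -> t < 4 -> t != y ->
    q * ln t + ln (4 - t) < q * ln y + ln (4 - y) + (t - y) * (q / y - (4 - y)^-1).
  move=> t0 t4 ty; have t4' : 0 < 4 - t by rewrite subr_gt0.
  have h1 : ln t - ln y < t / y - 1.
    rewrite -ln_div ?posrE//; apply: ln_lt_sub1; first by rewrite divr_gt0.
    by apply: contra ty => /eqP h; rewrite -[t](divfK (lt0r_neq0 y0)) h mul1r.
  have h2 : ln (4 - t) - ln (4 - y) < (4 - t) / (4 - y) - 1.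
    rewrite -ln_div ?posrE//; apply: ln_lt_sub1; first by rewrite divr_gt0.
    apply: contra ty => /eqP h; have : 4 - t = 4 - y by rewrite -[LHS](divfK (lt0r_neq0 y4)) h mul1r.
    by move=> ?; apply/eqP; lra.
  have -> : (t - y) * (q / y - (4 - y)^-1) = q * (t / y - 1) + ((4 - t) / (4 - y) - 1).
    by field; rewrite !gt_eqF.
  have : q * (ln t - ln y) < q * (t / y - 1) by rewrite ltr_pM2l.
  by lra.
rewrite gt_min; have [K0|K0] := leP (q / y - (4 - y)^-1) 0.
  apply/orP; right; apply: (lt_le_trans (T z _ _ _)) => //.
  - exact: lt_trans yz.
  - by rewrite gt_eqF.
  - by rewrite gerDl mulr_ge0_le0// subr_ge0 ltW.
apply/orP; left; apply: (lt_le_trans (T x _ _ _)) => //.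
- by rewrite (lt_trans xy)// (lt_trans yz).
- by rewrite lt_eqF.
- by rewrite gerDl mulr_le0_ge0// ?ltW// subr_lt0.
Qed.

(* The two equations hold at the critical points of the difference
   d1 `^ al - d2 `^ al on the sphere; the first one forces d1 to decrease with
   d2, the second one forces it to increase. *)
Lemma critical_pair_unique (q al c a b a' b' : R) : 0 < q -> 0 < al ->
  0 < b -> b < a -> a < 4 -> 0 < b' -> b' < a' -> a' < 4 ->
  q * ln a + ln (4 - a) = q * ln b + ln (4 - b) ->
  q * ln a' + ln (4 - a') = q * ln b' + ln (4 - b') ->
  a `^ al - b `^ al = c -> a' `^ al - b' `^ al = c -> a = a'.
Proof.
move=> q0 al0.
pose g x := q * ln x + ln (4 - x); rewrite -!/(g _).
have QC x y z : 0 < x -> x < y -> y < z -> z < 4 -> Num.min (g x) (g z) < g y.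
  exact: strict_quasiconcave.
wlog : a b a' b' / b <= b' => [wlg|].
  move=> b0 ba a4 b'0 b'a' a'4 e e' ec ec'.
  have [bb|/ltW bb] := leP b b'; first exact: wlg bb _ _ _ _ _ _ _ _ _ _.
  by apply/esym; exact: (wlg a' b' a b).
move=> bb' b0 ba a4 b'0 b'a' a'4 e e' ec ec'.
have a0 := lt_trans b0 ba; have a'0 := lt_trans b'0 b'a'.
move: bb'; rewrite le_eqVlt => /predU1P[bb|bb].
  apply: (powR_injective al0); rewrite ?nnegrE ?ltW//.
  by move: ec'; rewrite -ec bb => /addIr.
exfalso.
have aa : a < a'.
  rewrite ltNge; apply/negP => aa.
  have h1 : a' `^ al <= a `^ al by apply: ge0_ler_powR => //; rewrite ?nnegrE ltW.
  have h2 : b `^ al < b' `^ al by apply: gt0_ltr_powR => //; rewrite nnegrE ltW.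
  by lra.
(* Two pairs at equal levels of such a function must be nested, whereas b < b' and a < a'. The cases
   are the positions of b' relative to a. *)
have ga' : g a' < g a.
  by have := QC _ _ _ b0 ba aa a'4; rewrite -e gt_min ltxx.
have [b'a|] := ltP b' a.
  by have := QC _ _ _ b0 bb b'a a4; rewrite -e minxx -e' => h; have := lt_trans h ga'; rewrite ltxx.
rewrite le_eqVlt => /predU1P[ab'|ab'].
  by move: ga'; rewrite ab' e' ltxx.
have := QC _ _ _ a0 ab' b'a' a'4; rewrite -e' gt_min ltxx orbF => h.
by have := lt_trans h ga'; rewrite ltxx.
Qed.

End isolated_zeros.

(** * Ties between two costs *)

Section null_sets.
Context {R : realType}.
Variable m : nat.
Notation T := (borel_rV R m.+1).
Notation V := 'rV[R]_m.+1.

(** On a line of a chart parallel to the j-th axis, [K] and [B] are the parts of the scalar product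
    with v and of 1 - |t| ^ 2 that stay constant. *)
Let K (t : m.-tuple R) (j : 'I_m) (v : V) : R :=
  \sum_(i < m | i != j) tnth t i * v 0 (lift ord0 i).
Let B (t : m.-tuple R) (j : 'I_m) : R := 1 - \sum_(i < m | i != j) tnth t i ^+ 2.

Let tnorm_update (t : m.-tuple R) j x :
  1 - tnorm (update_tuple t j x) ^+ 2 = B t j - x ^+ 2.
Proof.
rewrite sqr_enorm /dot (bigD1 j)//= !mxE tnth_mktuple eqxx /B -expr2.
under eq_bigr => i ij do rewrite !mxE tnth_mktuple (negbTE ij) -expr2.
by ring.
Qed.

Let dot_slice (t : m.-tuple R) j x s (v : V) :
  dot (tuple_chart ord0 s (update_tuple t j x) : V) v =
  K t j v + x * v 0 (lift ord0 j) + (-1) ^+ s * Num.sqrt (B t j - x ^+ 2) * v 0 ord0.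
Proof.
rewrite /dot big_ord_recl /tuple_chart hemisphere_chart_diag.
rewrite -/(tnorm _) tnorm_update addrC; congr (_ + _).
under eq_bigr do rewrite hemisphere_chart_lift mxE tnth_mktuple.
rewrite (bigD1 j)//= eqxx addrC; congr (_ + _); apply: eq_bigr => i ij.
by rewrite (negbTE ij).
Qed.

Let slice_pos (t : m.-tuple R) j x :
  tnorm (update_tuple t j x) < 1 -> 0 < B t j - x ^+ 2.
Proof. by move=> t1; rewrite -tnorm_update subr_gt0 expr_lt1// tnorm_ge0. Qed.

Lemma sphere_null_slices (A : set T) : measurable A ->
  (forall s, exists j : 'I_m, forall t : m.-tuple R,
    countable [set x : R | tnorm (update_tuple t j x) < 1 /\
      A (tuple_chart ord0 s (update_tuple t j x))]) ->
  sphere_measure m A = 0%E.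
Proof.
move=> mA h; apply: sphere_measure_null => // s; have [j hj] := h s.
apply: (@lebesgue_tuple_countable_slices _ _ j).
  apply: measurableI; first exact: measurable_chart_preimage.
  exact: measurable_unit_ball.
move=> t; apply: sub_countable (hj t); apply: subset_card_le => x /= [h1 h2].
by [].
Qed.

Lemma measurable_dot (v : V) : measurable_fun [set: T] (fun x : T => dot (x : V) v).
Proof.
by apply: measurable_sum => i; apply: measurable_funM => //; exact: measurable_coord.
Qed.

Lemma measurable_hyperplane (v : V) (e : R) :
  measurable ([set x | dot (x : V) v = e] : set T).
Proof.
rewrite (_ : [set x | _] = (fun x : T => dot (x : V) v) @^-1` [set e])//.
by rewrite -[X in measurable X]setTI; exact: measurable_dot.
Qed.

(** Squaring away the root of the chart leaves, on a line along the j-th axis, a quadratic equation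
    with leading coefficient v_j ^ 2 + v_0 ^ 2, nonzero for a suitable j. Its roots add up to 2 b /
    a, so one solution x0 determines the only other candidate. *)
Lemma hyperplane_null (v : V) (e : R) : (0 < m)%N -> v != 0 ->
  sphere_measure m [set x | dot (x : V) v = e] = 0%E.
Proof.
move=> m0 v0; apply: sphere_null_slices; first exact: measurable_hyperplane.
move=> s.
have [j vj] : exists j : 'I_m, v 0 (lift ord0 j) ^+ 2 + v 0 ord0 ^+ 2 != 0.
  have [v00|v00] := eqVneq (v 0 ord0) 0; last first.
    exists (Ordinal m0); rewrite gt_eqF// ltr_wpDl ?sqr_ge0//.
    by rewrite lt_neqAle sqr_ge0 andbT eq_sym sqrf_eq0.
  have [j vj] : exists j : 'I_m, v 0 (lift ord0 j) != 0.
    apply/existsP; rewrite -negb_forall; apply: contra v0 => /forallP h.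
    apply/eqP/rowP => i; rewrite mxE.
    by case: (unliftP ord0 i) => [k ->|->//]; exact/eqP/h.
  by exists j; rewrite v00 expr0n addr0 sqrf_eq0.
exists j => t.
pose a := v 0 (lift ord0 j) ^+ 2 + v 0 ord0 ^+ 2.
pose b := (e - K t j v) * v 0 (lift ord0 j).
have quad x : tnorm (update_tuple t j x) < 1 ->
    dot (tuple_chart ord0 s (update_tuple t j x) : V) v = e ->
    a * x ^+ 2 - 2 * b * x = v 0 ord0 ^+ 2 * B t j - (e - K t j v) ^+ 2.
  move=> /slice_pos h; rewrite dot_slice => hd.
  have : ((-1) ^+ s * Num.sqrt (B t j - x ^+ 2) * v 0 ord0) ^+ 2 =
      (e - K t j v - x * v 0 (lift ord0 j)) ^+ 2.
    by congr (_ ^+ 2); rewrite -hd; ring.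
  rewrite !exprMn sqrr_sign mul1r sqr_sqrtr ?(ltW h)// /a /b => h2.
  have -> : v 0 ord0 ^+ 2 * B t j = (B t j - x ^+ 2) * v 0 ord0 ^+ 2 + x ^+ 2 * v 0 ord0 ^+ 2.
    by ring.
  by rewrite h2; ring.
have [[x0 [n0 h0]]|nh] := pselect (exists x, tnorm (update_tuple t j x) < 1 /\
    dot (tuple_chart ord0 s (update_tuple t j x) : V) v = e); last first.
  rewrite (_ : [set x | _] = set0)//; apply/seteqP; split => // x hx.
  by apply: nh; exists x.
apply: (@sub_countable _ _ _ [set x0; 2 * b / a - x0]); last first.
  by apply: finite_set_countable; exact: finite_set2.
apply: subset_card_le => x /= [n1 h1].
have := quad _ n1 h1; rewrite -(quad _ n0 h0) => e1.
have : (x - x0) * (x - (2 * b / a - x0)) = 0.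
  apply: (mulfI vj); rewrite mulr0 -/a.
  have -> : a * ((x - x0) * (x - (2 * b / a - x0))) = (a * x ^+ 2 - 2 * b * x) - (a * x0 ^+ 2 - 2 * b * x0).
    by field.
  by rewrite e1 subrr.
by move/eqP; rewrite mulf_eq0 !subr_eq0 => /orP[/eqP|/eqP]; [left|right].
Qed.

Section tie.
Variables (w1 w2 : V) (al c : R).
Hypotheses (w1S : enorm w1 = 1) (w2S : enorm w2 = 1) (al0 : 0 < al).

(** On the sphere, [d1] and [d2] are the squared distances to w1 and w2, so al stands for p / 2. Up
    to the factor - 2 al, [n] is the gradient of d1 ^ al - d2 ^ al. *)
Let d1 (x : V) : R := 2 - 2 * dot x w1.
Let d2 (x : V) : R := 2 - 2 * dot x w2.
Let n (x : V) : V := d1 x `^ (al - 1) *: w1 - d2 x `^ (al - 1) *: w2.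
Let tie_set : set T := [set x | [/\ d1 x `^ al - d2 x `^ al = c, 0 < d1 x & 0 < d2 x]].
(** The j-th coordinate direction of a chart is the tangent vector e_j - (x_j / x_0) e_0; the
    condition says that [n] is not orthogonal to it, so that the tie function has a nonzero
    derivative along the j-th axis. *)
Let regular (j : 'I_m) : set T :=
  tie_set `&` [set x | n x 0 (lift ord0 j) * (x : V) 0 ord0 != (x : V) 0 (lift ord0 j) * n x 0 ord0].

Let md1 : measurable_fun [set: T] (fun x : T => d1 x).
Proof. by apply: measurable_funB => //; apply: measurable_funM => //; exact: measurable_dot. Qed.

Let md2 : measurable_fun [set: T] (fun x : T => d2 x).
Proof. by apply: measurable_funB => //; apply: measurable_funM => //; exact: measurable_dot. Qed.

Let mtie : measurable tie_set.
Proof.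
rewrite (_ : tie_set = (fun x : T => d1 x `^ al - d2 x `^ al) @^-1` [set c] `&`
   ((fun x : T => d1 x) @^-1` `]0, +oo[%classic `&` (fun x : T => d2 x) @^-1` `]0, +oo[%classic)); last first.
  by apply/seteqP; split => x /=; rewrite !in_itv/= !andbT; [move=> []|move=> [? []]].
apply: measurableI; last apply: measurableI; rewrite -[X in measurable X]setTI.
- by apply: measurable_funB => //; apply: (measurableT_comp (measurable_powR _)).
- exact: md1.
- exact: md2.
Qed.

Let mn i : measurable_fun [set: T] (fun x : T => n x 0 i).
Proof.
rewrite (_ : (fun x => _) = (fun x : T => d1 x `^ (al - 1) * w1 0 i - d2 x `^ (al - 1) * w2 0 i)); last first.
  by apply/funext => x; rewrite !mxE.
by apply: measurable_funB => //; apply: measurable_funM => //;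
  apply: (measurableT_comp (measurable_powR _)).
Qed.

Let mregular j : measurable (regular j).
Proof.
apply: measurableI => //.
rewrite (_ : [set x | _] = (fun x : T => n x 0 (lift ord0 j) * (x : V) 0 ord0 -
   (x : V) 0 (lift ord0 j) * n x 0 ord0) @^-1` [set~ 0]); last first.
  by apply/seteqP; split => x /=; rewrite -subr_eq0 => /eqP.
rewrite -[X in measurable X]setTI.
have mf : measurable_fun [set: T] (fun x : T => n x 0 (lift ord0 j) * (x : V) 0 ord0 -
   (x : V) 0 (lift ord0 j) * n x 0 ord0).
  by apply: measurable_funB; apply: measurable_funM => //; exact: measurable_coord.
by apply: mf => //; apply: measurableC.
Qed.

Let regular_null j : sphere_measure m (regular j) = 0%E.
Proof.
apply: sphere_null_slices => // s; exists j => t.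
pose u (w : V) (x : R) := 2 - 2 * (K t j w + x * w 0 (lift ord0 j) +
  (-1) ^+ s * Num.sqrt (B t j - x ^+ 2) * w 0 ord0).
pose H (x : R) := u w1 x `^ al - u w2 x `^ al - c.
apply: isolated_points_countable => x [/slice_pos Bx [[tie p1 p2] reg]].
have e1 y : d1 (tuple_chart ord0 s (update_tuple t j y)) = u w1 y by rewrite /d1 dot_slice.
have e2 y : d2 (tuple_chart ord0 s (update_tuple t j y)) = u w2 y by rewrite /d2 dot_slice.
have du w : is_derive x 1 (u w) (- 2 * (w 0 (lift ord0 j) -
    (-1) ^+ s * (x / Num.sqrt (B t j - x ^+ 2)) * w 0 ord0)).
  have dS : is_derive x 1 (fun x => Num.sqrt (B t j - x ^+ 2)) (- (x / Num.sqrt (B t j - x ^+ 2))).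
    apply: (is_derive_eq (@is_derive1_comp _ (@Num.sqrt R) (fun x => B t j - x ^+ 2) x _ _
       (is_derive1_sqrt Bx) _)).
    by rewrite /GRing.scale/=; field; rewrite gt_eqF ?sqrtr_gt0.
  apply: is_derive_eq.
  rewrite /GRing.scale/=; ring.
rewrite e1 in p1; rewrite e2 in p2.
have dH : is_derive x 1 H (al * u w1 x `^ (al - 1) * (- 2 * (w1 0 (lift ord0 j) -
    (-1) ^+ s * (x / Num.sqrt (B t j - x ^+ 2)) * w1 0 ord0)) -
   al * u w2 x `^ (al - 1) * (- 2 * (w2 0 (lift ord0 j) -
    (-1) ^+ s * (x / Num.sqrt (B t j - x ^+ 2)) * w2 0 ord0))).
  have h1 := @is_derive1_comp _ (@powR R ^~ al) (u w1) x _ _ (is_derive1_powR al p1) (du w1).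
  have h2 := @is_derive1_comp _ (@powR R ^~ al) (u w2) x _ _ (is_derive1_powR al p2) (du w2).
  by apply: is_derive_eq; rewrite subr0.
have [||e e0 he] := @is_derive_isolated _ H x _ dH.
- apply: contra reg => /eqP hz.
  have nE i : n (tuple_chart ord0 s (update_tuple t j x)) 0 i =
      u w1 x `^ (al - 1) * w1 0 i - u w2 x `^ (al - 1) * w2 0 i.
    by rewrite /n e1 e2 !mxE.
  have x0E : (tuple_chart ord0 s (update_tuple t j x) : V) 0 ord0 =
      (-1) ^+ s * Num.sqrt (B t j - x ^+ 2).
    by rewrite /tuple_chart hemisphere_chart_diag -/(tnorm _) tnorm_update.
  have xjE : (tuple_chart ord0 s (update_tuple t j x) : V) 0 (lift ord0 j) = x.
    by rewrite /tuple_chart hemisphere_chart_lift mxE tnth_mktuple eqxx.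
  rewrite !nE x0E xjE.
  move: hz Bx; move: (u w1 x `^ _) (u w2 x `^ _) => P Q hz.
  rewrite -sqrtr_gt0; move: (Num.sqrt _) hz => S hz S0.
  have ss : (-1) ^+ s * (-1) ^+ s = 1 :> R by rewrite -expr2 sqrr_sign.
  move: ((-1) ^+ s) hz ss => sg hz ss.
  rewrite -subr_eq0; apply/eqP; apply: (mulfI (lt0r_neq0 al0)); rewrite mulr0.
  (* Multiplying the vanishing derivative by - sg S / 2 clears the denominator S and the factor - 2;
     since x_0 = sg S, the result is the equality excluded by [regular]. *)
  rewrite -[RHS](mulr0 (- sg * S / 2)) -[X in _ = _ * X]hz.
  transitivity (al * ((P * w1 0 (lift ord0 j) - Q * w2 0 (lift ord0 j)) * (sg * S) -
     (sg * sg) * (x * (P * w1 0 ord0 - Q * w2 0 ord0)))).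
    by rewrite ss mul1r.
  by field; rewrite gt_eqF.
- by rewrite /H -e1 -e2 tie subrr.
exists e => // y [_ [[tiey _ _] _]]; apply: he.
by rewrite /H -e1 -e2 tiey subrr.
Qed.

Let nneg_null (v : V) e : (0 < m)%N -> v != 0 ->
  (sphere_measure m).-negligible [set x | dot (x : V) v = e].
Proof.
by move=> m0 v0; apply/negligibleP; [exact: measurable_hyperplane|exact: hyperplane_null].
Qed.

Let w1_neq0 : w1 != 0.
Proof. by rewrite -enorm_eq0 w1S oner_eq0. Qed.

Let w2_neq0 : w2 != 0.
Proof. by rewrite -enorm_eq0 w2S oner_eq0. Qed.

Let critical : set T := [set x | [/\ sphere R m.+1 x, tie_set x, (x : V) 0 ord0 != 0 &
  forall j : 'I_m, n x 0 (lift ord0 j) * (x : V) 0 ord0 = (x : V) 0 (lift ord0 j) * n x 0 ord0]].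

(* At a critical point n is proportional to x, and eliminating <w1, w2> from
   <n, x>, <n, w1>, <n, w2> gives d1^(2 al - 1) (4 - d1) = d2^(2 al - 1) (4 - d2). *)
Let critical_eq x : critical x ->
  d1 x `^ (2 * al - 1) * (4 - d1 x) = d2 x `^ (2 * al - 1) * (4 - d2 x).
Proof.
move=> [xS [_ p1 p2] x0 nx].
pose mu := n x 0 ord0 / (x : V) 0 ord0.
have nmu : n x = mu *: (x : V).
  apply/rowP => i; rewrite [RHS]mxE; apply: (mulIf x0).
  case: (unliftP ord0 i) => [j ->|->]; rewrite ?nx /mu; field; exact: x0.
have xx : dot (x : V) x = 1 by rewrite -sqr_enorm xS expr1n.
have ww1 : dot w1 w1 = 1 by rewrite -sqr_enorm w1S expr1n.
have ww2 : dot w2 w2 = 1 by rewrite -sqr_enorm w2S expr1n.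
pose P := d1 x `^ (al - 1); pose Q := d2 x `^ (al - 1).
pose u := dot (x : V) w1; pose v := dot (x : V) w2; pose k := dot w1 w2.
have hx : P * u - Q * v = mu.
  have := congr1 (fun y => dot y (x : V)) nmu.
  by rewrite /n dotDl dotNl !dotZl xx mulr1 !(dotC _ (x : V)).
have h1 : P - Q * k = mu * u.
  have := congr1 (fun y => dot y w1) nmu.
  by rewrite /n dotDl dotNl !dotZl ww1 mulr1 (dotC w2).
have h2 : P * k - Q = mu * v.
  have := congr1 (fun y => dot y w2) nmu.
  by rewrite /n dotDl dotNl !dotZl ww2 mulr1.
have key : P ^+ 2 * (1 - u ^+ 2) = Q ^+ 2 * (1 - v ^+ 2).
  have : P * (P - Q * k) + Q * (P * k - Q) = P * (mu * u) + Q * (mu * v) by rewrite h1 h2.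
  by rewrite -hx => h; apply/eqP; rewrite -subr_eq0; apply/eqP; move/eqP: h;
     rewrite -subr_eq0 => /eqP h; rewrite -[RHS]h; ring.
have pow d : 0 < d -> d `^ (2 * al - 1) = (d `^ (al - 1)) ^+ 2 * d.
  move=> d0; have -> : 2 * al - 1 = (al - 1) + (al - 1) + 1 by ring.
  by rewrite !powRD ?(gt_eqF d0) ?implybT// powRr1 ?(ltW d0)// expr2.
rewrite !pow// -/P -/Q.
have -> : P ^+ 2 * d1 x * (4 - d1 x) = 4 * (P ^+ 2 * (1 - u ^+ 2)) by rewrite /d1 -/u; ring.
have -> : Q ^+ 2 * d2 x * (4 - d2 x) = 4 * (Q ^+ 2 * (1 - v ^+ 2)) by rewrite /d2 -/v; ring.
by rewrite key.
Qed.

(** Since 1/2 < al the exponent 2 al - 1 is positive, and 0 < c gives d2 < d1: this is the setting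
    of [critical_pair_unique], which puts all critical points in a single hyperplane orthogonal to
    w1. *)
Lemma tie_null : (0 < m)%N -> 2^-1 < al -> 0 < c ->
  (sphere_measure m).-negligible [set x : T | sphere R m.+1 x /\
    d1 x `^ al - d2 x `^ al = c].
Proof.
move=> m0 al2 c0.
have critical_null : (sphere_measure m).-negligible critical.
  have [[x cx]|nc] := pselect (exists x, critical x); last first.
    rewrite (_ : critical = set0); first exact: negligible_set0.
    by apply/seteqP; split => // x cx; apply: nc; exists x.
  apply: (@negligibleS _ _ _ _ ([set y | dot (y : V) w1 = dot (x : V) w1] : set T)); last exact: nneg_null.
  move=> y cy /=.
  have lt21 z : tie_set z -> d2 z < d1 z.
    move=> [tz p1 p2]; rewrite ltNge; apply/negP => h.
    have : d1 z `^ al <= d2 z `^ al.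
      by apply: ge0_ler_powR => //; rewrite ?nnegrE ltW.
    by lra.
  have lt4 z : critical z -> d1 z < 4.
    move=> cz; have [_ tz _ _] := cz; have := critical_eq cz; have [_ p1 p2] := tz.
    have lt := lt21 _ tz; have [d14|d14] := ltP (d1 z) 4; first by [].
    have d14e : d1 z <= 4.
      rewrite /d1; have := ler_enormD; have [zS _ _ _] := cz.
      have := cauchy_schwarz (- (z : V)) w1; rewrite enormN zS w1S mulr1 dotNl; lra.
    have -> : d1 z = 4 by apply/eqP; rewrite eq_le d14e d14.
    rewrite subrr mulr0 => /esym/eqP; rewrite mulf_eq0 (gt_eqF (powR_gt0 _ p2)) /= subr_eq0 => /eqP h.
    by lra.
  have logeq z : critical z ->
     (2 * al - 1) * ln (d1 z) + ln (4 - d1 z) = (2 * al - 1) * ln (d2 z) + ln (4 - d2 z).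
    move=> cz; have [_ tz _ _] := cz; have [_ p1 p2] := tz.
    have l4 := lt4 _ cz; have l21 := lt21 _ tz.
    have := congr1 (@ln R) (critical_eq cz).
    by rewrite !lnM ?posrE ?powR_gt0// ?subr_gt0 ?(lt_trans l21 l4)// !ln_powR.
  have [_ tx _ _] := cx; have [ex px1 px2] := tx.
  have [_ ty _ _] := cy; have [ey py1 py2] := ty.
  have : d1 y = d1 x.
    apply: (@critical_pair_unique _ (2 * al - 1) al c (d1 y) (d2 y) (d1 x) (d2 x)) => //;
      rewrite ?lt21 ?lt4 ?logeq//.
    by lra.
  by rewrite /d1; lra.
pose F k := if insub k is Some j then regular j else set0.
have F0 : (sphere_measure m).-negligible (\bigcup_k F k).
  apply: negligible_bigcup => k; rewrite /F; case: insubP => [j _ _|_].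
    by apply/negligibleP; [exact: mregular|exact: regular_null].
  exact: negligible_set0.
pose e0 : V := delta_mx 0 ord0.
have e00 : e0 != 0.
  by apply/eqP => /rowP/(_ ord0)/eqP; rewrite !mxE eqxx oner_eq0.
have e0E (x : V) : dot x e0 = x 0 ord0.
  rewrite /dot (bigD1 ord0)//= big1 ?addr0 ?mxE ?eqxx ?mulr1// => k kj.
  by rewrite mxE/= (negbTE kj) mulr0.
(* Besides the regular and the critical ties, one discards the equator x_0 = 0, which lies in
   neither chart, and the points w1 and w2, where the powers need not be differentiable; each of
   these lies in a hyperplane. *)
apply: (@negligibleS _ _ _ _ ((\bigcup_k F k) `|` critical `|`
  [set x | dot (x : V) e0 = 0] `|` [set x | dot (x : V) w1 = 1] `|` [set x | dot (x : V) w2 = 1] : set T)).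
  move=> x [xS ex].
  have dle w : enorm w = 1 -> dot (x : V) w <= 1.
    by move=> wS; have := cauchy_schwarz (x : V) w; rewrite xS wS mulr1.
  have [h2|h2] := eqVneq (dot (x : V) w2) 1; first by right.
  have [h1|h1] := eqVneq (dot (x : V) w1) 1; first by left; right.
  have p1 : 0 < d1 x.
    have : dot (x : V) w1 < 1 by rewrite lt_neqAle h1 dle.
    by rewrite /d1; lra.
  have p2 : 0 < d2 x.
    have : dot (x : V) w2 < 1 by rewrite lt_neqAle h2 dle.
    by rewrite /d2; lra.
  have [x0|x0] := eqVneq ((x : V) 0 ord0) 0.
    by left; left; right; rewrite /= e0E.
  do 3 left.
  have [[j hj]|nj] := pselect (exists j : 'I_m,
     n x 0 (lift ord0 j) * (x : V) 0 ord0 != (x : V) 0 (lift ord0 j) * n x 0 ord0).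
    by left; exists j => //; rewrite /F valK.
  right; split => // j; apply/eqP/negPn/negP => hj.
  by apply: nj; exists j.
by do 4 (apply: negligibleU; last by [|exact: nneg_null]).
Qed.

End tie.

Lemma tie_negligible (w1 w2 : V) (p c : R) : (0 < m)%N -> 1 < p ->
  enorm w1 = 1 -> enorm w2 = 1 -> w1 != w2 ->
  (sphere_measure m).-negligible [set x : T | sphere R m.+1 x /\
    enorm ((x : V) - w1) `^ p - enorm ((x : V) - w2) `^ p = c].
Proof.
move=> m0 p1 w1S w2S w12; have p0 : 0 < p by exact: lt_trans p1.
have pw (x w : V) : sphere R m.+1 x -> enorm w = 1 ->
    enorm (x - w) `^ p = (2 - 2 * dot x w) `^ (p / 2).
  move=> xS wS; have pE : p = 2%:R * (p / 2) by field.
  rewrite {1}pE powRrM powR_mulrn ?enorm_ge0// sqr_enormB xS wS !expr1n.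
  by congr (_ `^ _); ring.
wlog c0 : w1 w2 c w1S w2S w12 / 0 <= c => [wlg|].
  have [c0|/ltW c0] := leP 0 c; first exact: wlg.
  have := wlg w2 w1 (- c) w2S w1S; rewrite oppr_ge0 eq_sym => /(_ w12 c0).
  by apply: negligibleS => x /= [xS <-]; rewrite opprB.
move: c0; rewrite le_eqVlt => /predU1P[c0|c0].
  apply: (@negligibleS _ _ _ _ ([set x | dot (x : V) (w1 - w2) = 0] : set T)); last first.
    apply/negligibleP; first exact: measurable_hyperplane.
    by apply: hyperplane_null => //; rewrite subr_eq0.
  move=> x /= [xS]; rewrite -c0 => /eqP; rewrite subr_eq0 => /eqP/(powR_injective p0).
  rewrite !nnegrE !enorm_ge0 => /(_ isT isT) h.
  have := sqr_enormB (x : V) w1; rewrite h sqr_enormB w1S w2S.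
  by rewrite dotDr dotNr => ?; lra.
have al0 : 0 < p / 2 by rewrite divr_gt0.
have al2 : 2^-1 < p / 2 by rewrite ltr_pdivlMr// mulVf.
apply: negligibleS (tie_null w1S w2S al0 m0 al2 c0) => x /= [xS].
by rewrite !pw.
Qed.

End null_sets.

Lemma measure_bigsetU_le d (T : measurableType d) (R : realType)
    (mu : {measure set T -> \bar R}) I (s : seq I) (F : I -> set T) :
  (forall i, measurable (F i)) ->
  (mu (\big[setU/set0]_(i <- s) F i) <= \sum_(i <- s) mu (F i))%E.
Proof.
move=> mF; elim: s => [|i s ih]; first by rewrite !big_nil measure0.
rewrite !big_cons; apply: le_trans (leeD2l _ ih); apply: measureU2 => //.
by elim/big_ind : _ => // *; exact: measurableU.
Qed.

(** * Semidiscrete transport *)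

Section semidiscrete.
Context d (T : measurableType d) (R : realType).
Variables (mu : {measure set T -> \bar R}) (L : nat) (j0 : 'I_L).
Variables (c : 'I_L -> T -> R) (M : R).
Hypotheses (mu1 : mu setT = 1%E) (mc : forall k, measurable_fun [set: T] (c k)).
Hypothesis (cM : forall k x, 0 <= c k x <= M).
Hypothesis (ties : forall k l e, k != l -> mu.-negligible [set x | c k x - c l x = e]).
Implicit Types (lam : 'I_L -> R).

(** The default value of the minimum is itself one of the terms, so it does not change the
    minimum. *)
Definition lower_envelope lam (x : T) : R :=
  \big[Num.min/c j0 x + lam j0]_(k < L) (c k x + lam k).
Local Notation phi := lower_envelope.

Lemma lower_envelope_le lam k x : phi lam x <= c k x + lam k.
Proof. exact: bigmin_le. Qed.

Lemma le_lower_envelope lam y x :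
  (forall k, y <= c k x + lam k) -> y <= phi lam x.
Proof. by move=> h; apply: le_bigmin => // k _. Qed.

Lemma measurable_lower_envelope lam : measurable_fun [set: T] (phi lam).
Proof.
have m k : measurable_fun [set: T] (fun x => c k x + lam k).
  by apply: measurable_funD.
rewrite /lower_envelope; elim: (index_enum _) => [|k s ih].
  by under eq_fun do rewrite big_nil; exact: m.
under eq_fun do rewrite big_cons.
by apply: measurable_minr => //; exact: m.
Qed.

Let mu_fin : (mu setT < +oo)%E. Proof. by rewrite mu1 ltry. Qed.

Lemma bounded_integrable (f : T -> R) (a b : R) : measurable_fun [set: T] f ->
  (forall x, a <= f x <= b) -> mu.-integrable setT (EFin \o f).
Proof.
move=> mf fab; apply: measurable_bounded_integrable => //.
exists (`|a| + `|b|); split; first exact: num_real.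
move=> y yM x _; apply: le_trans (ltW yM).
have /andP[h1 h2] := fab x.
rewrite ler_norml; apply/andP; split.
  by have := ler_norm (- a); rewrite normrN; have := normr_ge0 b; lra.
by have := ler_norm b; have := normr_ge0 a; lra.
Qed.

Lemma lower_envelope_bound lam lo hi : (forall k, lo <= lam k <= hi) ->
  forall x, lo <= phi lam x <= M + hi.
Proof.
move=> h x; apply/andP; split.
  by apply: le_lower_envelope => k; have /andP[? _] := cM k x; have /andP[? _] := h k; lra.
apply: (le_trans (lower_envelope_le lam j0 x)).
by have /andP[_ ?] := cM j0 x; have /andP[_ ?] := h j0; lra.
Qed.

Lemma integrable_lower_envelope lam : mu.-integrable setT (EFin \o phi lam).
Proof.
apply: (@bounded_integrable _ (\big[Num.min/lam j0]_k lam k) (M + \big[Num.max/lam j0]_k lam k)).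
  exact: measurable_lower_envelope.
by apply: lower_envelope_bound => k; rewrite bigmin_le le_bigmax.
Qed.

(* The dual Kantorovich functional, whose maximizers have cells of mass 1 / L. *)
Definition dual_value lam : R :=
  \int[mu]_x phi lam x - (\sum_k lam k) / L%:R.

Let L0 : 0 < L%:R :> R.
Proof. by rewrite ltr0n; case: L j0 => // -[]. Qed.

Let int_cst (e : R) : \int[mu]_x e = e.
Proof. by rewrite Rintegral_cst// mu1 mulr1. Qed.

Let integrable_cst (e : R) : mu.-integrable setT (EFin \o (fun=> e)).
Proof. by apply: (@bounded_integrable _ e e) => // x; rewrite lexx. Qed.

(** This allows a maximizer to be translated so that its least weight is 0. *)
Lemma dual_value_shift lam e :
  dual_value (fun k => lam k - e) = dual_value lam.
Proof.
rewrite /dual_value.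
have -> : \int[mu]_x phi (fun k => lam k - e) x = \int[mu]_x (phi lam x - e).
  apply: eq_Rintegral => x _; apply/eqP; rewrite eq_le; apply/andP; split.
    rewrite lerBrDr; apply: le_lower_envelope => k.
    by have := lower_envelope_le (fun k => lam k - e) k x; lra.
  by apply: le_lower_envelope => k; have := lower_envelope_le lam k x; lra.
rewrite (RintegralB measurableT (integrable_lower_envelope lam) (integrable_cst e)).
rewrite int_cst sumrB sumr_const card_ord -mulr_natl.
by field; rewrite gt_eqF.
Qed.

Lemma lower_envelope_lipschitz lam lam' e :
  (forall k, `|lam k - lam' k| <= e) -> forall x, phi lam x <= phi lam' x + e.
Proof.
move=> h x; rewrite -lerBlDr; apply: le_lower_envelope => k.
have := lower_envelope_le lam k x; have := h k; rewrite ler_norml => /andP[_]; lra.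
Qed.

Lemma dual_value_lipschitz lam lam' e : (forall k, `|lam k - lam' k| <= e) ->
  dual_value lam - dual_value lam' <= 2 * e.
Proof.
move=> h.
have h1 : \int[mu]_x phi lam x <= \int[mu]_x phi lam' x + e.
  rewrite -[X in _ <= _ + X]int_cst -(RintegralD measurableT (integrable_lower_envelope lam') (integrable_cst e)).
  apply: le_Rintegral => //.
  - exact: integrable_lower_envelope.
  - rewrite (_ : EFin \o _ = (EFin \o phi lam') \+ (EFin \o (fun=> e)))%E//.
    by apply: integrableD => //; exact: integrable_lower_envelope.
  - by move=> x _; exact: lower_envelope_lipschitz.
have h2 : (\sum_k lam' k) / L%:R <= (\sum_k lam k) / L%:R + e.
  rewrite ler_pdivrMr// mulrDl divfK ?gt_eqF// mulr_natr.
  have -> : e *+ L = \sum_(k < L) e by rewrite sumr_const card_ord.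
  rewrite -big_split/=; apply: ler_sum => k _.
  by have := h k; rewrite ler_norml => /andP[]; lra.
by rewrite /dual_value; lra.
Qed.

Lemma dual_value_max (K : R) : 0 <= K -> exists lam, [/\ (forall k, 0 <= lam k <= K) &
  forall lam', (forall k, 0 <= lam' k <= K) -> dual_value lam' <= dual_value lam].
Proof.
move=> K0.
pose A := [set v : 'rV[R]_L | forall i, `[0, K]%classic (v ord0 i)].
have cA : compact A by apply: (@rV_compact R L (fun=> `[0, K]%classic)) => i; exact: segment_compact.
pose f (v : 'rV[R]_L) := dual_value (v ord0).
have cf : continuous f.
  move=> v; have FF : Filter (nbhs v) := nbhs_filter v.
  apply/cvgrPdist_le => e e0.
  apply: (@filterS _ _ FF (ball v (e / 2))) => [u [_ uv]|]; last first.
    by apply: nbhsx_ballx; rewrite divr_gt0.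
  have huv k : `|v ord0 k - u ord0 k| <= e / 2 by apply/ltW; exact: uv.
  have hvu k : `|u ord0 k - v ord0 k| <= e / 2 by rewrite distrC.
  have := dual_value_lipschitz huv; have := dual_value_lipschitz hvu.
  rewrite -/(f u) -/(f v) ler_norml => h1 h2; apply/andP; split; lra.
have [|v vA hv] := EVT_max_rV _ cA (continuous_subspaceT cf).
  by exists 0 => i /=; rewrite mxE in_itv/= lexx.
rewrite inE in vA; exists (v ord0); split.
  by move=> k; have := vA k; rewrite /= in_itv.
move=> lam' h'; have := hv (\row_k lam' k).
have -> : f (\row_k lam' k) = dual_value lam'.
  by congr dual_value; apply/funext => k; rewrite mxE.
by apply; rewrite inE => i /=; rewrite mxE in_itv/=; exact: h'.
Qed.

Definition strict_cell lam (t : R) l : set T :=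
  [set x | forall k, k != l -> c l x + lam l + t <= c k x + lam k].

Lemma measurable_strict_cell lam t l : measurable (strict_cell lam t l).
Proof.
rewrite (_ : strict_cell _ _ _ = \bigcap_(k : 'I_L) [set x | k != l -> c l x + lam l + t <= c k x + lam k]); last first.
  by apply/seteqP; split => x h k; [move=> _; exact: h|exact: h].
apply: fin_bigcap_measurable => // k _.
have [kl|kl] := eqVneq k l; first by rewrite (_ : [set x | _] = setT)//; apply/seteqP; split.
rewrite (_ : [set x | _] = (fun x => c k x - c l x) @^-1` `[lam l + t - lam k, +oo[%classic); last first.
  apply/seteqP; split => x /=; rewrite in_itv/= andbT => h; last by move=> _; lra.
  by have := h isT; lra.
by rewrite -[X in measurable X]setTI; apply: measurable_funB.
Qed.

(* Raising lam l by t raises the envelope by t on the t-interior of the l-th cell. *)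
Lemma strict_cell_le lam (t : R) l : 0 < t ->
  dual_value (fun k => lam k + t *+ (k == l)) <= dual_value lam ->
  (mu (strict_cell lam t l) <= (L%:R^-1)%:E)%E.
Proof.
move=> t0; rewrite /dual_value.
pose lam' := fun k => lam k + t *+ (k == l); rewrite -/lam'.
have -> : \sum_k lam' k = \sum_k lam k + t.
  rewrite big_split/=; congr (_ + _); rewrite (bigD1 l)//= eqxx big1 ?addr0//.
  by move=> k /negbTE ->.
have mA := measurable_strict_cell lam t l.
have iA : mu.-integrable setT (EFin \o (fun x => t * \1_(strict_cell lam t l) x)).
  apply: (@bounded_integrable _ 0 t).
    by apply: measurable_funM => //; exact: measurable_indic.
  move=> x; rewrite indicE; case: (_ \in _); rewrite ?mulr1 ?mulr0 ?lexx ?(ltW t0)//.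
have h : \int[mu]_x phi lam x + t * fine (mu (strict_cell lam t l)) <= \int[mu]_x phi lam' x.
  have <- : \int[mu]_x (t * \1_(strict_cell lam t l) x) = t * fine (mu (strict_cell lam t l)).
    rewrite RintegralZl//; last first.
      apply: (@bounded_integrable _ 0 1); first exact: measurable_indic.
      by move=> x; rewrite indicE; case: (_ \in _); rewrite ?lexx ?ler01.
    by congr (_ * _); rewrite /Rintegral integral_indic// setIT.
  rewrite -(RintegralD measurableT (integrable_lower_envelope lam) iA).
  apply: le_Rintegral => //.
  - rewrite (_ : EFin \o _ = (EFin \o phi lam) \+ (EFin \o (fun x => (t * \1_(strict_cell lam t l) x)%R)))%E//.
    by apply: integrableD => //; exact: integrable_lower_envelope.
  - exact: integrable_lower_envelope.
  move=> x _; apply: le_lower_envelope => k; rewrite indicE.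
  case: (boolP (x \in _)) => [|_]; last first.
    rewrite mulr0 addr0 (le_trans (lower_envelope_le lam k x))// lerD2l /lam' lerDl.
    by rewrite mulrn_wge0// ltW.
  rewrite inE mulr1 => xA; rewrite /lam'; have [->|kl] := eqVneq k l.
    by rewrite mulr1n addrA lerD2r lower_envelope_le.
  rewrite mulr0n addr0; apply: le_trans (xA k kl).
  by rewrite lerD2r lower_envelope_le.
move=> h'.
have fA : mu (strict_cell lam t l) \is a fin_num.
  by rewrite ge0_fin_numE//; apply: le_lt_trans mu_fin; apply: le_measure; rewrite ?inE.
rewrite -(fineK fA) lee_fin -(ler_pM2l t0).
have : (\sum_k lam k + t) / L%:R = (\sum_k lam k) / L%:R + t / L%:R by rewrite mulrDl.
by lra.
Qed.

Let ex_min (f : 'I_L -> R) : exists i, forall k, f i <= f k.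
Proof. by case: (@arg_minP _ _ _ j0 xpredT f isT) => i _ h; exists i => k; exact: h. Qed.

(** Only increases of a single weight are tested. They show that every strict cell has mass at most
    1 / L; as ties are negligible the masses add up to at least 1, so all the inequalities are
    equalities. The maximum is taken over a box of side M + 1 for the sake of compactness. *)
Theorem semidiscrete_equal_masses : exists lam, (forall k, 0 <= lam k) /\
  forall l, mu [set x | forall k, k != l -> c l x + lam l < c k x + lam k] = (L%:R^-1)%:E.
Proof.
have M0 : 0 <= M by have /andP[] := cM j0 point; exact: le_trans.
have K0 : 0 <= M + 1 by lra.
have [lam1 [b1 max1]] := dual_value_max K0.
have [i imin] := ex_min lam1.
pose lam k := lam1 k - lam1 i.
have lam0 k : 0 <= lam k by rewrite subr_ge0 imin.
have lamK k : lam k <= M + 1.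
  by have /andP[_ ?] := b1 k; have /andP[? _] := b1 i; rewrite /lam; lra.
have lami : lam i = 0 by rewrite /lam subrr.
have lammax lam' : (forall k, 0 <= lam' k <= M + 1) -> dual_value lam' <= dual_value lam.
  by move=> h; rewrite /lam dual_value_shift max1.
exists lam; split => //.
pose S l := [set x | forall k, k != l -> c l x + lam l < c k x + lam k].
have SE l : S l = \bigcup_n strict_cell lam n.+1%:R^-1 l.
  apply/seteqP; split => x; last first.
    move=> [n _ h] k kl; have := h k kl.
    have : 0 < n.+1%:R^-1 :> R by rewrite invr_gt0.
    by move: (_^-1) => e; lra.
  move=> h; pose e := \big[Num.min/1]_(k < L | k != l) (c k x + lam k - (c l x + lam l)).
  have e0 : 0 < e by apply: lt_bigmin => // k kl; rewrite subr_gt0; exact: h.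
  have he k : k != l -> e <= c k x + lam k - (c l x + lam l).
    by move=> kl; exact: bigmin_le_cond.
  exists (Num.truncn e^-1) => // k kl.
  have /andP[_ h1] : (Num.truncn e^-1)%:R <= e^-1 < (Num.truncn e^-1).+1%:R.
    by apply: truncn_itv; rewrite invr_ge0 ltW.
  have h2 : (Num.truncn e^-1).+1%:R^-1 <= e.
    by rewrite -[leRHS]invrK lef_pV2 ?posrE ?invr_gt0// ltW.
  have := he _ kl; move: h2; move: (_^-1) => r; lra.
have mS l : measurable (S l).
  by rewrite SE; apply: bigcupT_measurable => n; exact: measurable_strict_cell.
have Sle l : (mu (S l) <= (L%:R^-1)%:E)%E.
  (* At the upper face of the box no increase is allowed, but there the cell is empty: some weight
     is 0 and the costs lie between 0 and M. *)
  have [lamlK|lamlK] := ltP (lam l) (M + 1); last first.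
    rewrite (_ : S l = set0) ?measure0 ?lee_fin ?invr_ge0 ?(ltW L0)//.
    apply/seteqP; split => // x /(_ i).
    have -> : i != l by apply/eqP => il; move: lamlK; rewrite -il lami; lra.
    move=> /(_ isT); rewrite lami.
    by have /andP[? _] := cM l x; have /andP[_ ?] := cM i x; lra.
  have cell_le t : 0 < t -> (mu (strict_cell lam t l) <= (L%:R^-1)%:E)%E.
    move=> t0; pose s := Num.min t (M + 1 - lam l).
    have s0 : 0 < s by rewrite lt_min t0 subr_gt0.
    apply: (@le_trans _ _ (mu (strict_cell lam s l))).
      apply: le_measure; rewrite ?inE; [exact: measurable_strict_cell|exact: measurable_strict_cell|].
      move=> x h k kl; apply: le_trans (h k kl); rewrite lerD2l.
      by rewrite ge_min lexx.
    apply: strict_cell_le => //; apply: lammax => k.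
    have [->|kl] := eqVneq k l; rewrite ?mulr1n ?mulr0n ?addr0 ?lam0 ?lamK//.
    rewrite addr_ge0 ?(ltW s0)//=.
    have : s <= M + 1 - lam l by rewrite ge_min lexx orbT.
    by lra.
  rewrite SE.
  have cv : mu \o (fun n => strict_cell lam n.+1%:R^-1 l) @ \oo --> mu (\bigcup_n strict_cell lam n.+1%:R^-1 l).
    apply: nondecreasing_cvg_mu.
    - by move=> n; exact: measurable_strict_cell.
    - by rewrite -SE; exact: mS.
    - move=> n n' nn'; apply/subsetPset => x h k kl; apply: le_trans (h k kl).
      by rewrite lerD2l lef_pV2 ?posrE// ler_nat.
  rewrite -(cvg_lim _ cv)//; apply: lime_le; first by apply/cvg_ex; eexists; exact: cv.
  by apply: nearW => n; apply: cell_le; rewrite invr_gt0.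
pose N (q : 'I_L * 'I_L) : set T := if q.1 == q.2 then set0 else
  [set x | c q.1 x - c q.2 x = lam q.2 - lam q.1].
have mN q : measurable (N q).
  rewrite /N; case: ifP => // _.
  rewrite (_ : [set x | _] = (fun x => c q.1 x - c q.2 x) @^-1` [set lam q.2 - lam q.1])//.
  by rewrite -[X in measurable X]setTI; apply: measurable_funB.
have N0 q : mu (N q) = 0%E.
  apply: measure_negligible; first exact: mN.
  rewrite /N; case: eqP => [_|/eqP q12]; first exact: negligible_set0.
  exact: ties.
have tot : (1 <= \sum_l mu (S l))%E.
  have -> : (\sum_l mu (S l) = \sum_l mu (S l) + \sum_q mu (N q))%E.
    by rewrite [X in (_ + X)%E]big1 ?adde0.
  have h1 := measure_bigsetU_le mu (index_enum 'I_L) mS.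
  have h2 := measure_bigsetU_le mu (index_enum ('I_L * 'I_L)%type) mN.
  rewrite -mu1; apply: le_trans (leeD h1 h2).
  have mb I (s : seq I) (F : I -> set T) : (forall i, measurable (F i)) ->
      measurable (\big[setU/set0]_(i <- s) F i).
    by move=> mF; elim/big_ind : _ => // *; exact: measurableU.
  apply: (@le_trans _ _ (mu (\big[setU/set0]_(l <- index_enum 'I_L) S l `|`
      \big[setU/set0]_(q <- index_enum ('I_L * 'I_L)%type) N q))); last first.
    by apply: measureU2; exact: mb.
  apply: le_measure; rewrite ?inE//; first by apply: measurableU; exact: mb.
  move=> x _; rewrite -!bigcup_seq.
  have [l lmin] := ex_min (fun k => c k x + lam k).
  have [Sx|nSx] := pselect (S l x).
    by left; exists l => //=; rewrite mem_index_enum.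
  have [k kl ck] : exists2 k, k != l & c k x + lam k <= c l x + lam l.
    apply: contrapT => nk; apply: nSx => k kl; rewrite ltNge; apply/negP => h.
    by apply: nk; exists k.
  right; exists (k, l); first by rewrite /= mem_index_enum.
  by rewrite /N /= (negbTE kl) /=; have := lmin k; lra.
have fS l : mu (S l) \is a fin_num.
  by rewrite ge0_fin_numE//; apply: le_lt_trans (Sle l) _; exact: ltry.
have aS l : fine (mu (S l)) <= L%:R^-1 by rewrite -lee_fin fineK.
have tot' : 1 <= \sum_l fine (mu (S l)).
  by rewrite -lee_fin -sumEFin; under eq_bigr do rewrite fineK//.
have sum0 : \sum_l (L%:R^-1 - fine (mu (S l))) = 0.
  apply/eqP; rewrite eq_le; apply/andP; split; last first.
    by apply: sumr_ge0 => l _; rewrite subr_ge0.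
  by rewrite sumrB sumr_const card_ord -[_ *+ L]mulr_natr mulVf ?gt_eqF// subr_le0.
move=> l; rewrite -(fineK (fS l)); congr (_%:E).
move: sum0 => /eqP; rewrite psumr_eq0; last by move=> k _; rewrite subr_ge0.
by move=> /allP/(_ l); rewrite mem_index_enum => /(_ isT); rewrite /= subr_eq0 => /eqP.
Qed.

End semidiscrete.

(** * Weak duality for semidiscrete transport *)

Lemma big_option_split (T : Type) (idx : T) (op : Monoid.com_law idx) (I : finType)
    (F : option I -> T) :
  \big[op/idx]_i F i = op (F None) (\big[op/idx]_i F (Some i)).
Proof.
rewrite (bigD1 None)//=; congr (op _ _); rewrite (@reindex_omap _ _ _ _ _ Some id)/=.
  by apply: eq_bigl => i; rewrite eqxx.
by case.
Qed.

Section cost_lower_bound.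
Local Open Scope ereal_scope.
Context d (X : measurableType d) (R : realType).

Lemma ge0_integral_indic_sum d' (Y : measurableType d') (I : finType)
    (mu : {measure set Y -> \bar R}) (a : I -> R) (B : I -> set Y) :
  (forall i, (0 <= a i)%R) -> (forall i, measurable (B i)) ->
  \int[mu]_y (\sum_i a i * \1_(B i) y)%R%:E = \sum_i (a i)%:E * mu (B i).
Proof.
move=> a0 mB.
under eq_integral do rewrite -sumEFin.
rewrite ge0_integral_sum//.
- apply: eq_bigr => i _; under eq_integral do rewrite EFinM.
  rewrite ge0_integralZl ?lee_fin//; first by rewrite integral_indic// setIT.
  by apply/measurable_EFinP; exact: measurable_indic.
- move=> i; apply/measurable_EFinP; exact: measurable_funM.
- by move=> i y _; rewrite lee_fin mulr_ge0.
Qed.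

(* Weak Kantorovich duality: lam l + delta * \1_A x <= C (x, w k) + lam k for all
   x in S l and all k, and lam has the same mean under both marginals. *)
Lemma coupling_cost_ge (g : {measure set (X * X) -> \bar R}) (C : X * X -> R)
    (L : nat) (w : 'I_L -> X) (S : 'I_L -> set X) (lam : 'I_L -> R) (A : set X)
    (delta e : R) :
  measurable_fun [set: X * X] C -> (forall z, 0 <= C z)%R ->
  (forall k, measurable [set w k]) -> injective w ->
  (forall k, measurable (S k)) -> measurable A -> (0 <= delta)%R ->
  (forall k, 0 <= lam k)%R ->
  (forall l k x, k != l -> S l x -> C (x, w l) + lam l < C (x, w k) + lam k)%R ->
  (forall l x, S l x -> A x -> delta <= C (x, w l))%R ->
  (forall l, g (S l `*` setT) = e%:E) -> (forall k, g (setT `*` [set w k]) = e%:E) ->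
  g (setT `*` ~` range w) = 0 ->
  delta%:E * g ((A `&` \bigcup_l S l) `*` setT) <= \int[g]_z (C z)%:E.
Proof.
move=> mC C0 mw wI mS mA d0 lam0 HS HA gS gw gN.
have mrw : measurable (range w).
  rewrite (_ : range w = \bigcup_k [set w k]); last first.
    by apply/seteqP; split => x [k _ h]; exists k.
  exact: fin_bigcup_measurable.
have mU : measurable (\bigcup_l S l) by exact: fin_bigcup_measurable.
pose Lam := (\sum_k lam k)%R.
have Lam0 : (0 <= Lam)%R by exact: sumr_ge0.
(* The index [None] carries the extra term delta on the left. On the right it carries the points
   outside the range of w, a null set for the second marginal, where the weight [Lam + delta] makes
   the pointwise inequality trivially true. *)
pose a (i : option 'I_L) := if i is Some k then lam k else delta.
pose B (i : option 'I_L) : set (X * X) :=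
  (if i is Some k then S k else A `&` \bigcup_l S l) `*` setT.
pose a' (i : option 'I_L) := if i is Some k then lam k else (Lam + delta)%R.
pose B' (i : option 'I_L) : set (X * X) :=
  setT `*` (if i is Some k then [set w k] else ~` range w).
have mB i : measurable (B i).
  by apply: measurableX => //; case: i => //; exact: measurableI.
have mB' i : measurable (B' i).
  by apply: measurableX => //; case: i => //; exact: measurableC.
have a0 i : (0 <= a i)%R by case: i => /=.
have a'0 i : (0 <= a' i)%R by case: i => //=; rewrite addr_ge0.
have pos i z : (0 <= \1_(B' i) z :> R)%R by rewrite indicE.
have sum0 z : (0 <= \sum_i a' i * \1_(B' i) z)%R.
  by apply: sumr_ge0 => i _; rewrite mulr_ge0.
have le_ptwise z : (\sum_i a i * \1_(B i) z <= C z + \sum_i a' i * \1_(B' i) z)%R.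
  have [[l Sl]|nS] := pselect (exists l, S l z.1); last first.
    rewrite big1; first by rewrite addr_ge0.
    move=> i _; rewrite indicE memNset ?mulr0// => -[+ _]; case: i => [l Sl|[_ [l _ Sl]]];
      by apply: nS; exists l.
  have -> : (\sum_i a i * \1_(B i) z = lam l + delta * \1_A z.1)%R.
    rewrite big_option_split /= addrC; congr (_ + _)%R; last first.
      rewrite !indicE; congr (_ * (nat_of_bool _)%:R)%R.
      apply/idP/idP; rewrite !inE; first by move=> [[]].
      by move=> Az; split => //; split => //; exists l.
    rewrite (bigD1 l)//= big1 ?addr0; first by rewrite indicE mem_set ?mulr1.
    move=> k kl; rewrite indicE memNset ?mulr0// => -[Sk _].
    have h1 := HS _ _ _ kl Sl; have := HS k l z.1; rewrite eq_sym kl => /(_ isT Sk) h2.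
    by have := lt_trans h1 h2; rewrite ltxx.
  have dA : (delta * \1_A z.1 <= delta)%R.
    by rewrite indicE; case: (_ \in _); rewrite ?mulr1 ?mulr0.
  have [[k _ kz]|nk] := pselect (range w z.2); last first.
    apply: (@le_trans _ _ (Lam + delta)%R).
      apply: lerD => //; rewrite /Lam (bigD1 l)//= lerDl.
      by apply: sumr_ge0.
    rewrite big_option_split /= indicE mem_set// mulr1 -[leLHS]add0r lerD//.
    by rewrite lerDl sumr_ge0// => i _; rewrite mulr_ge0.
  apply: (@le_trans _ _ (C z + lam k)%R).
    have dC : (delta * \1_A z.1 <= C (z.1, w l))%R.
      rewrite indicE; case: (boolP (_ \in _)); rewrite ?mulr0// inE mulr1; exact: HA.
    have zE : z = (z.1, w k) by rewrite kz -surjective_pairing.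
    rewrite [in leRHS]zE; have [->|kl] := eqVneq k l; first by lra.
    by have := HS l k z.1 kl Sl; lra.
  rewrite lerD2l (bigD1 (Some k))//= indicE mem_set ?mulr1 ?lerDl.
    by apply: sumr_ge0 => i _; rewrite mulr_ge0.
  by split => //=; rewrite kz.
have intB := ge0_integral_indic_sum g a0 mB.
have intB' := ge0_integral_indic_sum g a'0 mB'.
have msum b (D : option 'I_L -> set (X * X)) : (forall i, measurable (D i)) ->
    measurable_fun [set: X * X] (fun z => (\sum_i b i * \1_(D i) z)%R%:E : \bar R).
  move=> mD; apply/measurable_EFinP; apply: measurable_sum => i.
  by apply: measurable_funM => //; exact: measurable_indic.
have : \int[g]_z (\sum_i a i * \1_(B i) z)%R%:E <=
   \int[g]_z ((C z)%:E + (\sum_i a' i * \1_(B' i) z)%R%:E).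
  apply: ge0_le_integral => //.
  - by move=> z _; rewrite lee_fin sumr_ge0// => i _; rewrite mulr_ge0.
  - exact: msum.
  - by apply: emeasurable_funD; [exact/measurable_EFinP|exact: msum].
  - by move=> z _; rewrite -EFinD lee_fin.
rewrite ge0_integralD//; last 4 first.
- by move=> z _; rewrite lee_fin.
- exact/measurable_EFinP.
- by move=> z _; rewrite lee_fin sumr_ge0// => i _; rewrite mulr_ge0.
- exact: msum.
rewrite intB intB' !big_option_split /= gN mule0 add0e.
under eq_bigr do rewrite gS.
under [X in _ <= _ + X]eq_bigr do rewrite gw.
rewrite leeD2rE//.
by under eq_bigr do rewrite -EFinM; rewrite sumEFin.
Qed.

End cost_lower_bound.

(** * Cyclical monotonicity along chains *)

Section chains.
Context {R : realType}.
Variable n : nat.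
Notation V := 'rV[R]_n.
Implicit Types x y : V.

Lemma enorm_normalize x : x != 0 -> enorm ((enorm x)^-1 *: x) = 1.
Proof.
move=> x0; have n0 : 0 < enorm x by rewrite lt_neqAle eq_sym enorm_eq0 x0 enorm_ge0.
by rewrite enormZ gtr0_norm ?invr_gt0// mulVf// gt_eqF.
Qed.

(** The difference is at most 2 |x - y| / |x|, and 2 / (2 / 3) = 3. *)
Lemma normalize_lipschitz x y : 2 / 3 <= enorm x -> 2 / 3 <= enorm y ->
  enorm ((enorm x)^-1 *: x - (enorm y)^-1 *: y) <= 3 * enorm (x - y).
Proof.
move=> hx hy; have x0 : 0 < enorm x by lra.
have y0 : 0 < enorm y by lra.
have -> : (enorm x)^-1 *: x - (enorm y)^-1 *: y =
    (enorm x)^-1 *: ((x - y) + ((enorm y - enorm x) / enorm y) *: y).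
  by apply/rowP => i; rewrite !mxE; field; rewrite !gt_eqF.
rewrite enormZ gtr0_norm ?invr_gt0// ler_pdivrMl//.
apply: (le_trans (ler_enormD _ _)).
rewrite enormZ normrM normfV (gtr0_norm y0) divfK ?gt_eqF//.
have := ler_dist_enorm y x; rewrite (enormBC y) => h.
have : 0 <= enorm (x - y) by exact: enorm_ge0.
by nra.
Qed.

(** The chord is cut into M equal steps and projected radially. The angle being at most a right one,
    the chord stays at distance at least 1 / sqrt 2, hence 2/3, from the origin, and
    [normalize_lipschitz] applies. *)
Lemma sphere_segment x y (M : nat) : (0 < M)%N ->
  sphere R n x -> sphere R n y -> 0 <= dot x y ->
  exists z : nat -> V, [/\ z 0%N = x, z M = y,
    (forall i, (i <= M)%N -> sphere R n (z i)) &
    forall i, (i < M)%N -> enorm (z i - z i.+1) <= 3 * enorm (x - y) / M%:R].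
Proof.
move=> M0 xS yS xy; have MR : 0 < M%:R :> R by rewrite ltr0n.
pose u (i : nat) : V := (1 - i%:R / M%:R) *: x + (i%:R / M%:R) *: y.
have ub i : (i <= M)%N -> 2 / 3 <= enorm (u i).
  move=> iM; rewrite -(ler_pXn2r (ltn0Sn 1)) ?nnegrE ?enorm_ge0 ?divr_ge0//.
  rewrite sqr_enorm dotDl !dotDr !dotZl !dotZr (dotC y x) -!sqr_enorm xS yS.
  have t0 : 0 <= i%:R / M%:R :> R by rewrite divr_ge0.
  have t1 : i%:R / M%:R <= 1 :> R by rewrite ler_pdivrMr// mul1r ler_nat.
  move: t0 t1; move: (i%:R / M%:R) => t t0 t1.
  have : 0 <= t * (1 - t) * dot x y by rewrite !mulr_ge0// subr_ge0.
  have : 0 <= (2 * t - 1) ^+ 2 by exact: sqr_ge0.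
  have -> : (2 / 3) ^+ 2 = 4 / 9 :> R by field.
  by nra.
have un0 i : (i <= M)%N -> u i != 0.
  by move=> /ub h; rewrite -enorm_eq0 gt_eqF//; lra.
exists (fun i => (enorm (u i))^-1 *: u i); split => /=.
- have -> : u 0%N = x by rewrite /u mul0r subr0 scale1r scale0r addr0.
  by rewrite xS invr1 scale1r.
- have -> : u M = y by rewrite /u mulfV ?gt_eqF// subrr scale1r scale0r add0r.
  by rewrite yS invr1 scale1r.
- by move=> i iM; exact/enorm_normalize/un0.
- move=> i iM; apply: (le_trans (normalize_lipschitz (ub _ (ltnW iM)) (ub _ iM))).
  have -> : u i - u i.+1 = M%:R^-1 *: (x - y).
    by apply/rowP => j; rewrite !mxE -natr1; field; rewrite gt_eqF.
  by rewrite enormZ gtr0_norm ?invr_gt0// mulrCA mulrC.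
Qed.

End chains.

Section midpoint.
Context {R : realType}.
Variable m : nat.
Notation V := 'rV[R]_m.+1.

(** When the angle between x and y is obtuse, q is a unit vector orthogonal to x, with its sign
    chosen to make the scalar product with y nonnegative; both new distances are at most sqrt 2,
    hence less than |x - y|. The vector is found by projecting a basis vector that is not parallel
    to x. *)
Lemma sphere_midpoint (x y : V) : (0 < m)%N -> sphere R m.+1 x -> sphere R m.+1 y ->
  exists q : V, [/\ sphere R m.+1 q, 0 <= dot x q, 0 <= dot q y,
    enorm (x - q) <= enorm (x - y) & enorm (q - y) <= enorm (x - y)].
Proof.
move=> m0 xS yS; have [xy|xy] := leP 0 (dot x y).
  exists y; split => //; first by rewrite -sqr_enorm yS expr1n.
  by rewrite subrr enorm0 enorm_ge0.
have [i xi] : exists i, x 0 i ^+ 2 != 1.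
  have [x0|x0] := eqVneq (x 0 ord0 ^+ 2) 1; last by exists ord0.
  exists (lift ord0 (Ordinal m0)).
  have : dot x x = 1 by rewrite -sqr_enorm xS expr1n.
  rewrite /dot (bigD1 ord0)//= -expr2 x0 (bigD1 (lift ord0 (Ordinal m0)))//= -expr2 => h.
  have : 0 <= \sum_(i < m.+1 | (i != ord0) && (i != lift ord0 (Ordinal m0))) x 0 i * x 0 i.
    by apply: sumr_ge0 => i _; rewrite -expr2 sqr_ge0.
  move=> ?; apply/eqP => ?; lra.
pose e : V := delta_mx 0 i.
have de (v : V) : dot e v = v 0 i.
  rewrite /dot (bigD1 i)//= big1 ?addr0 ?mxE ?eqxx ?mul1r// => k ki.
  by rewrite mxE/= (negbTE ki) mul0r.
pose v : V := e - x 0 i *: x.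
have vx : dot v x = 0 by rewrite dotDl dotNl dotZl de -sqr_enorm xS; ring.
have v0 : v != 0.
  apply: contra xi => /eqP v0; have : dot v e = 0 by rewrite v0 -(scale0r 0) dotZl mul0r.
  rewrite dotDl dotNl dotZl (dotC x) !de !mxE !eqxx /= => h.
  by apply/eqP; rewrite expr2; lra.
pose q : V := (-1) ^+ (dot v y < 0)%R *: ((enorm v)^-1 *: v).
have nv0 : 0 < enorm v by rewrite lt_neqAle eq_sym enorm_eq0 v0 enorm_ge0.
have qS : enorm q = 1 by rewrite enormZ normrX normrN1 expr1n mul1r enorm_normalize.
have xq : dot x q = 0 by rewrite dotC !dotZl vx !mulr0.
have qy : 0 <= dot q y.
  rewrite !dotZl mulrCA mulr_ge0 ?invr_ge0 ?(ltW nv0)//.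
  by case: ltP => h; rewrite ?expr1 ?expr0 ?mulN1r ?mul1r// oppr_ge0 ltW.
exists q; split => //; first by rewrite xq.
- rewrite -(ler_pXn2r (ltn0Sn 1)) ?nnegrE ?enorm_ge0// !sqr_enormB xq qS xS yS.
  by lra.
- rewrite -(ler_pXn2r (ltn0Sn 1)) ?nnegrE ?enorm_ge0// !sqr_enormB qS xS yS.
  by lra.
Qed.

Lemma sphere_chain (x y : V) (M : nat) : (0 < m)%N -> (0 < M)%N ->
  sphere R m.+1 x -> sphere R m.+1 y ->
  exists z : nat -> V, [/\ z 0%N = x, z (M + M)%N = y,
    (forall i, (i <= M + M)%N -> sphere R m.+1 (z i)) &
    forall i, (i < M + M)%N -> enorm (z i - z i.+1) <= 3 * enorm (x - y) / M%:R].
Proof.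
move=> m0 M0 xS yS; have [q [qS xq qy h1 h2]] := sphere_midpoint m0 xS yS.
have [z1 [z10 z1M z1S z1d]] := sphere_segment M0 xS qS xq.
have [z2 [z20 z2M z2S z2d]] := sphere_segment M0 qS yS qy.
have MR : 0 < M%:R :> R by rewrite ltr0n.
exists (fun i => if (i <= M)%N then z1 i else z2 (i - M)%N); split => //.
- by rewrite leqNgt -[ltnLHS]addn0 ltn_add2l M0 /= addKn.
- move=> i iM; case: leqP => Mi; first exact: z1S.
  by apply: z2S; rewrite leq_subLR.
- move=> i iM; case: (ltngtP i M) => iM'.
  + apply: le_trans (z1d _ iM') _.
    by rewrite ler_pM2r ?invr_gt0// ler_pM2l.
  + rewrite ?iM' subSn ?(ltnW iM')//; apply: (le_trans (z2d (i - M)%N _)).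
      by rewrite ltn_subLR// ltnW.
    by rewrite ler_pM2r ?invr_gt0// ler_pM2l.
  + rewrite iM' z1M -z20 subSn// subnn; apply: (le_trans (z2d 0%N M0)).
    by rewrite ler_pM2r ?invr_gt0// ler_pM2l.
Qed.

End midpoint.

Section laguerre.
Context {R : realType}.
Variables (m L : nat) (p : R) (w : 'I_L -> 'rV[R]_m.+1) (lam : 'I_L -> R).
Notation V := 'rV[R]_m.+1.

Lemma laguerre_cellP l (x : V) : laguerre_cell p w lam l x <->
  sphere R m.+1 x /\ forall k, enorm (x - w l) `^ p + lam l <= enorm (x - w k) `^ p + lam k.
Proof.
split => -[xS h]; split => //.
  move=> k; have := le_trans h (bigmin_le _ k _); rewrite lee_fin; exact.
apply/bigmin_geP; split => [|k _]; first exact: leey.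
by rewrite lee_fin.
Qed.

(* Cyclical monotonicity along a chain from x to w l: if the points of the chain
   could all be approximated by points moved by less than r / N, then moving x
   to w l by short steps would be cheaper than moving it directly. *)
Lemma laguerre_spread (M : nat) l (x : V) : (0 < m)%N -> (0 < M)%N -> 1 < p ->
  2 * (M + M)%:R * (9 / (M + M)%:R) `^ p < 1 -> sphere R m.+1 (w l) ->
  laguerre_cell p w lam l x -> x != w l ->
  exists2 z, sphere R m.+1 z & forall y k, laguerre_cell p w lam k y ->
    enorm (y - z) <= enorm (x - w l) / (M + M)%:R ->
    enorm (x - w l) / (M + M)%:R <= enorm (y - w k).
Proof.
move=> m0 M0 p1 hM wS cx xw.
have p0 : 0 < p by exact: lt_trans p1.
have [xS _] := cx.
set r := enorm (x - w l).
have r0 : 0 < r by rewrite lt_neqAle eq_sym enorm_eq0 subr_eq0 xw enorm_ge0.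
set N := (M + M)%N; have N0 : (0 < N)%N by rewrite addn_gt0 M0.
have NR : 0 < N%:R :> R by rewrite ltr0n.
have NE : N%:R = 2 * M%:R :> R by rewrite natrD mulr2n mulrDl mul1r.
have MR : 0 < M%:R :> R by rewrite ltr0n.
have [z [z0 zN zS zd]] := sphere_chain m0 M0 xS wS.
apply: contrapT => nz.
have /choice[f hf] : forall i : 'I_N.+1, exists yk : V * 'I_L,
    [/\ laguerre_cell p w lam yk.2 yk.1, enorm (yk.1 - z i) <= r / N%:R &
        enorm (yk.1 - w yk.2) < r / N%:R].
  move=> i; apply: contrapT => ni; apply: nz; exists (z i); first by apply: zS; rewrite -ltnS.
  move=> y k cy yz; rewrite leNgt; apply/negP => yw.
  by apply: ni; exists (y, k).
pose g (i : nat) := f (inord i).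
have hg i : (i <= N)%N -> [/\ laguerre_cell p w lam (g i).2 (g i).1,
    enorm ((g i).1 - z i) <= r / N%:R & enorm ((g i).1 - w (g i).2) < r / N%:R].
  by move=> iN; have := hf (inord i); rewrite inordK.
(* A chain step has length 3 r / M = 6 r / N. Two approximation errors and the displacement of the
   next approximating point, each at most r / N, bring the total to 9 r / N. *)
pose Q := (9 * r / N%:R) `^ p.
have le_Q e : 0 <= e -> e <= 9 * r / N%:R -> e `^ p <= Q.
  move=> e0 he; apply: ge0_ler_powR => //; first exact: ltW.
  by rewrite nnegrE (le_trans e0).
have rN0 : 0 < r / N%:R by rewrite divr_gt0.
have d9 : 9 * r / N%:R = r / N%:R + (6 * (r / N%:R) + (r / N%:R + r / N%:R)).
  by field; rewrite gt_eqF.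
have d2 : r / N%:R + r / N%:R <= 9 * r / N%:R.
  by rewrite d9 lerD2l ler_wpDl ?lerDl ?(ltW rN0)// mulr_ge0 ?(ltW rN0).
have d1 : r / N%:R <= 9 * r / N%:R by apply: le_trans d2; rewrite lerDl ltW.
(* The cell inequality at the i-th approximating point is tested against the center assigned to the
   next one; its own cost is nonnegative and is dropped. *)
have step i : (i < N)%N -> lam (g i).2 <= Q + lam (g i.+1).2.
  move=> iN; have [/laguerre_cellP[_ /(_ (g i.+1).2) h1] h2 h3] := hg _ (ltnW iN).
  have [_ h4 h5] := hg _ iN.
  apply: (@le_trans _ _ (enorm ((g i).1 - w (g i).2) `^ p + lam (g i).2)).
    by rewrite lerDr powR_ge0.
  apply: (le_trans h1); rewrite lerD2r; apply: le_Q; first exact: enorm_ge0.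
  have t1 := enorm_triangle (z i) (g i).1 (w (g i.+1).2).
  have t2 := enorm_triangle (z i.+1) (z i) (w (g i.+1).2).
  have t3 := enorm_triangle (g i.+1).1 (z i.+1) (w (g i.+1).2).
  rewrite enormBC in h4; have h6 := zd _ iN.
  have e6 : 3 * r / M%:R = 6 * (r / N%:R) by rewrite NE; field; rewrite gt_eqF.
  rewrite -/r e6 in h6.
  rewrite d9; apply: (le_trans t1); apply: lerD h2 _; apply: (le_trans t2).
  by apply: lerD h6 _; apply: (le_trans t3); exact: lerD h4 (ltW h5).
have acc i : (i <= N)%N -> r `^ p + lam l <= i.+1%:R * Q + lam (g i).2.
  elim: i => [_|i ih iN].
    have [_ h2 h3] := hg _ (leq0n N).
    move/laguerre_cellP : cx => [_ /(_ (g 0%N).2)] h1; apply: (le_trans h1).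
    rewrite mul1r lerD2r; apply: le_Q; first exact: enorm_ge0.
    have t1 := enorm_triangle (g 0%N).1 x (w (g 0%N).2).
    rewrite z0 enormBC in h2.
    by apply: (le_trans t1); apply: le_trans d2; exact: lerD h2 (ltW h3).
  apply: (le_trans (ih (ltnW iN))).
  by rewrite -[i.+2%:R]natr1 mulrDl mul1r -addrA lerD2l step.
have [/laguerre_cellP[_ /(_ l) h1] h2 h3] := hg _ (leqnn N).
have last : lam (g N).2 <= Q + lam l.
  apply: (@le_trans _ _ (enorm ((g N).1 - w (g N).2) `^ p + lam (g N).2)).
    by rewrite lerDr powR_ge0.
  apply: (le_trans h1); rewrite lerD2r; apply: le_Q; first exact: enorm_ge0.
  by rewrite -zN; exact: le_trans h2 d1.
(* One move from x to the first center, N moves along the chain, and one from the last approximating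
   point to w l, which is z N. *)
have tot : r `^ p <= (N%:R + 2) * Q.
  rewrite -(lerD2r (lam l)); apply: (le_trans (acc N (leqnn N))).
  have -> : (N%:R + 2) * Q + lam l = N.+1%:R * Q + (Q + lam l).
    by rewrite -natr1; ring.
  by rewrite lerD2l.
have QE : Q = (9 / N%:R) `^ p * r `^ p.
  by rewrite /Q mulrAC powRM// ?divr_ge0// ltW.
have rp0 : 0 < r `^ p by exact: powR_gt0.
have : (N%:R + 2) * Q < r `^ p.
  have N2 : N%:R + 2 <= 2 * N%:R :> R.
    have h : 2 <= N%:R :> R by rewrite NE ler_pMr// ler1n.
    by rewrite mulr2n mulrDl mul1r lerD2l.
  apply: (@le_lt_trans _ _ (2 * N%:R * Q)).
    by rewrite ler_wpM2r// powR_ge0.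
  by rewrite QE mulrA -[ltRHS]mul1r ltr_pM2r.
by rewrite ltNge tot.
Qed.

End laguerre.

(** The left-hand side is 2 * 9 ^ p / N ^ (p - 1) with N = 2 M, which tends to 0 because 1 < p. *)
Lemma chain_length_exists (R : realType) (p : R) : 1 < p ->
  exists2 M, (0 < M)%N & 2 * (M + M)%:R * (9 / (M + M)%:R) `^ p < 1.
Proof.
move=> p1; have q0 : 0 < p - 1 by rewrite subr_gt0.
pose a := 2 * 9 `^ p.
have a0 : 0 < a by rewrite mulr_gt0// powR_gt0.
pose M := (Num.truncn (a `^ (p - 1)^-1)).+1.
have /andP[_ hM] : (Num.truncn (a `^ (p - 1)^-1))%:R <= a `^ (p - 1)^-1 < M%:R.
  by apply: truncn_itv; exact: powR_ge0.
exists M => //; set N := (M + M)%N.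
have N0 : 0 < N%:R :> R by rewrite ltr0n addn_gt0.
have aN : a < N%:R `^ (p - 1).
  have -> : a = (a `^ (p - 1)^-1) `^ (p - 1) by rewrite -powRrM mulVf ?gt_eqF// powRr1// ltW.
  apply: gt0_ltr_powR => //; rewrite ?nnegrE ?powR_ge0//.
  by apply: (lt_le_trans hM); rewrite ler_nat leq_addr.
rewrite powRM ?invr_ge0 ?ler0n// -powR_inv1 ?ler0n// -powRrM mulN1r powRN.
have -> : p = (p - 1) + 1 by rewrite subrK.
rewrite (@powRD _ N%:R) ?(gt_eqF N0) ?implybT// powRr1 ?(ltW N0)// subrK.
have b0 : 0 < N%:R `^ (p - 1) by rewrite powR_gt0.
have -> : 2 * N%:R * (9 `^ p * (N%:R `^ (p - 1) * N%:R)^-1) = a / N%:R `^ (p - 1).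
  by rewrite /a; field; rewrite !gt_eqF.
by rewrite ltr_pdivrMr// mul1r.
Qed.

(** * Hausdorff measure of the sphere *)

Section hausdorff_sphere.
Context {R : realType}.
Notation lt := (@lebesgue_tuple R).

Lemma diam_ge0 n (A : set 'rV[R]_n) : (0 <= diam A)%E.
Proof. by apply: ereal_sup_ubound; left. Qed.

Lemma diam_ge n (A : set 'rV[R]_n) a b : A a -> A b -> ((enorm (a - b))%:E <= diam A)%E.
Proof. by move=> Aa Ab; apply: ereal_sup_ubound; right; exists a => //; exists b. Qed.

Lemma diam_le n (A : set 'rV[R]_n) (c : R) : 0 <= c ->
  (forall a b, A a -> A b -> enorm (a - b) <= c) -> (diam A <= c%:E)%E.
Proof.
move=> c0 h; apply: ge_ereal_sup => _ [->|[a Aa [b Ab <-]]]; rewrite lee_fin//.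
exact: h.
Qed.

Variable k : nat.
Notation S := (sphere R k.+1).

(** Balls of radius d / 2 around the points are disjoint and fit in the shell between the radii 1 -
    d / 2 and 1 + d / 2, whose volume is of order d; this saves one power of d over packing a full
    ball. *)
Lemma sphere_packing_bound (s : seq 'rV[R]_k.+1) (d : R) : 0 < d <= 1 ->
  pairwise (fun a b => d <= enorm (a - b)) s -> (forall a, a \in s -> S a) ->
  (size s)%:R * d ^+ k <= 8 ^+ k.+1.
Proof.
move=> /andP[d0 d1] ps sS.
have vfin := @unit_ball_volume_fin R k.+1; have v0 := @unit_ball_volume_gt0 R k.+1.
have fv0 : 0 < fine (unit_ball_volume k.+1 : \bar R).
  by rewrite fine_gt0// v0/= -ge0_fin_numE// ltW.
pose A := tuple_ball (0 : 'rV[R]_k.+1) (1 + d / 2) `\` tuple_ball (0 : 'rV[R]_k.+1) (1 - d / 2).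
have mA : measurable A by apply: measurableD; exact: measurable_tuple_ball.
have Avol : lt k.+1 A = (((1 + d / 2) ^+ k.+1 - (1 - d / 2) ^+ k.+1) * fine (unit_ball_volume k.+1 : \bar R))%:E.
  have h := @lebesgue_tuple_ball R k.+1 0.
  have v r : 0 < r -> lt k.+1 (tuple_ball (0 : 'rV[R]_k.+1) r) =
      (r ^+ k.+1 * fine (unit_ball_volume k.+1 : \bar R))%:E.
    by move=> r0; rewrite EFinM fineK//; exact: h.
  have sub : tuple_ball (0 : 'rV[R]_k.+1) (1 - d / 2) `<=` tuple_ball 0 (1 + d / 2).
    by move=> t; rewrite /tuple_ball/= => /lt_trans; apply; lra.
  have -> : lt k.+1 A = (lt k.+1 (tuple_ball (0 : 'rV[R]_k.+1) (1 + d / 2)) -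
      lt k.+1 (tuple_ball (0 : 'rV[R]_k.+1) (1 - d / 2)))%E.
    have := @measureD _ _ _ (lt k.+1) _ _ (measurable_tuple_ball (0 : 'rV[R]_k.+1) (1 + d / 2))
      (measurable_tuple_ball (0 : 'rV[R]_k.+1) (1 - d / 2)).
    rewrite (setIidr sub); apply.
    suff : (lt k.+1 (tuple_ball (0 : 'rV[R]_k.+1) (1 + d / 2)) < +oo)%E by [].
    by rewrite v ?ltry//; lra.
  by rewrite !v; [rewrite -EFinB mulrBl|lra|lra].
have : (((size s)%:R * (d / 2) ^+ k.+1)%:E * unit_ball_volume k.+1 <= lt k.+1 A)%E.
  apply: packing_measure => //; first by rewrite divr_gt0.
    by apply: sub_pairwise ps => a b; rewrite mulrCA divff ?mulr1.
  move=> a /sS aS t; rewrite /tuple_ball /= => ta.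
  have := ler_dist_enorm (row_of_tuple t) a; rewrite aS => h.
  have {h} : `|enorm (row_of_tuple t) - 1| < d / 2 by exact: le_lt_trans ta.
  rewrite ltr_distl => /andP[h1 h2].
  by split; rewrite /tuple_ball/= subr0// ; apply/negP; rewrite -leNgt ltW.
rewrite Avol -(fineK vfin) -EFinM lee_fin ler_pM2r// => h.
have h2 : (1 + d / 2) ^+ k.+1 - (1 - d / 2) ^+ k.+1 <= d * (k.+1%:R * 2 ^+ k).
  rewrite subrXX; have -> : 1 + d / 2 - (1 - d / 2) = d by field.
  rewrite ler_pM2l//.
  have -> : k.+1%:R * 2 ^+ k = \sum_(i < k.+1) 2 ^+ k :> R by rewrite sumr_const card_ord mulr_natl.
  apply: ler_sum => i _ /=.
  have -> : 2 ^+ k = 2 ^+ (k - i) * 2 ^+ i :> R by rewrite -exprD subnK// -ltnS.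
  by apply: ler_pM; rewrite ?exprn_ge0 ?lerXn2r ?nnegrE//; lra.
have k2 : k.+1%:R <= 2 ^+ k.+1 :> R by rewrite -natrX ler_nat ltnW// ltn_expl.
have p2 : 0 < 2 ^+ k :> R by rewrite exprn_gt0.
have : (size s)%:R * d ^+ k <= 2 ^+ k.+1 * (k.+1%:R * 2 ^+ k).
  rewrite -(ler_pM2r d0) -mulrA -exprSr.
  have -> : (size s)%:R * d ^+ k.+1 = 2 ^+ k.+1 * ((size s)%:R * (d / 2) ^+ k.+1).
    by rewrite expr_div_n; field; rewrite expf_neq0.
  by rewrite -[leRHS]mulrA ler_pM2l ?exprn_gt0// [leRHS]mulrC (le_trans h).
move/le_trans; apply.
have -> : 8 = 2 * 2 * 2 :> R by ring.
rewrite !exprMn -mulrA ler_pM2l ?exprn_gt0//; apply: ler_pM => //.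
by rewrite exprS ler_peMl ?(ltW p2)// ler1n.
Qed.

(** A d-separated set of largest cardinality, which exists by the packing bound, is a d-net: a point
    at distance at least d from it could be added. *)
Lemma sphere_net (d : R) : 0 < d <= 1 -> exists s : seq 'rV[R]_k.+1,
  [/\ (size s)%:R * d ^+ k <= 8 ^+ k.+1, (forall a, a \in s -> S a) &
      forall x, S x -> exists2 a, a \in s & enorm (x - a) < d].
Proof.
move=> d01; have /andP[d0 d1] := d01.
pose good (s : seq 'rV[R]_k.+1) := pairwise (fun a b => d <= enorm (a - b)) s /\
  forall a, a \in s -> S a.
pose P N := `[< exists2 s, good s & size s = N >].
have P0 : exists N, P N by exists 0%N; apply/asboolP; exists [::].
have PN N : P N -> (N <= Num.truncn (8 ^+ k.+1 / d ^+ k : R))%N.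
  move=> /asboolP[s [ps sS] sN]; have := sphere_packing_bound d01 ps sS.
  rewrite sN -ler_pdivlMr ?exprn_gt0// => h.
  by rewrite -ltnS -(ltr_nat R) (le_lt_trans h)// truncnS_gt.
have [N /asboolP[s [ps sS] sN] maxN] := ex_maxnP P0 PN.
exists s; split => //; first exact: sphere_packing_bound.
move=> x xS; apply: contrapT => nx.
suff : P N.+1 by move=> /maxN; rewrite ltnn.
apply/asboolP; exists (x :: s); last by rewrite /= sN.
split => /=.
  rewrite ps andbT; apply/allP => a As; rewrite leNgt; apply/negP => h.
  by apply: nx; exists a.
by move=> a; rewrite inE => /predU1P[->//|]; exact: sS.
Qed.

Lemma ball_volume_gt0 : (0 < ball_volume R k)%E.
Proof. exact: lt_le_trans (unit_ball_volume_gt0 k) (unit_ball_volume_le k). Qed.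

(** Cover by the balls of radius d around a d-net. Each has gauge at most 2 ^ k d ^ k and there are
    at most 8 ^ (k + 1) / d ^ k of them, so d disappears from the bound. *)
Lemma hausdorff_sphere_le :
  (hausdorff_measure k S <= (16 ^+ k.+1)%:E)%E.
Proof.
apply: ge_ereal_sup => _ [e /= e0 <-].
pose d := Num.min 1 (e / 2).
have d0 : 0 < d by rewrite lt_min ltr01 divr_gt0.
have d1 : d <= 1 by rewrite ge_min lexx.
have de : 2 * d <= e.
  have : d <= e / 2 by rewrite ge_min lexx orbT.
  lra.
have [|s [sz sS snet]] := @sphere_net d; first by rewrite d0.
pose F (i : nat) : set 'rV[R]_k.+1 :=
  if (i < size s)%N then [set x | enorm (x - nth 0 s i) < d] else set0.
have dF i : (diam (F i) <= (2 * d)%:E)%E.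
  apply: diam_le => [|a b]; first by rewrite mulr_ge0// ltW.
  rewrite /F; case: ifP => // _ /= ha hb.
  rewrite (le_trans (enorm_triangle (nth 0 s i) _ _))// mulr2n mulrDl mul1r.
  by rewrite lerD ?ltW// enormBC.
apply: (@le_trans _ _ (\sum_(0 <= i <oo) hausdorff_gauge k (F i))%E).
  apply: ereal_inf_lbound; exists F => //; split.
    move=> x /snet[a /(nthP 0)[i si ia] xa]; exists i => //.
    by rewrite /F si /= ia.
  by move=> i; rewrite (le_trans (dF i))// lee_fin.
have gF0 i : (size s <= i)%N -> hausdorff_gauge k (F i) = 0%E.
  by move=> h; rewrite /F ltnNge h /= /hausdorff_gauge eqxx.
have g0 i : (0 <= hausdorff_gauge k (F i))%E.
  rewrite /hausdorff_gauge; case: ifP => // _; apply: mule_ge0 => //.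
  by rewrite lee_fin exprn_ge0// divr_ge0// fine_ge0// diam_ge0.
have gle i : (hausdorff_gauge k (F i) <= (2 ^+ k * d ^+ k)%:E)%E.
  rewrite /hausdorff_gauge; case: ifP => _; first by rewrite lee_fin mulr_ge0 ?exprn_ge0// ltW.
  rewrite EFinM; apply: lee_pmul.
  - exact/ltW/ball_volume_gt0.
  - by rewrite lee_fin exprn_ge0// divr_ge0// fine_ge0// diam_ge0.
  - exact: ball_volume_le.
  have fd : diam (F i) \is a fin_num.
    by rewrite ge0_fin_numE ?diam_ge0// (le_lt_trans (dF i))// ltry.
  rewrite lee_fin lerXn2r ?nnegrE ?divr_ge0 ?fine_ge0 ?diam_ge0 ?(ltW d0)//.
  by rewrite ler_pdivrMr// mulrC -lee_fin fineK.
rewrite (nneseries_split 0 (size s)); last by move=> i _; exact: g0.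
rewrite add0n [X in (_ + X)%E]eseries0 ?adde0; last by move=> i hi _; exact: gF0.
apply: (@le_trans _ _ (\sum_(0 <= i < size s) (2 ^+ k * d ^+ k)%:E)%E).
  by apply: lee_sum => i _; exact: gle.
rewrite sumEFin lee_fin sumr_const_nat subn0 -[leLHS]mulr_natl mulrCA.
have -> : 16 = 2 * 8 :> R by ring.
rewrite exprMn; apply: ler_pM => //; rewrite ?exprn_ge0//.
  by rewrite mulr_ge0// exprn_ge0// ltW.
by rewrite exprS ler_peMl ?exprn_ge0// ler1n.
Qed.

(** Forgetting the first coordinate does not increase distances and maps the sphere onto a set
    containing the open unit ball. A nonempty covering set projects into a cube with half-side its
    diameter, of volume 4 ^ k (diam / 2) ^ k, whence the factor 4 ^ (- k) in [b]; subadditivity of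
    Lebesgue measure bounds every covering sum from below. *)
Lemma hausdorff_sphere_gt0 : (0 < hausdorff_measure k S)%E.
Proof.
have bv0 := ball_volume_gt0.
have bvfin : ball_volume R k \is a fin_num.
  by rewrite ge0_fin_numE ?(ltW bv0)// (le_lt_trans (ball_volume_le _))// ltry.
pose b := fine (ball_volume R k) * 4^-1 ^+ k.
have b0 : 0 < b.
  by rewrite mulr_gt0 ?exprn_gt0// fine_gt0// bv0/= -ge0_fin_numE// ltW.
pose c : \bar R := (b%:E * unit_ball_volume k)%E.
have c0 : (0 < c)%E by rewrite mule_gt0// unit_ball_volume_gt0.
apply: (lt_le_trans c0); apply: (@le_trans _ _ (hausdorff_pre k 1 S)); last first.
  by apply: ereal_sup_ubound; exists 1 => //=.
apply: le_ereal_inf_tmp => _ [F [SF dF] <-].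
have fd i : diam (F i) \is a fin_num.
  by rewrite ge0_fin_numE ?diam_ge0// (le_lt_trans (dF i))// ltry.
pose a i : 'rV[R]_k.+1 := xget 0 (F i).
pose Q i : set (k.-tuple R) := if F i == set0 then set0 else
  tuple_cube (\row_j a i 0 (lift ord0 j)) (fine (diam (F i))).
have mQ i : measurable (Q i).
  by rewrite /Q; case: ifP => // _; exact: measurable_tuple_cube.
have gQ i : hausdorff_gauge k (F i) = (b%:E * lt k (Q i))%E.
  rewrite /b EFinM fineK//.
  rewrite /hausdorff_gauge /Q; case: ifP => _; first by rewrite measure0 mule0.
  rewrite lebesgue_tuple_cube ?fine_ge0 ?diam_ge0// -muleA -EFinM -exprMn.
  by congr (_ * (_ ^+ k)%:E)%E; field.
under eq_eseriesr do rewrite gQ.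
rewrite nneseriesZl; last by move=> i _; exact: measure_ge0.
apply: lee_wpmul2l; first by rewrite lee_fin ltW.
apply: measure_sigma_subadditive => //; first exact: measurable_tuple_ball.
move=> t; rewrite /tuple_ball /= subr0 => t1.
have [i _ Fi] := SF _ (enorm_tuple_chart false t1).
exists i => //; rewrite /Q; case: ifPn => [/eqP F0|_]; first by rewrite F0 in Fi.
have Fa : F i (a i) by apply: (@xgetPex _ 0 (F i)); eexists; exact: Fi.
move=> j; have := diam_ge Fi Fa; rewrite -(fineK (fd i)) lee_fin.
apply: le_trans; have := ler_coord_enorm ((tuple_chart ord0 false t : 'rV[R]_k.+1) - a i) (lift ord0 j).
apply: le_trans; have -> : (tuple_chart ord0 false t - a i : 'rV[R]_k.+1) 0 (lift ord0 j) =
    tnth t j - a i 0 (lift ord0 j).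
  rewrite mxE (_ : (- a i) 0 _ = - a i 0 (lift ord0 j)); last by rewrite mxE.
  by congr (_ - _); rewrite [LHS]hemisphere_chart_lift mxE.
by rewrite mxE.
Qed.

End hausdorff_sphere.

(** * The constant in the diameter bound *)

Section constants.
Context {R : realType}.

Lemma asin_ge_id (b : R) : 0 < b <= 1 -> b <= asin b.
Proof.
move=> /andP[b0 b1]; have b11 : -1 <= b <= 1 by apply/andP; split=> //; lra.
have [/andP[a1 a2] sb] := asin_def b11.
have a0 : 0 <= asin b.
  rewrite leNgt; apply/negP => an; have : 0 <= sin (- asin b).
    by apply: sin_ge0_pi; have := @pi_gt0 R; lra.
  by rewrite sinN sb; lra.
have [|c _ h] := @MVT_segment R sin cos 0 (asin b) a0 (fun x _ => is_derive_sin x).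
  by apply: continuous_subspaceT => x; exact: continuous_sin.
rewrite sin0 !subr0 sb in h.
by rewrite {1}h ler_piMl// cos_le1.
Qed.

(* The quantity raised to a negative power is at most 16 ^ m. *)
Lemma diam_factor_ge (b p : R) (m : nat) : 0 < b < 1 -> 0 < p -> (0 < m)%N ->
  16^-1 <= (fine (hausdorff_measure m.-1 (sphere R m)) / m%:R *
    (b * Num.sqrt (1 - b ^+ 2) / asin b) ^+ m.-1) `^ (- (m%:R + p)^-1).
Proof.
case: m => // k /andP[b0 b1] p0 _ /=.
have asb : b <= asin b by apply: asin_ge_id; rewrite b0 ltW.
have as0 : 0 < asin b by exact: lt_le_trans asb.
have bb : b ^+ 2 < 1 by rewrite expr_lt1// ltW.
set q := b * _ / _.
have q0 : 0 < q by rewrite divr_gt0// mulr_gt0// sqrtr_gt0 subr_gt0.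
have q1 : q <= 1.
  rewrite /q ler_pdivrMr// mul1r (le_trans _ asb)// ler_piMr ?(ltW b0)//.
  by rewrite -[leRHS]sqrtr1 ler_sqrt// gerBl sqr_ge0.
have H0 := @hausdorff_sphere_gt0 R k; have H1 := @hausdorff_sphere_le R k.
set H := hausdorff_measure _ _ in H0 H1 *.
have Hfin : H \is a fin_num by rewrite ge0_fin_numE ?(ltW H0)// (le_lt_trans H1)// ltry.
have fH0 : 0 < fine H by rewrite fine_gt0// H0/= -ge0_fin_numE// ltW.
have fH1 : fine H <= 16 ^+ k.+1 by rewrite -lee_fin fineK.
have mp0 : 0 < k.+1%:R + p by rewrite addr_gt0.
set X := (fine H / _ * _).
have X0 : 0 < X by rewrite mulr_gt0 ?exprn_gt0// divr_gt0.
have X1 : X <= 16 ^+ k.+1.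
  rewrite (le_trans _ fH1)// -[leRHS]mulr1; apply: ler_pM => //.
  - by rewrite ltW// divr_gt0.
  - by rewrite exprn_ge0// ltW.
  - by rewrite ler_pdivrMr// ler_peMr ?(ltW fH0)// ler1n.
  - by rewrite exprn_ile1// ltW.
rewrite powRN lef_pV2 ?posrE ?powR_gt0//.
(* As m <= m + p, the root of order m + p of 16 ^ m is at most 16. *)
apply: (@le_trans _ _ ((16 `^ (k.+1%:R + p)) `^ (k.+1%:R + p)^-1)).
  apply: ge0_ler_powR; rewrite ?nnegrE ?powR_ge0 ?invr_ge0 ?(ltW mp0) ?(ltW X0)//.
  by rewrite (le_trans X1)// -powR_mulrn// ler_powR ?lerDl ?ltW// ltr1n.
by rewrite -powRrM divff ?gt_eqF// powRr1.
Qed.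

End constants.

Lemma measurable_set_le d (T : measurableType d) (R : realType) (f g : T -> R) :
  measurable_fun [set: T] f -> measurable_fun [set: T] g ->
  measurable [set x | f x <= g x].
Proof. by move=> mf mg; rewrite -[X in measurable X]setTI; exact: measurable_fun_le. Qed.

Lemma measurable_set_lt d (T : measurableType d) (R : realType) (f g : T -> R) :
  measurable_fun [set: T] f -> measurable_fun [set: T] g ->
  measurable [set x | f x < g x].
Proof.
move=> mf mg; rewrite (_ : mkset _ = ~` [set x | g x <= f x]).
  exact/measurableC/measurable_set_le.
by apply/seteqP; split => x /=; [rewrite ltNge => /negP|move/negP; rewrite -ltNge].
Qed.

Lemma negligible_bigcup_ord d (T : measurableType d) (R : realType)
    (mu : {measure set T -> \bar R}) L (F : 'I_L -> set T) :
  (forall k, mu.-negligible (F k)) -> mu.-negligible (\bigcup_k F k).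
Proof.
move=> nF; pose G (i : nat) := \bigcup_(k in [set k : 'I_L | val k = i]) F k.
suff N : mu.-negligible (\bigcup_i G i).
  by apply: negligibleS N => x [k _ Fk]; exists (val k) => //; exists k.
apply: negligible_bigcup => i.
have [[k ki]|nk] := pselect (exists k : 'I_L, val k = i).
  by apply: negligibleS (nF k) => x [j /= ji Fj]; rewrite (_ : k = j)//; apply: val_inj; rewrite ki.
apply: negligibleS (negligible_set0 mu) => x [j /= ji _].
by apply: nk; exists j.
Qed.

(** * Laguerre cells of the sphere *)

Section equal_area_cells.
Context {R : realType}.
Variables (m L : nat) (p : R) (w : 'I_L -> 'rV[R]_m.+1).
Hypotheses (m0 : (0 < m)%N) (p1 : 1 < p).
Hypotheses (wI : injective w) (wS : forall l, sphere R m.+1 (w l)).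
Notation T := (borel_rV R m.+1).
Notation S := (sphere R m.+1).
Notation sigma := (@sphere_measure R m).

Lemma measurable_cost (v : 'rV[R]_m.+1) :
  measurable_fun [set: T] (fun x : T => enorm ((x : 'rV[R]_m.+1) - v) `^ p).
Proof.
apply: (measurableT_comp (measurable_powR p)); apply: measurable_fun_enorm => i.
rewrite (_ : (fun _ => _) = (fun x : T => (x : 'rV[R]_m.+1) 0 i - v 0 i)).
  by apply: measurable_funB => //; exact: measurable_coord.
by apply/funext => x; rewrite !mxE.
Qed.

Lemma measurable_pair_cost :
  measurable_fun [set: T * T] (fun z : T * T => enorm ((z.1 : 'rV[R]_m.+1) - z.2) `^ p).
Proof.
apply: (measurableT_comp (measurable_powR p)); apply: measurable_fun_enorm => i.
rewrite (_ : (fun _ => _) = (fun z : T * T => (z.1 : 'rV[R]_m.+1) 0 i - (z.2 : 'rV[R]_m.+1) 0 i)).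
  apply: measurable_funB.
    exact: (measurableT_comp (@measurable_coord R m.+1 i) measurable_fst).
  exact: (measurableT_comp (@measurable_coord R m.+1 i) measurable_snd).
by apply/funext => x; rewrite !mxE.
Qed.

Lemma measurable_enorm_ball (v : 'rV[R]_m.+1) (r : R) :
  measurable ([set x | enorm (x - v) <= r] : set T).
Proof.
apply: measurable_set_le => //.
apply: measurable_fun_enorm => i.
rewrite (_ : (fun _ => _) = (fun x : T => (x : 'rV[R]_m.+1) 0 i - v 0 i)).
  by apply: measurable_funB => //; exact: measurable_coord.
by apply/funext => x; rewrite !mxE.
Qed.

Lemma measurable_point (v : 'rV[R]_m.+1) : measurable ([set v] : set T).
Proof.
rewrite (_ : [set v] = [set x | enorm (x - v) <= 0]); first exact: measurable_enorm_ball.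
apply/seteqP; split => x /=; first by move=> ->; rewrite subrr enorm0.
move=> h; apply/eqP; rewrite -subr_eq0 -enorm_eq0.
by rewrite eq_le h enorm_ge0.
Qed.

(** Strict cells are pairwise disjoint, as the pointwise inequality behind weak duality requires;
    they differ from the closed cells by a null set. *)
Definition strict_laguerre_cell (lam : 'I_L -> R) (l : 'I_L) : set T :=
  [set x | S x /\ forall k, k != l ->
    enorm ((x : 'rV[R]_m.+1) - w l) `^ p + lam l < enorm ((x : 'rV[R]_m.+1) - w k) `^ p + lam k].

Lemma measurable_strict_laguerre_cell lam l : measurable (strict_laguerre_cell lam l).
Proof.
rewrite (_ : strict_laguerre_cell _ _ = S `&` \bigcap_(k in [set k | k != l])
  [set x : T | enorm ((x : 'rV[R]_m.+1) - w l) `^ p + lam l < enorm ((x : 'rV[R]_m.+1) - w k) `^ p + lam k]).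
  apply: measurableI; first exact: measurable_sphere.
  apply: fin_bigcap_measurable => [|k _]; first exact: finite_finset.
  apply: measurable_set_lt => //;
    by apply: measurable_funD => //; exact: measurable_cost.
by [].
Qed.

Lemma measurable_laguerre_cell lam l : measurable (laguerre_cell p w lam l : set T).
Proof.
rewrite (_ : laguerre_cell p w lam l = S `&` \bigcap_k
  [set x : T | enorm ((x : 'rV[R]_m.+1) - w l) `^ p + lam l <= enorm ((x : 'rV[R]_m.+1) - w k) `^ p + lam k]).
  apply: measurableI; first exact: measurable_sphere.
  apply: fin_bigcap_measurable => // k _.
  apply: measurable_set_le => //;
    by apply: measurable_funD => //; exact: measurable_cost.
apply/seteqP; split => x.
  by move=> /laguerre_cellP[xS h]; split => // k _; exact: h.
by move=> [xS h]; apply/laguerre_cellP; split => // k; exact: h.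
Qed.

Lemma negligible_setC_sphere : sigma.-negligible (~` S : set T).
Proof.
have mS : measurable (S : set T) by exact: measurable_sphere.
apply/negligibleP; first exact: measurableC.
apply: sphere_measure_null; first exact: measurableC.
move=> s; rewrite (_ : _ `&` _ = set0) ?measure0//.
apply/seteqP; split => // t [/= + t1]; apply; exact: enorm_tuple_chart.
Qed.

Lemma eq_measure_negligible (A B : set T) : measurable A -> measurable B ->
  A `<=` B -> sigma.-negligible (B `\` A) -> sigma A = sigma B.
Proof.
move=> mA mB AB N.
have e : sigma B = (sigma (B `\` A) + sigma (B `&` A))%E by exact: measureDI.
have z : sigma (B `\` A) = 0%E by apply: measure_negligible => //; exact: measurableD.
by rewrite e z add0e (setIidr AB).
Qed.

Lemma laguerre_cell_tie lam l k : l != k ->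
  sigma (laguerre_cell p w lam l `&` laguerre_cell p w lam k : set T) = 0%E.
Proof.
move=> lk; apply: measure_negligible.
  by apply: measurableI; exact: measurable_laguerre_cell.
have wlk : w l != w k by apply: contra lk => /eqP/wI ->.
apply: negligibleS (tie_negligible (lam k - lam l) m0 p1 (wS l) (wS k) wlk).
move=> x [/laguerre_cellP[xS /(_ k) h1] /laguerre_cellP[_ /(_ l) h2]]; split => //.
by apply/eqP; rewrite subr_eq addrAC eq_sym subr_eq addrC eq_le h1 h2.
Qed.

Lemma strict_laguerre_cell_sub lam l : strict_laguerre_cell lam l `<=` laguerre_cell p w lam l.
Proof.
move=> x [xS h]; apply/laguerre_cellP; split => // k.
by have [->//|/h/ltW] := eqVneq k l.
Qed.

Lemma laguerre_cell_boundary_negligible lam l :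
  sigma.-negligible (laguerre_cell p w lam l `\` strict_laguerre_cell lam l).
Proof.
pose tie k : set T := if l != k then laguerre_cell p w lam l `&` laguerre_cell p w lam k
  else set0.
have mI k : measurable (laguerre_cell p w lam l `&` laguerre_cell p w lam k : set T).
  by apply: measurableI; exact: measurable_laguerre_cell.
suff N : sigma.-negligible (\bigcup_k tie k).
  apply: negligibleS N => x [cx nx]; have /laguerre_cellP[xS h] := cx.
  have [k kl hk] : exists2 k, k != l & enorm ((x : 'rV[R]_m.+1) - w k) `^ p + lam k <=
      enorm ((x : 'rV[R]_m.+1) - w l) `^ p + lam l.
    apply: contrapT => H; apply: nx; split => // k kl; rewrite ltNge; apply/negP => hk.
    by apply: H; exists k.
  exists k => //; rewrite /tie eq_sym kl; split; first exact: cx.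
  apply/laguerre_cellP; split; first exact: xS.
  by move=> j; exact: le_trans hk (h j).
apply: negligible_bigcup_ord => k; rewrite /tie.
case: ifP => [lk|_]; last exact: negligible_set0.
by apply/negligibleP; [exact: mI|exact: laguerre_cell_tie].
Qed.

Lemma strict_laguerre_cell_mass lam l :
  sigma (strict_laguerre_cell lam l) = sigma (laguerre_cell p w lam l).
Proof.
apply: eq_measure_negligible; [exact: measurable_strict_laguerre_cell|
  exact: measurable_laguerre_cell|exact: strict_laguerre_cell_sub|].
exact: laguerre_cell_boundary_negligible.
Qed.

Lemma bigcup_laguerre_cell lam : (0 < L)%N -> \bigcup_l laguerre_cell p w lam l = S.
Proof.
move=> L0; apply/seteqP; split; first by move=> x [l _ /laguerre_cellP[]].
move=> x xS; pose f l := enorm (x - w l) `^ p + lam l.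
case: (@arg_minP _ _ _ (Ordinal L0) xpredT f) => // l _ h.
by exists l => //; apply/laguerre_cellP; split => // k; exact: h.
Qed.

Lemma equal_area_weights : (0 < L)%N -> exists2 lam : 'I_L -> R, (forall k, 0 <= lam k) &
  forall l, sigma (strict_laguerre_cell lam l) = (L%:R^-1)%:E.
Proof.
move=> L0; have p0 : 0 < p by exact: lt_trans p1.
(* Distances on the sphere are at most 2, so truncating at 2 ^ p bounds the cost on the whole space
   without changing it on the sphere. *)
pose c k (x : T) := Num.min (enorm ((x : 'rV[R]_m.+1) - w k) `^ p) (2 `^ p).
have cS k (x : T) : S x -> c k x = enorm ((x : 'rV[R]_m.+1) - w k) `^ p.
  move=> xS; apply/min_idPl/ge0_ler_powR; rewrite ?nnegrE ?enorm_ge0 ?(ltW p0)//.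
  by rewrite (le_trans (ler_enormB _ _))// xS wS.
have mc k : measurable_fun [set: T] (c k).
  by apply: measurable_minr => //; exact: measurable_cost.
have cM k x : 0 <= c k x <= 2 `^ p.
  by rewrite le_min !powR_ge0 ge_min lexx orbT.
have ties k l e : k != l -> sigma.-negligible [set x | c k x - c l x = e].
  move=> kl; have wkl : w k != w l by apply: contra kl => /eqP/wI ->.
  apply: negligibleS (negligibleU negligible_setC_sphere
    (tie_negligible e m0 p1 (wS k) (wS l) wkl)).
  move=> x /= h; have [xS|] := pselect (S x); last by left.
  by right; split => //; rewrite -!cS.
have [lam [lam0 hlam]] := semidiscrete_equal_masses (Ordinal L0) (sphere_measure_setT m) mc cM ties.
exists lam => // l; rewrite -(hlam l).
apply: eq_measure_negligible; first exact: measurable_strict_laguerre_cell.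
- rewrite (_ : [set _ | _] = \bigcap_(k in [set k | k != l])
    [set x : T | c l x + lam l < c k x + lam k])//.
  apply: fin_bigcap_measurable => [|k _]; first exact: finite_finset.
  by apply: measurable_set_lt => //; apply: measurable_funD.
- by move=> x [xS h] k kl; rewrite !cS//; exact: h.
- apply: negligibleS negligible_setC_sphere => x [h nx] xS; apply: nx; split => // k kl.
  by rewrite -!cS//; exact: h.
Qed.

End equal_area_cells.

(** * Transport cost and diameter of the cells *)

Section cell_diameter.
Context {R : realType}.
Variables (m L M : nat) (p : R) (w : 'I_L -> 'rV[R]_m.+1) (lam : 'I_L -> R).
Hypotheses (m0 : (0 < m)%N) (M0 : (0 < M)%N) (p1 : 1 < p) (L0 : (0 < L)%N).
Hypotheses (wI : injective w) (wS : forall l, sphere R m.+1 (w l)).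
Hypothesis chain : 2 * (M + M)%:R * (9 / (M + M)%:R) `^ p < 1 :> R.
Hypothesis lam0 : forall k, 0 <= lam k.
Hypothesis lam_mass : forall l, sphere_measure m (strict_laguerre_cell p w lam l) = (L%:R^-1)%:E.
Notation T := (borel_rV R m.+1).
Notation S := (sphere R m.+1).
Notation sigma := (@sphere_measure R m).
Notation N := ((M + M)%:R : R).

Lemma strict_cells_inter_mass (A : set T) : measurable A ->
  sigma (A `&` \bigcup_l strict_laguerre_cell p w lam l) = sigma A.
Proof.
move=> mA; have mU : measurable (\bigcup_l strict_laguerre_cell p w lam l : set T).
  by apply: fin_bigcup_measurable => // l _; exact: measurable_strict_laguerre_cell.
apply: eq_measure_negligible => //; first exact: measurableI.
have Ns := negligible_bigcup_ord (laguerre_cell_boundary_negligible m0 p1 wI wS lam).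
apply: negligibleS (negligibleU (@negligible_setC_sphere R m) Ns) => x [Ax nx].
have [xS|] := pselect (S x); last by left.
right; have [l _ cl] : (\bigcup_l laguerre_cell p w lam l) x by rewrite bigcup_laguerre_cell.
by exists l => //; split => // sl; apply: nx; split => //; exists l.
Qed.

Lemma empirical_point k : empirical w [set w k] = (L%:R^-1)%:E.
Proof.
rewrite /empirical (bigD1 k)//= big1 ?adde0.
  by rewrite diracE mem_set ?mule1.
by move=> l lk; rewrite diracE memNset// => /wI/eqP; apply/negP.
Qed.

Lemma empirical_setC_range : empirical w (~` range w) = 0%E.
Proof.
rewrite /empirical big1 ?mule0// => l _; rewrite diracE memNset//.
by apply; exists l.
Qed.

Lemma coupling_laguerre_cost_ge g l (x : 'rV[R]_m.+1) :
  coupling (@sphere_probability R m.+1) (empirical w) g ->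
  laguerre_cell p w lam l x -> x != w l ->
  (((enorm (x - w l) / N / 16 ^+ 3) `^ (m%:R + p))%:E <=
    \int[g]_z (enorm ((z.1 : 'rV[R]_m.+1) - z.2) `^ p)%:E)%E.
Proof.
move=> gc cx xw; have p0 : 0 < p by exact: lt_trans p1.
have [z zS hz] := laguerre_spread m0 M0 p1 chain (wS l) cx xw.
have /laguerre_cellP[xS _] := cx.
have N2 : 2 <= N by rewrite ler_nat addnn -muln2 leq_pmull.
have N0 : 0 < N by lra.
have r0 : 0 < enorm (x - w l).
  by rewrite lt_neqAle enorm_ge0 andbT eq_sym enorm_eq0 subr_eq0.
have r2 : enorm (x - w l) <= 2.
  by rewrite (le_trans (ler_enormB _ _))// xS wS.
set q := enorm (x - w l) / N in hz *.
have q0 : 0 < q by rewrite divr_gt0.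
(* The cap estimate is for radii at most 1; the chain has at least 2 steps, which compensates for
   the diameter 2 of the sphere. *)
have q1 : q <= 1 by rewrite ler_pdivrMr// mul1r (le_trans r2).
pose A : set T := [set y | enorm ((y : 'rV[R]_m.+1) - z) <= q].
have mA : measurable A by exact: measurable_enorm_ball.
have mU : measurable (\bigcup_l strict_laguerre_cell p w lam l : set T).
  by apply: fin_bigcup_measurable => // k _; exact: measurable_strict_laguerre_cell.
have mW : measurable (range w : set T).
  rewrite (_ : range w = \bigcup_k [set w k]).
    by apply: fin_bigcup_measurable => // k _; exact: measurable_point.
  by apply/seteqP; split => y [k _ h]; exists k.
have gS k : g (strict_laguerre_cell p w lam k `*` setT) = (L%:R^-1)%:E.
  have ms := @measurable_strict_laguerre_cell R m L p w lam k.
  by have [-> _] := gc _ ms; rewrite sphere_probabilityE// lam_mass.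
have gw k : g (setT `*` [set w k]) = (L%:R^-1)%:E.
  by have [_ ->] := gc _ (measurable_point (w k)); rewrite empirical_point.
have gN : g (setT `*` ~` range w) = 0%E.
  by have [_ ->] := gc _ (measurableC mW); rewrite empirical_setC_range.
have cost := @coupling_cost_ge _ T R g
  (fun z => enorm ((z.1 : 'rV[R]_m.+1) - z.2) `^ p) L w
  (strict_laguerre_cell p w lam) lam A (q `^ p) L%:R^-1
  (measurable_pair_cost p) (fun z => powR_ge0 _ _) (fun k => measurable_point (w k)) wI
  (measurable_strict_laguerre_cell p w lam) mA (powR_ge0 _ _) lam0.
apply: le_trans (cost _ _ gS gw gN); last 2 first.
- by move=> k j y jk [_]; apply.
- move=> k y /strict_laguerre_cell_sub cy Ay.
  apply: ge0_ler_powR; rewrite ?nnegrE ?enorm_ge0 ?(ltW q0) ?(ltW p0)//.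
  exact: hz cy Ay.
have cap : (((q / 16 ^+ 3) ^+ m)%:E <=
    g ((A `&` \bigcup_l strict_laguerre_cell p w lam l) `*` setT))%E.
  have mAU := measurableI _ _ mA mU; have [-> _] := gc _ mAU.
  rewrite sphere_probabilityE// strict_cells_inter_mass//.
  by apply: (sphere_measure_cap m0 zS) => //; rewrite q0.
have k0 : 0 < 16 ^+ 3 :> R by rewrite exprn_gt0.
(* Weakening q ^ p to (q / 16 ^ 3) ^ p merges the two factors into one power of exponent m + p. *)
apply: (@le_trans _ _ ((q `^ p)%:E * ((q / 16 ^+ 3) ^+ m)%:E)%E); last first.
  by apply: lee_wpmul2l cap; rewrite lee_fin powR_ge0.
rewrite -EFinM lee_fin powRD; last first.
  by apply/implyP => _; rewrite gt_eqF// divr_gt0.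
have qk0 : 0 <= q / 16 ^+ 3 := divr_ge0 (ltW q0) (ltW k0).
rewrite powR_mulrn// mulrC; apply: ler_wpM2r; first by rewrite exprn_ge0.
apply: ge0_ler_powR; rewrite ?nnegrE ?(ltW p0) ?(ltW q0)//.
by rewrite ler_pdivrMr// ler_peMr ?(ltW q0)// exprn_ege1// ler1n.
Qed.

Notation K := (poweR (MK p (@sphere_probability R m.+1) (empirical w)) (p / (m%:R + p))).

Lemma laguerre_cell_radius_le l (x : 'rV[R]_m.+1) : laguerre_cell p w lam l x ->
  ((enorm (x - w l))%:E <= (16 ^+ 3 * N)%:E * K)%E.
Proof.
move=> cx; have p0 : 0 < p by exact: lt_trans p1.
have mp0 : 0 < m%:R + p by rewrite ltr_wpDl.
have k0 : 0 < 16 ^+ 3 :> R by rewrite exprn_gt0.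
have N0 : 0 < N by rewrite ltr0n addn_gt0 M0.
have kN0 : 0 < 16 ^+ 3 * N by rewrite mulr_gt0.
have [->|xw] := eqVneq x (w l).
  by rewrite subrr enorm0 mule_ge0 ?poweR_ge0// lee_fin ltW.
set q := enorm (x - w l) / N / 16 ^+ 3.
have q0 : 0 <= q by rewrite !divr_ge0 ?enorm_ge0 ?(ltW N0) ?(ltW k0).
suff qK : (q%:E <= K)%E.
  apply: (@le_trans _ _ ((16 ^+ 3 * N)%:E * q%:E)%E); last first.
    by apply: lee_wpmul2l => //; rewrite lee_fin ltW.
  rewrite -EFinM lee_fin (_ : _ * q = enorm (x - w l))//.
  rewrite /q mulrC mulrA divfK ?gt_eqF// divfK ?gt_eqF//.
(* The bound holds for the cost of every coupling, hence for the infimum; raising it to the power p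
   / (m + p) afterwards avoids exchanging a power with the infimum. *)
have QM : ((q `^ ((m%:R + p) / p))%:E <= MK p (@sphere_probability R m.+1) (empirical w))%E.
  apply: le_ereal_inf_tmp => _ [g gc <-].
  have := coupling_laguerre_cost_ge gc cx xw; rewrite -/q => h.
  rewrite powRrM -poweR_EFin; apply: gt0_ler_poweR => //.
  - by rewrite invr_ge0 ltW.
  - by rewrite in_itv/= leey andbT lee_fin powR_ge0.
  - rewrite in_itv/= leey andbT; apply: integral_ge0 => z _.
    by rewrite lee_fin powR_ge0.
have -> : q%:E = poweR (q `^ ((m%:R + p) / p))%:E (p / (m%:R + p)).
  rewrite poweR_EFin -powRrM (_ : _ / _ * _ = 1) ?powRr1//.
  by field; rewrite !gt_eqF.
apply: gt0_ler_poweR => //.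
- by rewrite divr_ge0 ?ltW.
- by rewrite in_itv/= leey andbT lee_fin powR_ge0.
- rewrite in_itv/= leey andbT; apply: le_trans QM.
  by rewrite lee_fin powR_ge0.
Qed.

Lemma diam_laguerre_cell_le l (c : R) : 2 * (16 ^+ 3 * N) <= c ->
  (diam (laguerre_cell p w lam l) <= c%:E * K)%E.
Proof.
move=> hc; have k0 : 0 <= 16 ^+ 3 * N by rewrite mulr_ge0 ?exprn_ge0.
have K0 : (0 <= K)%E by exact: poweR_ge0.
apply: (@le_trans _ _ ((2 * (16 ^+ 3 * N))%:E * K)%E); last first.
  by apply: lee_wpmul2r => //; rewrite lee_fin.
have -> : ((2 * (16 ^+ 3 * N))%:E * K = (16 ^+ 3 * N)%:E * K + (16 ^+ 3 * N)%:E * K)%E.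
  by rewrite mulr2n mulrDl mul1r EFinD ge0_muleDl.
apply: ge_ereal_sup => _ [->|[a ca [b cb <-]]].
  by rewrite adde_ge0// mule_ge0.
apply: (@le_trans _ _ ((enorm (a - w l))%:E + (enorm (b - w l))%:E)%E).
  by rewrite -EFinD lee_fin (enormBC b) enorm_triangle.
by apply: leeD; exact: laguerre_cell_radius_le.
Qed.

End cell_diameter.

Theorem theorem1p3 (R : realType) (p : R) (hp : 1 < p) :
  exists2 b : R, 0 < b < 4^-1 &
  forall (n L : nat) (w : 'I_L -> 'rV[R]_n),
    (2 <= n)%N -> (1 <= L)%N ->
    injective w -> (forall l, sphere R n (w l)) ->
  exists lambda : 'I_L -> R,
    let D := laguerre_cell p w lambda in
    [/\ \bigcup_l D l = sphere R n,
        forall l k, l != k -> sphere_probability (D l `&` D k) = 0%E,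
        forall l, sphere_probability (D l) = (L%:R^-1)%:E &
        (\big[maxe/-oo]_(l < L) diam (D l) <=
          (2 / b *
            (fine (hausdorff_measure (n - 2) (sphere R n.-1)) / (n - 1)%:R *
              (b * Num.sqrt (1 - b ^+ 2) / asin b) ^+ (n - 2))
            `^ (- ((n - 1)%:R + p)^-1))%:E *
          poweR (MK p (@sphere_probability R n) (empirical w))
                (p / ((n - 1)%:R + p)))%E].
Proof.
have p0 : 0 < p by exact: lt_trans hp.
have [M M0 chain] := chain_length_exists hp.
have N2 : 2 <= (M + M)%:R :> R by rewrite ler_nat addnn -muln2 leq_pmull.
have N0 : 0 < (M + M)%:R :> R by exact: lt_le_trans N2.
have k0 : 0 < 16 ^+ 4 :> R by rewrite exprn_gt0.
have k1 : 4 < 16 ^+ 4 :> R by rewrite (@lt_le_trans _ _ 16) ?ltr_nat// ler_eXnr// ler1n.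
(* With this choice 2 / b times the lower bound 1 / 16 for the other factor is exactly 2 * 16 ^ 3 *
   N, with N = M + M, the constant of [diam_laguerre_cell_le]. *)
pose b : R := (16 ^+ 4 * (M + M)%:R)^-1.
have b0 : 0 < b by rewrite invr_gt0 mulr_gt0.
have b4 : b < 4^-1.
  rewrite ltf_pV2 ?posrE ?mulr_gt0//.
  by rewrite (lt_le_trans k1)// ler_peMr ?(ltW k0)// (le_trans _ N2)// ler1n.
exists b; first by rewrite b0.
(* Here n = k + 2 and m = n - 1 is the dimension of the sphere; 2 <= n becomes 0 < m. *)
move=> [//|[//|k]] L w _ L0 wI wS; pose m := k.+1; have m0 : (0 < m)%N by [].
have [lam lam0 lam_mass] := equal_area_weights m0 hp wI wS L0.
exists lam => D; split.
- exact: bigcup_laguerre_cell.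
- move=> l j lj; rewrite sphere_probabilityE; first exact: laguerre_cell_tie.
  by apply: measurableI; exact: measurable_laguerre_cell.
- move=> l; rewrite sphere_probabilityE; last exact: measurable_laguerre_cell.
  by rewrite -strict_laguerre_cell_mass.
have -> : (k.+2 - 2)%N = m.-1 by rewrite /m subn2.
have -> : (k.+2 - 1)%N = m by rewrite subn1.
have F := @diam_factor_ge R b p m _ p0 m0.
apply/bigmax_leP; split => [|l _]; first exact: leNye.
apply: (diam_laguerre_cell_le m0 M0) => //.
have b1 : 0 < b < 1 by rewrite b0 (lt_trans b4)// invf_lt1// ltr1n.
apply: (@le_trans _ _ (2 / b * 16^-1)).
  rewrite /b invrK [16 ^+ 4]exprSr; set c := 16 ^+ 3; set d := (M + M)%:R.
  by rewrite (_ : 2 * _ / 16 = 2 * (c * d))//; field.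
apply: ler_wpM2l; last exact: F.
by rewrite divr_ge0// ltW.
Qed.
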